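(* Let $X$ be a Hausdorff space and let $p,q:X\times X\to\mathbb{C}$ be continuous positive definite kernels. Consider the three cases: (a) $p$ is SPD, and $\mathcal{N}(X)=\mathcal{M}_{\delta}(X)$; (b) $p$ is universal, and $\mathcal{N}(X)=\mathcal{M}_{c}(X)$; (c) $p$ is ISPD, and $\mathcal{N}(X)=\mathcal{M}(X)$. In each case, a measure $\lambda\in\mathcal{N}(X)$ satisfies $$\int_{X}\int_{X}p(x,y)q(x,y)\,d\lambda(x)\,d\overline{\lambda}(y)=0$$ if and only if $$\int_{A}\int_{A}q(x,y)\,d\lambda(x)\,d\overline{\lambda}(y)=0\quad\text{for every Borel set }A\subset X.$$ In particular, in case (a), (b), (c) respectively, the kernel $(p\odot q)(x,y):=p(x,y)q(x,y)$ is SPD, universal, ISPD if and only if $q(x,x)>0$ for every $x\in X$.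
   Context: A kernel $K:X\times X\to\mathbb{C}$ is positive definite if $\sum_{\mu,\nu=1}^{n}c_{\mu}\overline{c_{\nu}}K(x_{\mu},x_{\nu})\ge 0$ for all finitely many distinct points $x_{\mu}\in X$ and scalars $c_{\mu}\in\mathbb{C}$, and strictly positive definite (SPD) if moreover the sum vanishes only when all $c_{\mu}=0$. Its reproducing kernel Hilbert space $\mathcal{H}_{K}$ is the Hilbert space of functions $F:X\to\mathbb{C}$ that contains $K_{y}:=K(\cdot,y)$ for every $y\in X$, satisfies $\langle F,K_{y}\rangle_{\mathcal{H}_{K}}=F(y)$, and in which $\mathrm{span}\{K_{y}:y\in X\}$ is dense. $C(X)$ denotes the continuous complex-valued functions on $X$. $\mathcal{M}(X)$ denotes the finite complex-valued Radon measures on $X$ (complex Borel measures $\lambda$ with $|\lambda|$ finite and, for every Borel $E$, $|\lambda|(E)=\sup\{|\lambda|(K):K\subset E\text{ compact}\}=\inf\{|\lambda|(U):U\supset E\text{ open}\}$); $\mathcal{M}_{c}(X)\subset\mathcal{M}(X)$ those of compact support; $\mathcal{M}_{\delta}(X)$ the finite combinations $\sum_{\mu}c_{\mu}\delta_{x_{\mu}}$ of point masses with complex coefficients. A positive definite kernel $K$ on $X$ is universal if $\mathcal{H}_{K}\subset C(X)$ and for every compact $\mathcal{C}\subset X$ the restrictions to $\mathcal{C}$ of functions of $\mathcal{H}_{K}$ are uniformly dense in $C(\mathcal{C})$; when $\mathcal{H}_{K}\subset C(X)$, this is equivalent to: the only $\lambda\in\mathcal{M}_{c}(X)$ with $\int_{X}\int_{X}K(x,y)\,d\lambda(x)\,d\overline{\lambda}(y)=0$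 is the zero measure. A bounded positive definite kernel $K$ with $\mathcal{H}_{K}\subset C(X)$ is integrally strictly positive definite (ISPD) if the only $\lambda\in\mathcal{M}(X)$ with $\int_{X}\int_{X}K(x,y)\,d\lambda(x)\,d\overline{\lambda}(y)=0$ is the zero measure.
   Formalization: In case (c) the kernel q is additionally assumed bounded; for unbounded q the integrals of q over A need not exist for every finite Radon measure, and the claim of case (c) can fail. *)

(* Defs.v *)
From HB Require Import structures.
From mathcomp Require Import all_boot all_order all_algebra.
From mathcomp Require Import all_classical all_reals all_analysis.
From mathcomp.real_closed Require Import complex.

Set Implicit Arguments.
Unset Strict Implicit.
Unset Printing Implicit Defensive.
Import Order.TTheory GRing.Theory Num.Theory.
Import numFieldNormedType.Exports.
Local Open Scope classical_set_scope.
Local Open Scope ring_scope.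
Local Open Scope complex_scope.

(* R[i] carries its metric topology through the alias R[i]^o. *)
Definition ccontinuous (R : realType) (Y : topologicalType) (f : Y -> R[i]) :=
  continuous (f : Y -> R[i]^o).

Definition ccontinuous_on (R : realType) (Y : topologicalType) (C : set Y)
    (f : Y -> R[i]) :=
  {within C, continuous (f : Y -> R[i]^o)}.

Section Kernels.
Variables (R : realType) (X : ptopologicalType).
Implicit Types K p q : X -> X -> R[i].

Definition kernel_continuous K := ccontinuous (fun z : X * X => K z.1 z.2).

Definition kernel_bounded K := exists M : R, forall x y, `|K x y| <= M%:C.

Definition kernel_mul p q : X -> X -> R[i] := fun x y => p x y * q x y.

Definition kernel_sum K n (c : 'I_n -> R[i]) (x : 'I_n -> X) : R[i] :=
  \sum_(i < n) \sum_(j < n) c i * (c j)^* * K (x i) (x j).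

(* In R[i], 0 <= z means that z is real and nonnegative. *)
Definition positive_definite K := forall n (c : 'I_n -> R[i]) (x : 'I_n -> X),
  injective x -> 0 <= kernel_sum K c x.

Definition spd K := positive_definite K /\
  forall n (c : 'I_n -> R[i]) (x : 'I_n -> X),
    injective x -> kernel_sum K c x = 0 -> forall i, c i = 0.

(* H, with the inner product ip (relevant only on H), is the reproducing
   kernel Hilbert space of K.  ip F F is the squared norm of F. *)
Record is_rkhs K (H : set (X -> R[i]))
    (ip : (X -> R[i]) -> (X -> R[i]) -> R[i]) : Prop := IsRKHS {
  rkhs_zero : H (fun=> 0) ;
  rkhs_linear : forall a F G, H F -> H G -> H (fun x => a * F x + G x) ;
  rkhs_ip_linear : forall a F G L, H F -> H G -> H L ->
    ip (fun x => a * F x + G x) L = a * ip F L + ip G L ;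
  rkhs_ip_conj : forall F G, H F -> H G -> ip G F = (ip F G)^* ;
  rkhs_ip_pos : forall F, H F -> F <> (fun=> 0) -> 0 < ip F F ;
  rkhs_complete : forall u : nat -> X -> R[i], (forall n, H (u n)) ->
    (forall e : R, 0 < e -> exists N : nat, forall m n : nat,
      (N <= m)%N -> (N <= n)%N -> ip (u m \- u n) (u m \- u n) < e%:C) ->
    exists2 F, H F &
      forall e : R, 0 < e -> exists N : nat, forall n : nat,
        (N <= n)%N -> ip (u n \- F) (u n \- F) < e%:C ;
  rkhs_section : forall y, H (K ^~ y) ;
  rkhs_reproducing : forall F y, H F -> ip F (K ^~ y) = F y ;
  rkhs_dense : forall F (e : R), H F -> 0 < e ->
    exists n (c : 'I_n -> R[i]) (y : 'I_n -> X),
      let D := F \- (fun x => \sum_(i < n) c i * K x (y i)) in ip D D < e%:C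
}.

(* A positive definite kernel has exactly one RKHS, so for such K this is the
   underlying set of functions of the space H_K. *)
Definition rkhs K : set (X -> R[i]) :=
  [set F | exists H ip, is_rkhs K H ip /\ H F].

(* Functions on C are given by functions on X, whose values off C do not
   matter. *)
Definition universal K := [/\ positive_definite K,
  rkhs K `<=` @ccontinuous R X &
  forall C : set X, compact C -> forall f : X -> R[i], ccontinuous_on C f ->
    forall e : R, 0 < e ->
    exists2 F, rkhs K F & forall x, C x -> `|F x - f x| < e%:C].

End Kernels.

(* The measurable sets of borel X are the Borel sets of X. *)
Notation borel X := (g_sigma_algebraType (@open X)).

Section IntegralWrtCharge.
Variables (R : realType) (d : measure_display) (T : measurableType d).
Variable nu : {charge set T -> \bar R}.

Lemma hahn_sig : {PN | hahn_decomposition nu PN.1 PN.2}.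
Proof.
apply: cid; have [P [N PN]] := Hahn_decomposition nu.
by exists (P, N).
Qed.

(* Any other Hahn decomposition gives the same two measures. *)
Definition charge_pos : {measure set T -> \bar R} :=
  jordan_pos (svalP hahn_sig).

Definition charge_neg : {measure set T -> \bar R} :=
  jordan_neg (svalP hahn_sig).

Definition charge_integral (A : set T) (f : T -> R) : R :=
  \int[charge_pos]_(x in A) f x - \int[charge_neg]_(x in A) f x.

End IntegralWrtCharge.

(* A complex Borel measure, as its real and imaginary parts, which are finite
   signed measures. *)
Record complex_measure (R : realType) (X : ptopologicalType) := ComplexMeasure {
  cm_re : {charge set (borel X) -> \bar R} ;
  cm_im : {charge set (borel X) -> \bar R} }.

Section ComplexMeasures.
Variables (R : realType) (X : ptopologicalType).
Implicit Types (lam : complex_measure R X) (A E : set (borel X)).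
Implicit Types K : X -> X -> R[i].

Definition cm_val lam A : R[i] := fine (cm_re lam A) +i* fine (cm_im lam A).

Definition cm_is_zero lam := forall A, measurable A -> cm_val lam A = 0.

Definition cm_conj lam : complex_measure R X :=
  ComplexMeasure (cm_re lam) (copp (cm_im lam)).

Definition cm_integral lam A (f : X -> R[i]) : R[i] :=
  (charge_integral (cm_re lam) A (fun x => complex.Re (f x)) -
   charge_integral (cm_im lam) A (fun x => complex.Im (f x))) +i*
  (charge_integral (cm_re lam) A (fun x => complex.Im (f x)) +
   charge_integral (cm_im lam) A (fun x => complex.Re (f x))).

Definition double_integral K lam A : R[i] :=
  cm_integral (cm_conj lam) A (fun y => cm_integral lam A (fun x => K x y)).

Definition cm_variation lam E : \bar R :=
  ereal_sup [set (\sum_(0 <= n <oo) (complex.Re `|cm_val lam (F n)|)%:E)%E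
            | F in [set F : (set (borel X))^nat |
                [/\ forall n, measurable (F n), trivIset setT F &
                    \bigcup_n F n = E]]].

(* The class M(X); finiteness of the variation is automatic. *)
Definition radon lam := forall E, measurable E ->
  cm_variation lam E = ereal_sup [set cm_variation lam C
                       | C in [set C : set X | compact C /\ C `<=` E]] /\
  cm_variation lam E = ereal_inf [set cm_variation lam U
                       | U in [set U : set X | open U /\ E `<=` U]].

Definition cm_support lam : set X :=
  [set x | forall U : set X, open U -> U x -> (0 < cm_variation lam U)%E].

(* The class M_c(X). *)
Definition radon_compact lam := radon lam /\ compact (cm_support lam).

(* The class M_delta(X). *)
Definition finite_discrete lam :=
  exists n (c : 'I_n -> R[i]) (x : 'I_n -> X),
    forall A, measurable A -> cm_val lam A = \sum_(i < n) c i * (\1_A (x i))%:C.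

Definition ispd K := [/\ kernel_bounded K, positive_definite K,
  rkhs K `<=` @ccontinuous R X &
  forall lam, radon lam -> double_integral K lam setT = 0 -> cm_is_zero lam].

(* The equivalence asserted for all measures of a class N(X). *)
Definition null_form_equiv (N : complex_measure R X -> Prop)
    (p q : X -> X -> R[i]) :=
  forall lam, N lam ->
    (double_integral (kernel_mul p q) lam setT = 0 <->
     forall A, measurable A -> double_integral q lam A = 0).

End ComplexMeasures.

(* Main.v *)
Require Import Defs.
From mathcomp Require Import all_boot all_order all_algebra.
From mathcomp Require Import all_classical all_reals all_analysis.
From mathcomp.real_closed Require Import complex.
From mathcomp Require Import measurable_realfun ring lra.
Set Implicit Arguments.
Unset Strict Implicit.
Unset Printing Implicit Defensive.
Import Order.TTheory GRing.Theory Num.Theory.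
Import numFieldNormedType.Exports.
Local Open Scope classical_set_scope.
Local Open Scope ring_scope.
(** Write [H_K] for the reproducing kernel Hilbert space of [K].  If [K] is
    continuous with bounded diagonal on a set carrying [lam], then
    [F |-> int_A F dlam] is a bounded functional on [H_K]; by Riesz it is
    [F |-> <F, g>] with [g y] the conjugate of [int_A K(x, y) dlam(x)], and the
    double integral of [K] over [A] equals [<g, g>].  Hence the double integral
    vanishes iff [int_A F dlam = 0] for all [F] in [H_K].

    A function [f] lies in [H_K] iff [c K(x, y) - f(x) conj(f(y))] is positive
    definite for some [c >= 0], so by Schur's product theorem [F G] lies in the
    space of [p q] whenever [F] lies in [H_p] and [G] in [H_q].  If the double
    integral of [p q] vanishes, then [int F q(., z) dlam = 0] for all [F] in
    [H_p], and each of the three hypotheses on [p] turns this into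
    [q(., z) lam = 0], i.e. into the vanishing of the double integrals of [q]
    over all Borel sets.  Conversely, [q(., y) lam = 0] for all [y] makes the
    inner integral [int p(x, y) q(x, y) dlam(x)] vanish. *)

(** * Positive semidefinite kernels *)

(** The Borel sets of a product need not be generated by rectangles, so Fubini is not at hand for a
    kernel that is merely continuous; written as [<g, g>], the double integral involves only
    functions of one variable. The set [rkhs K] refers to the existence of a Hilbert space, which
    therefore has to be constructed; domination then decides membership without any inner product.
    Members of [H_K] may be unbounded on [X], so the estimates take place on a carrier [S] of the
    measure where the diagonals are bounded: a finite set, the compact support, or [X] itself.

    The hypotheses on [p] act in different ways. In case (a) the numbers lam({x}) q(x, z) are
    coefficients at which the form of [p] vanishes. In case (b) indicators must be approximated by
    continuous functions; Urysohn functions need not exist on a Hausdorff space, and truncated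
    members of [H_p] separate compact sets instead. In case (c) the measure q(., z) lam is again
    Radon, and integral strictness of [p] is applied to it. *)

Section PositiveSemidefinite.
Variable C : numClosedFieldType.

(** For [g > 0] the choice [z = - b / g] minimises the quadratic expression. The Cauchy-Schwarz
    inequalities below come from it, and so does the pointwise error bound in [minimizer_hilb]. *)
Lemma quadratic_cauchy_schwarz (a b g : C) : 0 <= g ->
  (forall z, 0 <= a + z^* * b + z * b^* + z * z^* * g) -> `|b| ^+ 2 <= a * g.
Proof.
move=> g0 H; rewrite normCK.
have a0 : 0 <= a by have := H 0; rewrite rmorph0 !mul0r !addr0.
have [->|bn0] := eqVneq b 0; first by rewrite mul0r mulr_ge0.
have t0 : 0 < b * b^* by rewrite mul_conjC_gt0.
move: g0; rewrite le_eqVlt => /predU1P[g0|g0].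
  (* With [g = 0] there is no quadratic term, and this [r] makes the value at [- r * b] equal to
     [- (a + 2)], which is negative. *)
  pose r := (a + 1) / (b * b^*).
  have r0 : 0 <= r by rewrite divr_ge0 ?addr_ge0 // ltW.
  have := H (- r * b); rewrite rmorphM rmorphN /= (geC0_conj r0) -g0 mulr0 addr0.
  have -> : a + - r * b^* * b + - r * b * b^* = - (a + 2).
    by rewrite /r; field; rewrite ?conjC_eq0 bn0.
  by rewrite oppr_ge0 => /(lt_le_trans (ltr_wpDl a0 (ltr0n _ 2))); rewrite ltxx.
have gn0 : g != 0 by rewrite gt_eqF.
have := H (- b / g).
rewrite rmorphM rmorphN fmorphV /= (geC0_conj (ltW g0)).
have -> : a + - b^* / g * b + - b / g * b^* + - b / g * (- b^* / g) * g
   = a - (b * b^*) / g by field.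
by rewrite subr_ge0 ler_pdivrMr.
Qed.

Section Forms.
Variable X : Type.
Implicit Types (K : X -> X -> C) (s t : seq (C * X)) (a c : C) (x y : X).

(* A sequence [s] of pairs (coefficient, point) stands for the finite
   combination of kernel sections [comb K s], and [form K s t] is the inner
   product of two such combinations in the Hilbert space of [K]. *)
Definition form K s t : C :=
  \sum_(u <- s) \sum_(v <- t) u.1 * (v.1)^* * K v.2 u.2.

Definition comb K s x : C := \sum_(u <- s) u.1 * K x u.2.

Definition pairing (f : X -> C) s : C := \sum_(u <- s) (u.1)^* * f u.2.

Definition scale a s := [seq (a * u.1, u.2) | u <- s].

(** Repeated points are allowed here, unlike in [positive_definite], so that combinations can be
    concatenated freely; [merge_points] bridges the two notions. *)
Definition psd K := forall s, 0 <= form K s s.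

Lemma form_nill K t : form K [::] t = 0.
Proof. by rewrite /form big_nil. Qed.

Lemma form_catl K s1 s2 t : form K (s1 ++ s2) t = form K s1 t + form K s2 t.
Proof. by rewrite /form big_cat. Qed.

Lemma form_catr K s t1 t2 : form K s (t1 ++ t2) = form K s t1 + form K s t2.
Proof. by rewrite /form -big_split /=; apply: eq_bigr => u _; rewrite big_cat. Qed.

Lemma form_scalel K a s t : form K (scale a s) t = a * form K s t.
Proof.
rewrite /form big_map mulr_sumr; apply: eq_bigr => u _ /=.
by rewrite mulr_sumr; apply: eq_bigr => v _; rewrite !mulrA.
Qed.

Lemma form_scaler K a s t : form K s (scale a t) = a^* * form K s t.
Proof.
rewrite /form mulr_sumr; apply: eq_bigr => u _ /=.
rewrite big_map mulr_sumr; apply: eq_bigr => v _ /=.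
by rewrite rmorphM; ring.
Qed.

Lemma form_pairing K s t : form K s t = pairing (comb K s) t.
Proof.
rewrite /form /pairing exchange_big; apply: eq_bigr => v _ /=.
by rewrite /comb mulr_sumr; apply: eq_bigr => u _; ring.
Qed.

Lemma form_sing K s a x : form K s [:: (a, x)] = a^* * comb K s x.
Proof. by rewrite form_pairing /pairing big_seq1. Qed.

Lemma form_sing1 K s x : form K s [:: (1, x)] = comb K s x.
Proof. by rewrite form_sing rmorph1 mul1r. Qed.

Lemma comb_sing K x y : comb K [:: (1, x)] y = K y x.
Proof. by rewrite /comb big_seq1 mul1r. Qed.

Lemma comb_cat K s t x : comb K (s ++ t) x = comb K s x + comb K t x.
Proof. by rewrite /comb big_cat. Qed.

Lemma comb_scale K a s x : comb K (scale a s) x = a * comb K s x.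
Proof.
by rewrite /comb big_map mulr_sumr; apply: eq_bigr => u _; rewrite mulrA.
Qed.

Lemma pairing_cat (f : X -> C) s t : pairing f (s ++ t) = pairing f s + pairing f t.
Proof. by rewrite /pairing big_cat. Qed.

Lemma pairing_scale (f : X -> C) a s : pairing f (scale a s) = a^* * pairing f s.
Proof.
rewrite /pairing big_map mulr_sumr; apply: eq_bigr => u _ /=.
by rewrite rmorphM mulrA.
Qed.

Lemma formD K1 K2 s t :
  form (fun x y => K1 x y + K2 x y) s t = form K1 s t + form K2 s t.
Proof.
rewrite /form -big_split; apply: eq_bigr => u _ /=.
by rewrite -big_split; apply: eq_bigr => v _ /=; rewrite mulrDr.
Qed.

Lemma formZ K c s t : form (fun x y => c * K x y) s t = c * form K s t.
Proof.
rewrite /form mulr_sumr; apply: eq_bigr => u _ /=.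
by rewrite mulr_sumr; apply: eq_bigr => v _ /=; ring.
Qed.

Lemma form_rank1 (f : X -> C) s :
  form (fun x y => f x * (f y)^*) s s = `|pairing f s| ^+ 2.
Proof.
rewrite normCK form_pairing /pairing mulr_suml; apply: eq_bigr => v _ /=.
rewrite rmorph_sum -mulrA; congr (_ * _); rewrite /comb mulr_sumr.
by apply: eq_bigr => u _ /=; rewrite rmorphM /= conjCK; ring.
Qed.

Lemma psdD K1 K2 : psd K1 -> psd K2 -> psd (fun x y => K1 x y + K2 x y).
Proof. by move=> p1 p2 s; rewrite formD addr_ge0. Qed.

Lemma psdZ K c : 0 <= c -> psd K -> psd (fun x y => c * K x y).
Proof. by move=> c0 p s; rewrite formZ mulr_ge0. Qed.

Lemma psd_rank1 (f : X -> C) : psd (fun x y => f x * (f y)^*).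
Proof. by move=> s; rewrite form_rank1 exprn_ge0. Qed.

Lemma psd_diag K x : psd K -> 0 <= K x x.
Proof. by move=> pK; have := pK [:: (1, x)]; rewrite form_sing1 comb_sing. Qed.

(** The form on the points [x], [y] with coefficients [1], [a] is real, hence so is its mixed part
    conj(a) K(y, x) + a K(x, y). Comparing [a = 1] with the imaginary unit gives the symmetry. *)
Lemma psd_conj K x y : psd K -> K y x = (K x y)^*.
Proof.
move=> pK; set b := K x y; set b' := K y x.
have H (a : C) : a^* * b' + a * b \is Num.real.
  have := ger0_real (pK [:: (1, x); (a, y)]).
  rewrite /form !(big_cons, big_nil) /= -/b -/b' rmorph1 !(mul1r, mulr1, addr0).
  have /ger0_real rx := psd_diag x pK.
  have /ger0_real ry : 0 <= a * a^* * K y y.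
    by rewrite mulr_ge0 ?mul_conjC_ge0 ?psd_diag.
  move=> r; have -> : a^* * b' + a * b =
    (K x x + a^* * b' + (a * b + a * a^* * K y y)) - K x x - a * a^* * K y y by ring.
  by rewrite !rpredB.
have /CrealP := H 1; have /CrealP := H 'i.
rewrite !(rmorphD, rmorphM) /= !conjCK rmorph1 !mul1r conjCi => Hi H1.
have {}Hi : b'^* - b^* = b - b'.
  apply: (mulfI (neq0Ci C)); rewrite !mulrBr.
  by have := Hi; rewrite !mulNr => ->; rewrite addrC.
apply: (mulIf (x := 2)); first by rewrite pnatr_eq0.
have -> : b' * 2 = (b' + b) - (b - b') by ring.
by rewrite -H1 -Hi; ring.
Qed.

Lemma form_conj K s t : psd K -> form K t s = (form K s t)^*.
Proof.
move=> pK; rewrite /form exchange_big rmorph_sum; apply: eq_bigr => u _ /=.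
rewrite rmorph_sum; apply: eq_bigr => v _ /=.
by rewrite !rmorphM /= conjCK (psd_conj v.2 u.2 pK); ring.
Qed.

Lemma form_cs K s t : psd K -> `|form K s t| ^+ 2 <= form K s s * form K t t.
Proof.
move=> pK; apply: quadratic_cauchy_schwarz => // z.
have := pK (s ++ scale z t).
rewrite !(form_catl, form_catr) !(form_scalel, form_scaler) (form_conj s t pK).
by congr (0 <= _); ring.
Qed.

Lemma comb_cs K s x : psd K -> `|comb K s x| ^+ 2 <= form K s s * K x x.
Proof.
by move=> pK; rewrite -form_sing1 -[K x x]comb_sing -form_sing1 form_cs.
Qed.

(* If [K x x = 0], the quotient is [0] and [schur_compl K x] is [K] itself. *)
Definition schur_compl K x y z := K y z - K y x * (K z x)^* / K x x.

(** This is the kernel of the orthogonal complement of the section at [x]: its form at [s] is <s, s>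
    - |<s, K_x>|^2 / K(x, x), nonnegative by [form_cs]. *)
Lemma psd_schur_compl K x : psd K -> psd (schur_compl K x).
Proof.
move=> pK s; have k0 := psd_diag x pK.
have -> : form (schur_compl K x) s s
    = form K s s - `|form K s [:: (1, x)]| ^+ 2 / K x x.
  transitivity (form (fun y z => K y z +
      (- (K x x)^-1) * (K y x * (K z x)^*)) s s).
    rewrite /form; apply: eq_bigr => u _; apply: eq_bigr => v _ /=.
    by rewrite /schur_compl; ring.
  rewrite formD formZ form_rank1 mulNr mulrC; congr (_ - _ / _).
  rewrite -(norm_conjC (form _ _ _)) -form_conj //.
  congr (`|_| ^+ 2).
  rewrite form_pairing; apply: eq_bigr => u _.
  by rewrite comb_sing.
move: k0; rewrite le_eqVlt => /predU1P[k0|k0].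
  by rewrite -k0 invr0 mulr0 subr0 pK.
rewrite subr_ge0 ler_pdivrMr // (le_trans (form_cs _ _ pK)) //.
by rewrite form_sing1 comb_sing.
Qed.

Lemma schur_compl0 K x y : psd K ->
  schur_compl K x y x = 0 /\ schur_compl K x x y = 0.
Proof.
move=> pK.
suff H z : schur_compl K x z x = 0.
  split=> //; rewrite (psd_conj y x (psd_schur_compl x pK)) H rmorph0 //.
rewrite /schur_compl (geC0_conj (psd_diag x pK)).
have [k0|k0] := eqVneq (K x x) 0; last by rewrite mulfK ?subrr.
have : `|K z x| ^+ 2 <= 0.
  by have := comb_cs [:: (1, x)] z pK; rewrite form_sing1 !comb_sing k0 mul0r.
rewrite -normrX normr_le0 expf_eq0 /= => /eqP ->; rewrite !mul0r subrr //.
Qed.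

(** Induction on the number of points, for all [K2] at once. Split [K2] into its Schur complement at
    the first point and a rank-one kernel: the complement vanishes on the row and column of that
    point, which drops out of the sum, and the rank-one factor is absorbed into the coefficients of
    a form of [K1]. *)
Lemma psdM K1 K2 : psd K1 -> psd K2 -> psd (fun x y => K1 x y * K2 x y).
Proof.
move=> p1 p2 s; elim: s K2 p2 => [|u s IH] K2 p2; first by rewrite form_nill.
pose S := schur_compl K2 u.2; pose x := u.2.
have -> : form (fun x y => K1 x y * K2 x y) (u :: s) (u :: s)
  = form (fun y z => K1 y z * S y z) (u :: s) (u :: s) +
    (K2 x x)^-1 * form (fun y z => K1 y z * (K2 y x * (K2 z x)^*)) (u :: s) (u :: s).
  rewrite -formZ -formD; apply: eq_bigr => v _; apply: eq_bigr => w _.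
  by rewrite /S /schur_compl -/x; ring.
rewrite addr_ge0 //.
  have -> : form (fun y z => K1 y z * S y z) (u :: s) (u :: s)
      = form (fun y z => K1 y z * S y z) s s.
    have Sl z : S u.2 z = 0 by case: (schur_compl0 u.2 z p2).
    have Sr z : S z u.2 = 0 by case: (schur_compl0 u.2 z p2).
    rewrite [in LHS]/form big_cons [X in X + _]big1 ?add0r => [|v _].
      by apply: eq_bigr => v _; rewrite big_cons /= Sl !mulr0 add0r.
    by rewrite Sr !mulr0.
  exact/IH/psd_schur_compl.
rewrite mulr_ge0 ?invr_ge0 ?psd_diag //.
have := p1 [seq (v.1 * (K2 v.2 x)^*, v.2) | v <- u :: s].
congr (0 <= _); rewrite /form big_map; apply: eq_bigr => v _.
by rewrite big_map; apply: eq_bigr => w _ /=; rewrite rmorphM /= conjCK; ring.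
Qed.

(* [dominated K f c] says that [f] lies in the Hilbert space of [K] with
   squared norm at most [c]. *)
Definition dominated K (f : X -> C) c :=
  psd (fun x y => c * K x y - f x * (f y)^*).

Lemma dominatedP K f c :
  dominated K f c <-> forall s, `|pairing f s| ^+ 2 <= c * form K s s.
Proof.
have E s : form (fun x y => c * K x y - f x * (f y)^*) s s
    = c * form K s s - `|pairing f s| ^+ 2.
  rewrite -form_rank1 -formZ -[X in _ = _ - X]mul1r -mulNr -formZ -formD.
  apply: eq_bigr => v _; apply: eq_bigr => w _.
  by rewrite mulN1r.
by split=> H s; have := H s; rewrite E subr_ge0.
Qed.

(** The kernel c d p q - (f g) conj(f g) equals c p (d q - g conj g) + (c p - f conj f) g conj g, a
    sum of two Schur products of positive semidefinite kernels. *)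
Lemma dominatedM p q f g c d : psd p -> psd q -> 0 <= c -> 0 <= d ->
  dominated p f c -> dominated q g d ->
  dominated (fun x y => p x y * q x y) (fun x => f x * g x) (c * d).
Proof.
move=> pp pq c0 d0 df dg.
have := psdD (psdM (psdZ c0 pp) dg) (psdM df (psd_rank1 g)).
rewrite /dominated; congr psd; apply/funext => x; apply/funext => y.
by rewrite rmorphM /=; ring.
Qed.

Lemma dominated_section K x : psd K -> dominated K (K^~ x) (K x x).
Proof.
move=> pK; apply/dominatedP => s.
have -> : pairing (K^~ x) s = (form K s [:: (1, x)])^*.
  rewrite -form_conj // form_pairing.
  by apply: eq_bigr => u _; rewrite comb_sing.
by rewrite norm_conjC (le_trans (form_cs _ _ pK)) // form_sing1 comb_sing mulrC.
Qed.

End Forms.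
End PositiveSemidefinite.

(** * Positive definiteness on distinct points *)

Section PositiveDefinite.
Variables (R : realType) (X : ptopologicalType).
Implicit Types K p q : X -> X -> R[i].

Definition fam n (c : 'I_n -> R[i]) (x : 'I_n -> X) : seq (R[i] * X) :=
  [seq (c i, x i) | i <- index_enum 'I_n].

(** In [kernel_sum] the conjugated coefficient goes with the second argument of [K], in [form] with
    the first; hence the conjugates. *)
Lemma kernel_sum_form K n (c : 'I_n -> R[i]) (x : 'I_n -> X) :
  kernel_sum K c x = form K (fam (fun i => (c i)^*) x) (fam (fun i => (c i)^*) x).
Proof.
rewrite /kernel_sum /form big_map exchange_big; apply: eq_bigr => j _ /=.
by rewrite big_map; apply: eq_bigr => i _ /=; rewrite conjCK; ring.
Qed.

Lemma psd_positive_definite K : psd K -> positive_definite K.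
Proof. by move=> pK n c x _; rewrite kernel_sum_form. Qed.

(** Coefficients of equal points are added up. The identity is stated for every [F] because a form
    is then rewritten in one argument at a time. *)
Lemma merge_points (s : seq (R[i] * X)) : exists n (c : 'I_n -> R[i]) (x : 'I_n -> X),
  injective x /\
  forall F : X -> R[i], \sum_(u <- s) u.1 * F u.2 = \sum_i c i * F (x i).
Proof.
pose l := undup [seq u.2 | u <- s].
exists (size l), (fun i => \sum_(u <- s | u.2 == nth point l i) u.1), (fun i => nth point l i).
split=> [i j /eqP|F].
  by rewrite nth_uniq ?undup_uniq // => /eqP/val_inj.
transitivity (\sum_(x <- l) (\sum_(u <- s | u.2 == x) u.1) * F x); last first.
  by rewrite (big_nth point) big_mkord.
under [RHS]eq_bigr do rewrite mulr_suml big_mkcond.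
rewrite [RHS]exchange_big /=; apply: eq_big_seq => u us.
rewrite (bigD1_seq u.2) ?undup_uniq //= ?eqxx; last first.
  by rewrite mem_undup; apply: map_f.
by rewrite big1 ?addr0 // => x; rewrite eq_sym => /negPf ->.
Qed.

Lemma positive_definite_psd K : positive_definite K -> psd K.
Proof.
move=> pK s; have [n [c [x [xi H]]]] := merge_points s.
have := pK n (fun i => (c i)^*) x xi; rewrite kernel_sum_form.
suff -> : form K (fam (fun i => (c i)^*^*) x) (fam (fun i => (c i)^*^*) x) = form K s s.
  by [].
rewrite [in RHS]/form.
under [in RHS]eq_bigr do under eq_bigr do rewrite -mulrA.
under [in RHS]eq_bigr do rewrite -mulr_sumr.
rewrite (H (fun y => \sum_(v <- s) (v.1)^* * K v.2 y)).
rewrite /form big_map; apply: eq_bigr => i _ /=.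
rewrite big_map.
have Hc y : \sum_(v <- s) (v.1)^* * K v.2 y = \sum_j (c j)^* * K (x j) y.
  apply: (can_inj (@conjCK _)); rewrite !rmorph_sum /=.
  under eq_bigr do rewrite rmorphM /= conjCK.
  by rewrite (H (fun z => (K z y)^*)); apply: eq_bigr => j _; rewrite rmorphM /= conjCK.
rewrite Hc mulr_sumr; apply: eq_bigr => j _ /=.
by rewrite !conjCK mulrA.
Qed.

End PositiveDefinite.

(** * Semi-inner products on spaces of functions *)

Section SemiInnerProduct.
Variables (C : numClosedFieldType) (X : Type).
Variables (H : set (X -> C)) (ip : (X -> C) -> (X -> C) -> C).
Implicit Types F G L : X -> C.

(** Serves three times: for the span of the sections, for its completion, and for any space that
    satisfies [is_rkhs]. *)
Record semi_inner_product : Prop := SemiInnerProduct {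
  sip_zero : H (fun=> 0) ;
  sip_lin : forall a F G, H F -> H G -> H (fun x => a * F x + G x) ;
  sip_linl : forall a F G L, H F -> H G -> H L ->
    ip (fun x => a * F x + G x) L = a * ip F L + ip G L ;
  sip_conj : forall F G, H F -> H G -> ip G F = (ip F G)^* ;
  sip_ge0 : forall F, H F -> 0 <= ip F F }.

Hypothesis S : semi_inner_product.

Lemma sipB F G : H F -> H G -> H (F \- G).
Proof.
move=> HF HG; have := sip_lin S (-1) HG HF.
by congr H; apply/funext => x /=; rewrite mulN1r addrC.
Qed.

Lemma sipZ a F : H F -> H (fun x => a * F x).
Proof.
move=> HF; have := sip_lin S a HF (sip_zero S).
by congr H; apply/funext => x /=; rewrite addr0.
Qed.

Lemma sipBl F G L : H F -> H G -> H L -> ip (F \- G) L = ip F L - ip G L.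
Proof.
move=> HF HG HL; have := sip_linl S (-1) HG HF HL.
rewrite mulN1r addrC => <-; congr (ip _ _).
by apply/funext => x /=; rewrite mulN1r addrC.
Qed.

Lemma sipBr F G L : H F -> H G -> H L -> ip L (F \- G) = ip L F - ip L G.
Proof.
move=> HF HG HL; rewrite (sip_conj S (sipB HF HG) HL) sipBl // rmorphB /=.
by rewrite -!(sip_conj S).
Qed.

Lemma sip0l L : H L -> ip (fun=> 0) L = 0.
Proof.
move=> HL; have := sipBl (sip_zero S) (sip_zero S) HL; rewrite subrr; apply: etrans.
by congr (ip _ _); apply/funext => x /=; rewrite subr0.
Qed.

Lemma sip_linr a F G L : H F -> H G -> H L ->
  ip L (fun x => a * F x + G x) = a^* * ip L F + ip L G.
Proof.
move=> HF HG HL; rewrite (sip_conj S (sip_lin S a HF HG) HL).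
by rewrite (sip_linl S) // rmorphD rmorphM /= -!(sip_conj S).
Qed.

Lemma sip_cs F G : H F -> H G -> `|ip F G| ^+ 2 <= ip F F * ip G G.
Proof.
move=> HF HG; apply: quadratic_cauchy_schwarz => [|z]; first exact: sip_ge0.
have := sip_ge0 S (sip_lin S z HG HF).
rewrite (sip_linl S) ?sip_linr //; try exact: sip_lin.
by rewrite (sip_conj S HF HG); congr (0 <= _); ring.
Qed.

Definition ipnorm F := sqrtC (ip F F).

Lemma ipnorm_ge0 F : H F -> 0 <= ipnorm F.
Proof. by move=> HF; rewrite sqrtC_ge0 sip_ge0. Qed.

Lemma ip_le_norm F G : H F -> H G -> `|ip F G| <= ipnorm F * ipnorm G.
Proof.
move=> HF HG; have hF := ipnorm_ge0 HF; have hG := ipnorm_ge0 HG.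
rewrite -(@ler_pXn2r _ 2) // ?nnegrE ?mulr_ge0 //.
by rewrite exprMn !sqrtCK sip_cs.
Qed.

Lemma ipnormD F G : H F -> H G -> ipnorm (fun x => F x + G x) <= ipnorm F + ipnorm G.
Proof.
move=> HF HG; have hF := ipnorm_ge0 HF; have hG := ipnorm_ge0 HG.
have E : (fun x => F x + G x) = (fun x => 1 * F x + G x).
  by apply/funext => x; rewrite mul1r.
have HFG : H (fun x => F x + G x) by rewrite E; exact: sip_lin.
rewrite -(@ler_pXn2r _ 2) // ?nnegrE ?addr_ge0 ?ipnorm_ge0 //.
have -> : ipnorm (fun x => F x + G x) ^+ 2 = ip F F + (ip F G + ip G F) + ip G G.
  by rewrite sqrtCK E (sip_linl S) ?sip_linr // -?E // rmorph1; ring.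
rewrite sqrrD !sqrtCK.
rewrite lerD2r lerD2l.
have r : ip F G + ip G F \is Num.real.
  by apply/CrealP; rewrite rmorphD /= -!(sip_conj S) // addrC.
apply: le_trans (real_ler_norm r) _; apply: le_trans (ler_normD _ _) _.
rewrite (sip_conj S HF HG) norm_conjC -mulr2n lerMn2r /=.
exact: ip_le_norm.
Qed.

Lemma ipnormZ a F : H F -> ipnorm (fun x => a * F x) = `|a| * ipnorm F.
Proof.
move=> HF; have E : (fun x => a * F x) = (fun x => a * F x + (fun=> 0) x).
  by apply/funext => x; rewrite addr0.
have H0 := sip_zero S.
have -> : ipnorm (fun x => a * F x) = sqrtC (`|a| ^+ 2 * ip F F).
  have HE : H (fun x => a * F x + (fun=> 0) x) by exact: sip_lin.
  congr sqrtC; rewrite E (sip_linl S) // (sip0l HE) addr0 (sip_linr a HF H0 HF).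
  by rewrite (sip_conj S H0 HF) (sip0l HF) rmorph0 addr0 normCK mulrA.
by rewrite sqrtCM ?nnegrE ?exprn_ge0 ?(sip_ge0 S) // sqrCK.
Qed.

Lemma ipnormBC F G : H F -> H G -> ipnorm (F \- G) = ipnorm (G \- F).
Proof.
move=> HF HG; rewrite /ipnorm !(sipBl, sipBr) //; try exact: sipB.
by congr sqrtC; ring.
Qed.

Lemma ipnorm_trans F G L : H F -> H G -> H L ->
  ipnorm (F \- G) <= ipnorm (F \- L) + ipnorm (L \- G).
Proof.
move=> HF HG HL; have := ipnormD (sipB HF HL) (sipB HL HG).
suff -> : (fun x => (F \- L) x + (L \- G) x) = F \- G by [].
by apply/funext => x /=; ring.
Qed.

End SemiInnerProduct.

(** * Construction of the reproducing kernel Hilbert space *)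

Section ScalarLimits.
Variable C : numFieldType.
Implicit Types (u v : nat -> C) (l e : C).

Lemma cvg_natP u l : u n @[n --> \oo] --> l <->
  forall e, 0 < e -> exists N, forall n, (N <= n)%N -> `|u n - l| < e.
Proof.
split=> [/cvgrPdist_lt H e e0|H].
  have [N _ HN] := H e e0; exists N => n Nn.
  by rewrite distrC; apply: HN.
apply/cvgrPdist_lt => e e0; have [N HN] := H e e0.
by exists N => // n /= Nn; rewrite distrC; apply: HN.
Qed.

Lemma cvg_nat_unique u l l' :
  u n @[n --> \oo] --> l -> u n @[n --> \oo] --> l' -> l = l'.
Proof. by apply: cvg_unique; exact: norm_hausdorff. Qed.

(** The order of [C] is only partial. The inequality passes to the limit in the form
    [|e - u n| = e - u n], an equation between continuous expressions. *)
Lemma cvg_nat_le u l e N : (forall n, (N <= n)%N -> u n <= e) ->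
  u n @[n --> \oo] --> l -> l <= e.
Proof.
move=> H ul.
have c1 : (e - u n) @[n --> \oo] --> e - l by apply: cvgB => //; exact: cvg_cst.
have c2 : `|e - u n| @[n --> \oo] --> `|e - l| by exact: cvg_norm c1.
have : `|e - l| = e - l.
  apply: cvg_nat_unique c2 _; apply/cvg_natP => d d0.
  have /cvg_natP/(_ d d0)[M HM] := c1.
  exists (maxn N M) => n; rewrite geq_max => /andP[Nn Mn].
  by rewrite [`|e - u n|]ger0_norm ?subr_ge0 ?H ?HM.
by rewrite -subr_ge0 => <-.
Qed.

Lemma cvg_sqz0 u e : (forall d, 0 < d -> exists N, forall n, (N <= n)%N -> `|u n| <= e * d) ->
  0 <= e -> u n @[n --> \oo] --> (0 : C).
Proof.
move=> H e0; apply/cvg_natP => d d0.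
have e1 : 0 < e + 1 by rewrite ltr_wpDl.
have [|N HN] := H (d / (e + 1)); first by rewrite divr_gt0.
exists N => n /HN; rewrite subr0 => /le_lt_trans; apply.
by rewrite mulrCA gtr_pMr // ltr_pdivrMr // mul1r ltrDl.
Qed.

End ScalarLimits.

Lemma cvg_conj (C : numClosedFieldType) (u : nat -> C) (l : C) : u n @[n --> \oo] --> l -> (u n)^* @[n --> \oo] --> l^*.
Proof.
move=> /cvg_natP H; apply/cvg_natP => e e0; have [N HN] := H e e0.
by exists N => n /HN; rewrite -rmorphB norm_conjC.
Qed.

Section Completion.
Variables (C : numClosedFieldType) (X : choiceType).
(** The construction runs over an abstract field; this hypothesis and [harmonic] below are the
    analytic facts about the complex numbers that it takes as given. They are supplied by
    [complex_complete] and [complex_harmonic]. *)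
Hypothesis complete : forall u : nat -> C,
  (forall e : C, 0 < e -> exists N, forall m n, (N <= m)%N -> (N <= n)%N ->
    `|u m - u n| < e) -> exists l : C, u n @[n --> \oo] --> l.
Variable K : X -> X -> C.
Hypothesis pK : psd K.
Implicit Types (F G L : X -> C) (u v : nat -> X -> C).

Definition span F := exists s, F = comb K s.

Definition span_ip F G : C :=
  form K (xget [::] [set s | F = comb K s]) (xget [::] [set s | G = comb K s]).

(** Independence of the chosen representations: [form K s t] depends on [s] only through [comb K s],
    by [form_pairing], and likewise on [t] by conjugate symmetry. *)
Lemma span_ipE s t : span_ip (comb K s) (comb K t) = form K s t.
Proof.
rewrite /span_ip; set s' := xget _ _; set t' := xget _ _.
have Es : comb K s = comb K s'.
  exact: (@xgetPex _ [::] [set s0 | comb K s = comb K s0] (ex_intro _ s erefl)).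
have Et : comb K t = comb K t'.
  exact: (@xgetPex _ [::] [set s0 | comb K t = comb K s0] (ex_intro _ t erefl)).
rewrite form_pairing -Es -form_pairing form_conj // form_pairing -Et.
by rewrite -form_pairing -form_conj.
Qed.

Lemma span_sip : semi_inner_product span span_ip.
Proof.
have lin a s t : (fun x => a * comb K s x + comb K t x) = comb K (scale a s ++ t).
  by apply/funext => x; rewrite comb_cat comb_scale.
split.
- by exists [::]; apply/funext => x; rewrite /comb big_nil.
- by move=> a _ _ [s ->] [t ->]; rewrite lin; eexists.
- move=> a _ _ _ [s ->] [t ->] [r ->].
  by rewrite lin !span_ipE form_catl form_scalel.
- by move=> _ _ [s ->] [t ->]; rewrite !span_ipE form_conj.
- by move=> _ [s ->]; rewrite span_ipE pK.
Qed.

Lemma span_section y : span (K^~ y).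
Proof. by exists [:: (1, y)]; apply/funext => x; rewrite comb_sing. Qed.

Lemma span_reproducing F y : span F -> span_ip F (K^~ y) = F y.
Proof.
move=> [s ->]; have -> : K^~ y = comb K [:: (1, y)].
  by apply/funext => x; rewrite comb_sing.
by rewrite span_ipE form_sing1.
Qed.

Local Notation nrm := (ipnorm span_ip).

Definition span_cauchy u := forall e, 0 < e ->
  exists N, forall m n, (N <= m)%N -> (N <= n)%N -> nrm (u m \- u n) < e.

Definition represents u F := [/\ forall n, span (u n), span_cauchy u &
  forall x, u n x @[n --> \oo] --> F x].

Lemma span_cauchy_bounded u : (forall n, span (u n)) -> span_cauchy u ->
  exists M N, 0 <= M /\ forall n, (N <= n)%N -> nrm (u n) <= M.
Proof.
move=> Hu /(_ 1 ltr01)[N HN].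
exists (1 + nrm (u N)), N; split.
  by rewrite addr_ge0 //; apply: ipnorm_ge0 span_sip _ _.
move=> n Nn.
have := ipnormD span_sip (sipB span_sip (Hu n) (Hu N)) (Hu N).
have -> : (fun x => (u n \- u N) x + u N x) = u n.
  by apply/funext => x /=; rewrite subrK.
by move=> /le_trans; apply; rewrite lerD2r ltW // HN.
Qed.

Lemma span_cauchyB u v : (forall n, span (u n)) -> (forall n, span (v n)) ->
  span_cauchy u -> span_cauchy v -> span_cauchy (fun n => u n \- v n).
Proof.
move=> Hu Hv cu cv e e0; have e2 : 0 < e / 2 by rewrite divr_gt0.
have [N HN] := cu _ e2; have [M HM] := cv _ e2.
exists (maxn N M) => m n; rewrite !geq_max => /andP[Nm Mm] /andP[Nn Mn].
have -> : (u m \- v m) \- (u n \- v n) =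
    (fun x => (u m \- u n) x + (v n \- v m) x).
  by apply/funext => x /=; ring.
apply: le_lt_trans (ipnormD span_sip (sipB span_sip (Hu _) (Hu _)) (sipB span_sip (Hv _) (Hv _))) _.
by rewrite [ltRHS]splitr ltrD ?HN ?HM.
Qed.

Lemma span_ip_cvg u v : (forall n, span (u n)) -> (forall n, span (v n)) ->
  span_cauchy u -> span_cauchy v ->
  exists l : C, span_ip (u n) (v n) @[n --> \oo] --> l.
Proof.
move=> Hu Hv cu cv; apply: complete => e e0.
have [A [N1 [A0 HA]]] := span_cauchy_bounded Hu cu.
have [B [N2 [B0 HB]]] := span_cauchy_bounded Hv cv.
have M0 : 0 < A + B + 1 by rewrite ltr_wpDl // addr_ge0.
have d0 : 0 < e / (A + B + 1) by rewrite divr_gt0.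
have [N3 H3] := cu _ d0; have [N4 H4] := cv _ d0.
exists (maxn (maxn N1 N2) (maxn N3 N4)) => m n; rewrite !geq_max.
move=> /andP[/andP[m1 m2] /andP[m3 m4]] /andP[/andP[n1 n2] /andP[n3 n4]].
have -> : span_ip (u m) (v m) - span_ip (u n) (v n) =
   span_ip (u m \- u n) (v m) + span_ip (u n) (v m \- v n).
  by rewrite (sipBl span_sip) // (sipBr span_sip) //; ring.
apply: le_lt_trans (ler_normD _ _) _.
have lt1 : `|span_ip (u m \- u n) (v m)| <= e / (A + B + 1) * B.
  apply: le_trans (ip_le_norm span_sip (sipB span_sip (Hu _) (Hu _)) (Hv _)) _.
  apply: ler_pM; rewrite ?(ipnorm_ge0 span_sip) ?HB //; first exact: sipB span_sip _ _ _ _.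
  by rewrite ltW // H3.
have lt2 : `|span_ip (u n) (v m \- v n)| <= A * (e / (A + B + 1)).
  apply: le_trans (ip_le_norm span_sip (Hu _) (sipB span_sip (Hv _) (Hv _))) _.
  apply: ler_pM; rewrite ?(ipnorm_ge0 span_sip) ?HA //; first exact: sipB span_sip _ _ _ _.
  by rewrite ltW // H4.
apply: le_lt_trans (lerD lt1 lt2) _.
rewrite mulrC -mulrDl mulrCA gtr_pMr // ltr_pdivrMr // mul1r addrC.
by rewrite ltrDl.
Qed.

(** Freeze [v] at a late index: against that finite combination the product is a finite sum of
    values of [u n], which tend to 0, and the change in [v] is small because the norms of [u n] stay
    bounded. This is what makes the inner product of the completion well defined. *)
Lemma span_ip_null u v : (forall n, span (u n)) -> (forall n, span (v n)) ->
  span_cauchy u -> span_cauchy v -> (forall x, u n x @[n --> \oo] --> 0) ->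
  span_ip (u n) (v n) @[n --> \oo] --> 0.
Proof.
move=> Hu Hv cu cv u0.
have [A [N1 [A0 HA]]] := span_cauchy_bounded Hu cu.
apply: (@cvg_sqz0 _ _ (A + 1)); last by rewrite addr_ge0.
move=> d d0; have [N2 H2] := cv _ d0.
have : span_ip (u n) (v N2) @[n --> \oo] --> 0.
  have [t Et] := Hv N2; rewrite Et.
  have E n : span_ip (u n) (comb K t) = pairing (u n) t.
    by have [s ->] := Hu n; rewrite span_ipE form_pairing.
  under eq_fun do rewrite E.
  rewrite /pairing; elim: t {Et E} => [|w t IH].
    by under eq_fun do rewrite big_nil; exact: cvg_cst.
  under eq_fun do rewrite big_cons.
  suff : (w.1)^* * u n w.2 + \sum_(v <- t) (v.1)^* * u n v.2 @[n --> \oo]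
      --> (w.1)^* * 0 + 0 by rewrite mulr0 addr0.
  by apply: cvgD => //; apply: cvgM (u0 _); exact: cvg_cst.
move=> /cvg_natP/(_ _ d0)[N3 H3].
exists (maxn N1 (maxn N2 N3)) => n; rewrite !geq_max => /and3P[n1 n2 n3].
have -> : span_ip (u n) (v n) =
    span_ip (u n) (v n \- v N2) + span_ip (u n) (v N2).
  by rewrite (sipBr span_sip) // subrK.
apply: le_trans (ler_normD _ _) _; rewrite mulrDl mul1r lerD //.
  apply: le_trans (ip_le_norm span_sip (Hu _) (sipB span_sip (Hv _) (Hv _))) _.
  apply: ler_pM; rewrite ?(ipnorm_ge0 span_sip) ?HA //; first exact: sipB span_sip _ _ _ _.
  by rewrite ltW // H2.
by have := H3 _ n3; rewrite subr0 => /ltW.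
Qed.

Hypothesis harmonic : forall e : C, 0 < e ->
  exists N, forall n, (N <= n)%N -> n.+1%:R^-1 < e.

Lemma representsB u v F G :
  represents u F -> represents v G -> represents (fun n => u n \- v n) (F \- G).
Proof.
move=> [Hu cu uF] [Hv cv vG]; split=> [n| |x].
- exact: sipB span_sip _ _ _ _.
- exact: span_cauchyB.
- by apply: cvgB; [exact: uF|exact: vG].
Qed.

Lemma represents_lin a u v F G : represents u F -> represents v G ->
  represents (fun n x => a * u n x + v n x) (fun x => a * F x + G x).
Proof.
move=> [Hu cu uF] [Hv cv vG]; split=> [n| |x].
- exact: sip_lin span_sip _ _ _ _ _.
- move=> e e0; have a0 : 0 < `|a| + 1 by rewrite ltr_wpDl.
  have [N HN] := cu (e / 2 / (`|a| + 1)) ltac:(by rewrite !divr_gt0).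
  have [M HM] := cv (e / 2) ltac:(by rewrite divr_gt0).
  exists (maxn N M) => m n; rewrite !geq_max => /andP[Nm Mm] /andP[Nn Mn].
  have Bu := sipB span_sip (Hu m) (Hu n); have Bv := sipB span_sip (Hv m) (Hv n).
  have -> : (fun x => a * u m x + v m x) \- (fun x => a * u n x + v n x) =
      (fun x => a * (u m \- u n) x + (v m \- v n) x).
    by apply/funext => x /=; ring.
  apply: le_lt_trans (ipnormD span_sip (sipZ span_sip a Bu) Bv) _.
  rewrite [ltRHS]splitr ltrD ?HM // (ipnormZ span_sip) //.
  have := HN _ _ Nm Nn; rewrite ltr_pdivlMr //; apply: le_lt_trans.
  by rewrite mulrC ler_wpM2l ?(ipnorm_ge0 span_sip) // lerDl.
- by apply: cvgD; [apply: cvgM (uF x); exact: cvg_cst|exact: vG].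
Qed.

Lemma represents_cst F : span F -> represents (fun=> F) F.
Proof.
move=> HF; split=> // [e e0|x]; last exact: cvg_cst.
exists 0%N => _ _ _ _.
have -> : F \- F = (fun x => 0 * F x) by apply/funext => x /=; rewrite subrr mul0r.
by rewrite (ipnormZ span_sip) // normr0 mul0r.
Qed.

(* The completion consists of the pointwise limits of Cauchy sequences of
   finite combinations; [hip] is its inner product. *)
Definition hilb F := exists u, represents u F.

Definition hip F G : C :=
  lim (span_ip (xget (fun=> fun=> 0) [set u | represents u F] n)
               (xget (fun=> fun=> 0) [set u | represents u G] n) @[n --> \oo]).

(** The limit does not depend on the sequences picked by [xget]: two representatives of one function
    differ by a Cauchy sequence with pointwise limit 0, and [span_ip_null] removes that difference
    in either argument. *)
Lemma hipE u v F G : represents u F -> represents v G ->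
  span_ip (u n) (v n) @[n --> \oo] --> hip F G.
Proof.
move=> ruF rvG; rewrite /hip; set u' := xget _ _; set v' := xget _ _.
have ru'F : represents u' F.
  exact: (@xgetPex _ _ [set w | represents w F] (ex_intro _ u ruF)).
have rv'G : represents v' G.
  exact: (@xgetPex _ _ [set w | represents w G] (ex_intro _ v rvG)).
have [Hu cu uF] := ruF; have [Hv cv vG] := rvG.
have [Hu' cu' uF'] := ru'F; have [Hv' cv' vG'] := rv'G.
have [l hl] := span_ip_cvg Hu' Hv' cu' cv'.
have -> : lim (span_ip (u' n) (v' n) @[n --> \oo]) = l.
  by apply: cvg_lim => //; exact: norm_hausdorff.
have n1 : span_ip (u n \- u' n) (v n) @[n --> \oo] --> 0.
  apply: span_ip_null => // [n||x]; first exact: sipB span_sip _ _ _ _.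
    exact: span_cauchyB.
  by rewrite -(subrr (F x)); apply: cvgB.
have n2 : span_ip (v n \- v' n) (u' n) @[n --> \oo] --> 0.
  apply: span_ip_null => // [n||x]; first exact: sipB span_sip _ _ _ _.
    exact: span_cauchyB.
  by rewrite -(subrr (G x)); apply: cvgB.
have E n : span_ip (u n) (v n) = span_ip (u n \- u' n) (v n) +
    ((span_ip (v n \- v' n) (u' n))^* + span_ip (u' n) (v' n)).
  rewrite (sipBl span_sip) // -(sip_conj span_sip) ?(sipBr span_sip) //; last first.
    exact: sipB span_sip _ _ _ _.
  by ring.
under eq_fun do rewrite E.
suff : span_ip (u n \- u' n) (v n) + ((span_ip (v n \- v' n) (u' n))^* +
    span_ip (u' n) (v' n)) @[n --> \oo] --> 0 + (0^* + l) by rewrite rmorph0 !add0r.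
by apply: cvgD => //; apply: cvgD => //; exact: cvg_conj.
Qed.

Lemma hip_unique u v F G l : represents u F -> represents v G ->
  span_ip (u n) (v n) @[n --> \oo] --> l -> hip F G = l.
Proof. by move=> ru rv; apply: cvg_nat_unique; exact: hipE. Qed.

Lemma hip_span F G : span F -> span G -> hip F G = span_ip F G.
Proof.
by move=> /represents_cst rF /represents_cst rG; apply: (hip_unique rF rG _); exact: cvg_cst.
Qed.

Lemma span_hilb F : span F -> hilb F.
Proof. by move=> HF; exists (fun=> F); exact: represents_cst. Qed.

Lemma hilb_sip : semi_inner_product hilb hip.
Proof.
split.
- exact/span_hilb/(sip_zero span_sip).
- by move=> a F G [u ru] [v rv]; eexists; exact: represents_lin ru rv.
- move=> a F G L [u ru] [v rv] [w rw]; apply: (hip_unique (represents_lin a ru rv) rw _).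
  have [Hu _ _] := ru; have [Hv _ _] := rv; have [Hw _ _] := rw.
  under eq_fun do rewrite (sip_linl span_sip) //.
  by apply: cvgD; [apply: cvgM; [exact: cvg_cst|exact: hipE]|exact: hipE].
- move=> F G [u ru] [v rv]; apply: (hip_unique rv ru _).
  have [Hu _ _] := ru; have [Hv _ _] := rv.
  under eq_fun do rewrite (sip_conj span_sip) //.
  by apply: cvg_conj; exact: hipE.
- move=> F [u ru]; have [Hu _ _] := ru.
  rewrite -oppr_le0; apply: (@cvg_nat_le _ (fun n => - span_ip (u n) (u n)) _ _ 0%N).
    by move=> n _; rewrite oppr_le0 (sip_ge0 span_sip).
  by apply: cvgN; exact: hipE.
Qed.

Lemma hilb_reproducing F y : hilb F -> hip F (K^~ y) = F y.
Proof.
move=> [u ru]; have [Hu _ uF] := ru.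
apply: (hip_unique ru (represents_cst (span_section y)) _).
by under eq_fun do rewrite span_reproducing //; exact: uF.
Qed.

Lemma hilb_definite F : hilb F -> hip F F = 0 -> F = (fun=> 0).
Proof.
move=> HF F0; apply/funext => y.
have := sip_cs hilb_sip HF (span_hilb (span_section y)).
by rewrite hilb_reproducing // F0 mul0r -normrX normr_le0 expf_eq0 /= => /eqP.
Qed.

Lemma hilb_norm_le u F e N : represents u F -> 0 <= e ->
  (forall n, (N <= n)%N -> nrm (u n) <= e) -> ipnorm hip F <= e.
Proof.
move=> ru e0 H; have [Hu _ _] := ru; have HF : hilb F by exists u.
rewrite -(@ler_pXn2r _ 2) ?nnegrE ?(ipnorm_ge0 hilb_sip) // sqrtCK.
apply: (@cvg_nat_le _ _ _ _ N _ (hipE ru ru)) => n Nn; rewrite -[X in X <= _]sqrtCK.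
by rewrite ler_pXn2r ?nnegrE ?(ipnorm_ge0 span_sip) // H.
Qed.

Lemma hilb_near u F : represents u F -> forall e, 0 < e ->
  exists N, forall n, (N <= n)%N -> ipnorm hip (F \- u n) < e.
Proof.
move=> ru e e0; have [Hu cu uF] := ru.
have [N HN] := cu _ (ltac:(by rewrite divr_gt0) : 0 < e / 2).
exists N => n Nn; apply: (@le_lt_trans _ _ (e / 2)); last by rewrite ltr_pdivrMr // ltr_pMr // ltrDl.
apply: (@hilb_norm_le _ _ _ N (representsB ru (represents_cst (Hu n)))).
  by rewrite ltW // divr_gt0.
by move=> m Nm; rewrite ltW // HN.
Qed.

Lemma hilb_dense F e : hilb F -> 0 < e ->
  exists s, ipnorm hip (F \- comb K s) < e.
Proof.
move=> [u ru] e0; have [N /(_ N (leqnn _))] := hilb_near ru e0.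
by have [Hu _ _] := ru; have [s ->] := Hu N; exists s.
Qed.

(** Replace [u n] by a finite combination within [1 / (n + 1)]. These combinations form a Cauchy
    sequence in the span; its values converge because they are inner products with fixed sections,
    and the pointwise limit is the limit sought. *)
Lemma hilb_complete (u : nat -> X -> C) : (forall n, hilb (u n)) ->
  (forall e, 0 < e -> exists N, forall m n, (N <= m)%N -> (N <= n)%N ->
    ipnorm hip (u m \- u n) < e) ->
  exists2 F, hilb F & forall e, 0 < e ->
    exists N, forall n, (N <= n)%N -> ipnorm hip (u n \- F) < e.
Proof.
move=> Hu cu.
have /choice[s Hs] n : exists s, ipnorm hip (u n \- comb K s) < n.+1%:R^-1.
  by apply: hilb_dense => //; rewrite invr_gt0.
pose v n := comb K (s n).
have Hv n : span (v n) by exists (s n).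
have Hv' n := span_hilb (Hv n).
have cv : span_cauchy v.
  move=> e e0; have e3 : 0 < e / 2 / 2 by rewrite !divr_gt0.
  have [N HN] := cu _ (ltac:(by rewrite divr_gt0) : 0 < e / 2); have [M HM] := harmonic e3.
  exists (maxn N M) => m n; rewrite !geq_max => /andP[Nm Mm] /andP[Nn Mn].
  have -> : nrm (v m \- v n) = ipnorm hip (v m \- v n).
    by rewrite /ipnorm hip_span //; exact: sipB span_sip _ _ _ _.
  apply: le_lt_trans (ipnorm_trans hilb_sip (Hv' m) (Hv' n) (Hu m)) _.
  apply: le_lt_trans (lerD (lexx _) (ipnorm_trans hilb_sip (Hu m) (Hv' n) (Hu n))) _.
  rewrite (ipnormBC hilb_sip) // addrCA [ltRHS]splitr ltrD ?HN // [ltRHS]splitr.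
  by rewrite ltrD // (lt_trans (Hs _)) // HM.
have /choice[F vF] x : exists l : C, v n x @[n --> \oo] --> l.
  have [l Hl] := span_ip_cvg Hv (fun=> span_section x) cv
    (let: And3 _ c _ := represents_cst (span_section x) in c).
  by exists l; under eq_fun do rewrite -span_reproducing //.
have rv : represents v F by [].
have HF : hilb F by exists v.
exists F => // e e0; have e2 : 0 < e / 2 by rewrite divr_gt0.
have [N HN] := hilb_near rv e2; have [M HM] := harmonic e2.
exists (maxn N M) => n; rewrite geq_max => /andP[Nn Mn].
apply: le_lt_trans (ipnorm_trans hilb_sip (Hu n) HF (Hv' n)) _.
rewrite [ltRHS]splitr ltrD //; first by rewrite (lt_trans (Hs n)) // HM.
by rewrite (ipnormBC hilb_sip) // HN.
Qed.

(* [F] is represented by a minimising sequence of the squared distance to [F],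
   up to the constant [|F|^2]; it is Cauchy by the parallelogram identity. *)
Lemma minimizer_hilb F (m : C) :
  let J s := form K s s - (pairing F s + (pairing F s)^*) in
  (forall s, m <= J s) -> (forall e, 0 < e -> exists s, J s < m + e) -> hilb F.
Proof.
move=> J Jge Jlt.
have /choice[s Hs] n : exists s, J s < m + n.+1%:R^-1.
  by apply: Jlt; rewrite invr_gt0.
have Hu n : span (comb K (s n)) by exists (s n).
exists (fun n => comb K (s n)); split=> // [e e0|x].
  have e4 : 0 < e ^+ 2 / 4 by rewrite divr_gt0 // exprn_gt0.
  have [N HN] := harmonic e4.
  exists N => i j Ni Nj.
  have -> : comb K (s i) \- comb K (s j) = comb K (s i ++ scale (-1) (s j)).
    by apply/funext => x /=; rewrite comb_cat comb_scale mulN1r.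
  set r := s i ++ scale (-1) (s j).
  rewrite /ipnorm span_ipE.
  have : form K r r < e ^+ 2.
    have := Jge (scale (2^-1) (s i ++ s j)).
    have -> : form K r r = 2 * (J (s i) + J (s j)) - 4 * J (scale (2^-1) (s i ++ s j)).
      rewrite /J /r !(form_catl, form_catr, form_scalel, form_scaler).
      rewrite !(pairing_cat, pairing_scale, rmorphD, rmorphM) /=.
      rewrite !(rmorphN, rmorph1, fmorphV, rmorph_nat, pairing_cat, rmorphD, conjCK) /=.
      by field.
    move=> Jr.
    have : 2 * (J (s i) + J (s j)) < 2 * ((m + e ^+ 2 / 4) + (m + e ^+ 2 / 4)).
      rewrite ltr_pM2l // ltrD // (lt_trans (Hs _)) // ltrD2l HN //.
    rewrite -subr_gt0 => lt; rewrite -subr_gt0.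
    have Jr4 : 0 <= 4 * (J (scale 2^-1 (s i ++ s j)) - m) by rewrite mulr_ge0 // subr_ge0.
    apply: lt_le_trans lt _; rewrite -subr_ge0; move: Jr4; congr (0 <= _).
    by field.
  have rr : 0 <= sqrtC (form K r r) by rewrite sqrtC_ge0.
  rewrite -[X in X < _]sqrtCK ltr_pXn2r ?nnegrE ?(ltW e0) //.
(* Near-minimality at [t], tested in the direction of the section at [x], bounds the error at [x] by
   the excess [J t - m]; this gives pointwise convergence to [F]. *)
have cs t : `|comb K t x - F x| ^+ 2 <= (J t - m) * K x x.
  apply: quadratic_cauchy_schwarz => [|z]; first exact: psd_diag.
  have := Jge (t ++ scale z [:: (1, x)]); rewrite -subr_ge0; congr (0 <= _).
  rewrite /J !(form_catl, form_catr, form_scalel, form_scaler).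
  rewrite !(pairing_cat, pairing_scale, rmorphD, rmorphM) /=.
  rewrite (form_conj t [:: (1, x)] pK) !form_sing1 comb_sing conjCK.
  have -> : pairing F [:: (1, x)] = F x by rewrite /pairing big_seq1 rmorph1 mul1r.
  by rewrite ?rmorphB ?rmorphN /=; ring.
apply/cvg_natP => e e0; have k0 := psd_diag x pK.
have k1 : 0 < K x x + 1 by rewrite ltr_wpDl.
have [N HN] := harmonic (ltac:(by rewrite divr_gt0 // exprn_gt0) : 0 < e ^+ 2 / (K x x + 1)).
exists N => n Nn.
rewrite -(@ltr_pXn2r _ 2) // ?nnegrE ?(ltW e0) //.
apply: le_lt_trans (cs (s n)) _.
have lt1 : J (s n) - m < e ^+ 2 / (K x x + 1).
  by rewrite ltrBlDl (lt_trans (Hs n)) // ltrD2l HN.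
apply: (@le_lt_trans _ _ (e ^+ 2 / (K x x + 1) * K x x)).
  by rewrite ler_wpM2r // ltW.
by rewrite mulrAC -mulrA gtr_pMr ?exprn_gt0 // ltr_pdivrMr // mul1r ltrDl.
Qed.

End Completion.

(** * Real and imaginary parts, completeness of the complex numbers *)

Section ComplexNumbers.
Variable R : realType.
Implicit Types (z : R[i]) (e : R).
Local Open Scope complex_scope.

Lemma gt0_real_complex z : 0 < z -> exists2 e : R, 0 < e & z = e%:C.
Proof. by case: z => a b; rewrite ltcE /= => /andP[/eqP -> a0]; exists a. Qed.

Lemma normc_real (r : R) : `|r%:C| = `|r|%:C :> R[i].
Proof. by rewrite normc_def /= expr0n /= addr0 sqrtr_sqr. Qed.

Lemma normc_ge_Im z : `|complex.Im z|%:C <= `|z|.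
Proof.
have := normc_ge_Re (z * 'i); rewrite ReiNIm normrN normrM.
by rewrite [`|'i|]normc_def /= expr0n /= expr1n add0r sqrtr1 mulr1.
Qed.

Lemma normc_le_ReIm z : `|z| <= (`|complex.Re z| + `|complex.Im z|)%:C.
Proof.
rewrite [in X in X <= _](complexE z); apply: le_trans (ler_normD _ _) _.
rewrite rmorphD /= lerD // ?normrM.
  by rewrite normc_real.
by rewrite [`|'i|]normc_def /= expr0n /= expr1n add0r sqrtr1 mul1r normc_real.
Qed.

Lemma ReB z1 z2 : complex.Re (z1 - z2) = complex.Re z1 - complex.Re z2.
Proof. by case: z1 z2 => a b [c d]. Qed.

Lemma ImB z1 z2 : complex.Im (z1 - z2) = complex.Im z1 - complex.Im z2.
Proof. by case: z1 z2 => a b [c d]. Qed.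

Lemma ReD (a b : R[i]) : complex.Re (a + b) = complex.Re a + complex.Re b.
Proof. by case: a b => ? ? []. Qed.

Lemma ImD (a b : R[i]) : complex.Im (a + b) = complex.Im a + complex.Im b.
Proof. by case: a b => ? ? []. Qed.

Lemma ReM (a b : R[i]) : complex.Re (a * b) =
  complex.Re a * complex.Re b - complex.Im a * complex.Im b.
Proof. by case: a b => ? ? []. Qed.

Lemma ImM (a b : R[i]) : complex.Im (a * b) =
  complex.Re a * complex.Im b + complex.Im a * complex.Re b.
Proof. by case: a b => ? ? []. Qed.

Lemma Re_conjC (a : R[i]) : complex.Re (a^*)%R = complex.Re a.
Proof. by case: a. Qed.

Lemma Im_conjC (a : R[i]) : complex.Im (a^*)%R = - complex.Im a.
Proof. by case: a. Qed.

Lemma complex_eqP (a b : R[i]) :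
  complex.Re a = complex.Re b -> complex.Im a = complex.Im b -> a = b.
Proof. by case: a b => ? ? [? ?] /= -> ->. Qed.

Lemma real_cauchy_cvg (u : nat -> R) :
  (forall e, 0 < e -> exists N, forall m n, (N <= m)%N -> (N <= n)%N ->
    `|u m - u n| < e) ->
  exists l : R, forall e, 0 < e -> exists N, forall n, (N <= n)%N -> `|u n - l| < e.
Proof.
move=> cu; have /cvg_ex[l ul] : cvg (u n @[n --> \oo]).
  apply/cauchy_cvgP/cauchy_exP => e e0; have [N HN] := cu e e0.
  exists (u N), N => // n /= Nn; rewrite -ball_normE /=; exact: HN.
by exists l => e e0; move/cvg_natP : ul; apply.
Qed.

Let C : numClosedFieldType := R[i].

Lemma complex_complete (u : nat -> C) :
  (forall e : C, 0 < e -> exists N, forall m n, (N <= m)%N -> (N <= n)%N ->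
    `|u m - u n| < e) -> exists l : C, u n @[n --> \oo] --> l.
Proof.
move=> cu.
have [a Ha] : exists a : R, forall e, 0 < e -> exists N, forall n, (N <= n)%N ->
    `|complex.Re (u n) - a| < e.
  apply: real_cauchy_cvg => e e0; have [|N HN] := cu e%:C; first by rewrite ltcR.
  exists N => m n Nm Nn; rewrite -ReB -ltcR.
  exact: le_lt_trans (normc_ge_Re _) (HN _ _ Nm Nn).
have [b Hb] : exists b : R, forall e, 0 < e -> exists N, forall n, (N <= n)%N ->
    `|complex.Im (u n) - b| < e.
  apply: real_cauchy_cvg => e e0; have [|N HN] := cu e%:C; first by rewrite ltcR.
  exists N => m n Nm Nn; rewrite -ImB -ltcR.
  exact: le_lt_trans (normc_ge_Im _) (HN _ _ Nm Nn).
exists (a +i* b); apply/cvg_natP => _ /gt0_real_complex[e e0 ->].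
have e2 : 0 < e / 2 by rewrite divr_gt0.
have [N HN] := Ha _ e2; have [M HM] := Hb _ e2.
exists (maxn N M) => n; rewrite geq_max => /andP[Nn Mn].
apply: le_lt_trans (normc_le_ReIm _) _; rewrite ltcR ReB ImB [ltRHS]splitr.
by rewrite ltrD ?HN ?HM.
Qed.

Lemma complex_harmonic (e : R[i]) : 0 < e ->
  exists N, forall n, (N <= n)%N -> n.+1%:R^-1 < e.
Proof.
move=> /gt0_real_complex[d d0 ->].
have [N HN] : exists N : nat, d^-1 < N%:R.
  by exists (Num.truncn d^-1).+1; rewrite truncnS_gt.
exists N => n Nn; have -> : n.+1%:R^-1 = (n.+1%:R^-1)%:C :> R[i].
  by rewrite fmorphV rmorph_nat.
rewrite ltcR invf_plt ?posrE // (lt_le_trans HN) // ler_nat ltnW //.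
Qed.

End ComplexNumbers.

(** * Members of the reproducing kernel Hilbert space *)

Section Rkhs.
Variables (R : realType) (X : ptopologicalType).
Implicit Types (K p q : X -> X -> R[i]) (F G : X -> R[i]).
Let C : numClosedFieldType := R[i].
Local Open Scope complex_scope.

Lemma sumr_comb K s : exists n (c : 'I_n -> R[i]) (y : 'I_n -> X),
  (fun x => \sum_(i < n) c i * K x (y i)) = comb K s.
Proof.
exists (size s), (fun i => (nth (0, point) s i).1), (fun i => (nth (0, point) s i).2).
by apply/funext => x; rewrite /comb (big_nth (0, point)) big_mkord.
Qed.

(** The record [is_rkhs] measures distances by [ip D D], the completion by the norm [ipnorm]; this
    converts one into the other. *)
Lemma lt_sqrtC_real (z : C) (e : R) : 0 <= z -> 0 < e ->
  (z < (e%:C : C)) = (sqrtC z < sqrtC (e%:C : C)).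
Proof. by move=> z0 e0; rewrite ltr_sqrtC ?nnegrE // ler0c ltW. Qed.

Lemma hilb_is_rkhs K : psd K ->
  @is_rkhs R X K (@hilb C X K) (@hip C X K).
Proof.
move=> pK; have S := hilb_sip (C := C) (@complex_complete R) pK.
have D F G : @hilb C X K F -> @hilb C X K G -> 0 <= @hip C X K (F \- G) (F \- G).
  by move=> HF HG; apply: (sip_ge0 S); exact: (sipB S).
split.
- exact: sip_zero S.
- exact: sip_lin S.
- exact: sip_linl S.
- exact: sip_conj S.
- move=> F HF F0; rewrite lt0r (sip_ge0 S) // andbT; apply/eqP => /(hilb_definite (C := C) (@complex_complete R) pK HF).
  exact: F0.
- move=> u Hu cu.
  have [|F HF cF] := hilb_complete (C := C) (@complex_complete R) pK (@complex_harmonic R) Hu.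
    move=> e /gt0_real_complex[d d0 ->].
    have [N HN] := cu (d ^+ 2) (exprn_gt0 _ d0); exists N => m n Nm Nn.
    have := HN m n Nm Nn; rewrite (lt_sqrtC_real (D _ _ (Hu m) (Hu n)) (exprn_gt0 2 d0)).
    have -> : (d ^+ 2)%:C = d%:C ^+ 2 :> C by rewrite rmorphXn.
    by rewrite sqrCK // ler0c ltW.
  exists F => // e e0; have [|N HN] := cF (sqrtC e%:C); first by rewrite sqrtC_gt0 ltcR.
  exists N => n Nn; rewrite (lt_sqrtC_real (D _ _ (Hu n) HF) e0); exact: HN.
- by move=> y; exact: span_hilb (span_section _ y).
- by move=> F y HF; rewrite (hilb_reproducing (C := C) (@complex_complete R) pK).
- move=> F e HF e0.
  have [|s Hs] := hilb_dense (C := C) (@complex_complete R) pK HF (_ : 0 < sqrtC e%:C).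
    by rewrite sqrtC_gt0 ltcR.
  have Hs' : @hip C X K (F \- comb K s) (F \- comb K s) < e%:C.
    have Hc : @hilb C X K (comb K s) by apply: (span_hilb pK); exists s.
    by rewrite (lt_sqrtC_real (D _ _ HF Hc) e0); exact: Hs.
  have [n [c [y E]]] := sumr_comb K s; exists n, c, y.
  by rewrite -E in Hs'; exact: Hs'.
Qed.

Section RkhsProperties.
Variables (K : X -> X -> R[i]) (H : set (X -> R[i])).
Variable ip : (X -> R[i]) -> (X -> R[i]) -> R[i].
Hypothesis rK : is_rkhs K H ip.

Lemma rkhs_sip : semi_inner_product (C := C) H ip.
Proof.
split; [exact: rkhs_zero rK|exact: rkhs_linear rK|exact: rkhs_ip_linear rK|
  exact: rkhs_ip_conj rK|move=> F HF].
have [->|F0] := pselect (F = (fun=> 0)); last exact/ltW/(rkhs_ip_pos rK).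
have H0 := rkhs_zero rK; have := rkhs_ip_linear rK 1 H0 H0 H0.
have -> : (fun x : X => 1 * 0 + 0 : R[i]) = (fun=> 0).
  by apply/funext => x; rewrite mulr0 addr0.
by rewrite mul1r -[X in X = _]addr0 => /addrI <-.
Qed.

Lemma rkhs_comb s : H (comb K s) /\ forall F, H F -> ip F (comb K s) = pairing F s.
Proof.
have S := rkhs_sip; elim: s => [|u s [Hs IH]].
  have -> : comb K [::] = (fun=> 0) by apply/funext => x; rewrite /comb big_nil.
  split=> [|F HF]; first exact: rkhs_zero rK.
  by rewrite (sip_conj S (rkhs_zero rK) HF) (sip0l S HF) rmorph0 /pairing big_nil.
have -> : comb K (u :: s) = (fun x => u.1 * K x u.2 + comb K s x).
  by apply/funext => x; rewrite /comb big_cons.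
have Hu := rkhs_section rK u.2.
split=> [|F HF]; first exact: rkhs_linear rK _ _ _ Hu Hs.
rewrite (sip_linr S u.1 Hu Hs HF) (rkhs_reproducing rK) // IH //.
by rewrite /pairing big_cons.
Qed.

Lemma rkhs_comb_norm s : ip (comb K s) (comb K s) = form K s s.
Proof.
by have [Hs E] := rkhs_comb s; rewrite E // form_pairing.
Qed.

(** Cauchy-Schwarz against finite combinations, valid in any space satisfying [is_rkhs]. With
    [dominated_hilb] it places every such space inside the constructed one. *)
Lemma rkhs_dominated F : H F -> dominated (C := C) K F (ip F F).
Proof.
move=> HF; apply/dominatedP => s; have [Hs E] := rkhs_comb s.
by rewrite -E // -rkhs_comb_norm (sip_cs rkhs_sip).
Qed.

End RkhsProperties.

(** The functional [J] of [minimizer_hilb] stands for the squared distance to [F] minus the squared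
    norm of [F]. Domination bounds it below by [- c], because 2 sqrt(c f) <= f + c for
    [f = form K s s]. Its values are real, so the infimum exists and [minimizer_hilb] applies. *)
Lemma dominated_hilb K F (c : R[i]) : psd K -> 0 <= c ->
  dominated K F c -> @hilb C X K F.
Proof.
move=> pK c0 /dominatedP dF.
pose J s := form K s s - (pairing F s + (pairing F s)^*)%R.
have Jc s : - c <= J s.
  have f0 : 0 <= form K s s := pK s.
  have r : (pairing F s + (pairing F s)^*)%R \is Num.real.
    by apply/CrealP; rewrite rmorphD /= conjCK addrC.
  rewrite /J lerBrDr -lerBrDl opprK.
  apply: le_trans (real_ler_norm r) _; apply: le_trans (ler_normD _ _) _.
  rewrite norm_conjC -mulr2n -mulr_natl.
  have cf0 : 0 <= form K s s + c by rewrite addr_ge0.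
  rewrite -(@ler_pXn2r _ 2) ?nnegrE ?mulr_ge0 // exprMn.
  apply: (@le_trans _ _ (2 ^+ 2 * (c * form K s s))).
    by rewrite ler_wpM2l ?dF // exprn_ge0.
  rewrite -subr_ge0.
  have -> : (form K s s + c) ^+ 2 - 2 ^+ 2 * (c * form K s s) = (form K s s - c) ^+ 2 by ring.
  have : form K s s - c \is Num.real by rewrite rpredB ?ger0_real.
  by move=> r2; apply: real_exprn_even_ge0.
have Jr s : J s = (complex.Re (J s))%:C.
  have c1 : - c \is Num.real by rewrite rpredN ger0_real.
  by rewrite RRe_real // (ger_real (Jc s)).
have hI : has_inf [set complex.Re (J s) | s in setT].
  split; first by exists (complex.Re (J [::])), [::].
  by exists (complex.Re (- c)) => _ [s _ <-]; have := Jc s; rewrite lecE => /andP[].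
apply: (minimizer_hilb (C := C) pK (@complex_harmonic R)
  (m := (inf [set complex.Re (J s) | s in setT])%:C)) => [s|e].
  by rewrite -/(J s) Jr lecR; apply: ge_inf; [case: hI|exists s].
move=> /gt0_real_complex[d d0 ->].
have [_ [s _ <-] Hs] := inf_adherent d0 hI.
by exists s; rewrite -/(J s) Jr -rmorphD ltcR.
Qed.

Lemma rkhsP K F : psd K ->
  rkhs K F <-> exists2 c, 0 <= c & dominated (C := C) K F c.
Proof.
move=> pK; split=> [[H [ip [rK HF]]]|[c c0 dF]].
  exists (ip F F); last exact: rkhs_dominated rK _ HF.
  exact: (sip_ge0 (rkhs_sip rK)).
exists (@hilb C X K), (@hip C X K); split; first exact: hilb_is_rkhs.
exact: dominated_hilb dF.
Qed.

Lemma dominated_le K F (c : R[i]) y : psd K -> dominated (C := C) K F c ->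
  `|F y| ^+ 2 <= c * K y y.
Proof.
move=> pK /dominatedP/(_ [:: (1, y)]); rewrite form_sing1 comb_sing.
by rewrite /pairing big_seq1 rmorph1 mul1r.
Qed.

(** Domination tested on the difference of the sections at [x] and [y]. The right factor is their
    squared distance, so continuity of [K] on the diagonal makes [F] continuous. *)
Lemma dominated_dist K F (c : R[i]) x y : psd K -> dominated (C := C) K F c ->
  `|F x - F y| ^+ 2 <= c * (K x x - K x y - K y x + K y y).
Proof.
move=> pK /dominatedP/(_ [:: (1, x); (-1, y)]).
rewrite /pairing /form !(big_cons, big_nil) /= !(rmorphN, rmorph1).
congr (`|_| ^+ 2 <= _ * _); ring.
Qed.

Lemma dist_continuous F (D : X -> X -> R[i]) (c : R[i]) : 0 <= c ->
  (forall x y, `|F x - F y| ^+ 2 <= c * D x y) ->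
  (forall y, (D x y : R[i]^o) @[x --> y] --> (0 : R[i]^o)) -> ccontinuous F.
Proof.
move=> c0 FD D0 y; apply/cvgrPdist_lt => e e0.
have c1 : 0 < c + 1 by rewrite ltr_wpDl.
have d0 : 0 < e ^+ 2 / (c + 1) by rewrite divr_gt0 // exprn_gt0.
have := D0 y => /cvgrPdist_lt/(_ _ d0); apply: filterS => x; rewrite sub0r normrN => Dx.
rewrite distrC -(@ltr_pXn2r _ 2) ?nnegrE ?(ltW e0) //.
apply: le_lt_trans (FD x y) _.
have r : c * D x y \is Num.real by rewrite (ger_real (FD x y)) ?ger0_real // exprn_ge0.
apply: le_lt_trans (real_ler_norm r) _; rewrite normrM (ger0_norm c0).
apply: (@le_lt_trans _ _ (c * (e ^+ 2 / (c + 1)))); first by rewrite ler_wpM2l // ltW.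
by rewrite mulrCA gtr_pMr ?exprn_gt0 // ltr_pdivrMr // mul1r ltrDl.
Qed.

Definition kernel_dist K x y := K x x - K x y - K y x + K y y.

Lemma kernel_section_continuous K y : kernel_continuous K -> ccontinuous (K^~ y).
Proof.
move=> cK x; have /= := @continuous_comp _ _ _ (fun x => (x, y)) (fun z => K z.1 z.2 : R[i]^o) x.
by apply; [apply: cvg_pair => //; exact: cvg_cst|exact: cK].
Qed.

Lemma kernel_dist_cvg0 K : kernel_continuous K ->
  forall y, (kernel_dist K x y : R[i]^o) @[x --> y] --> (0 : R[i]^o).
Proof.
move=> cK y.
have c1 : (K x x : R[i]^o) @[x --> y] --> (K y y : R[i]^o).
  have /= := @continuous_comp _ _ _ (fun x => (x, x)) (fun z => K z.1 z.2 : R[i]^o) y.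
  by apply; [apply: cvg_pair => //|exact: cK].
have c2 : (K x y : R[i]^o) @[x --> y] --> (K y y : R[i]^o) by exact: kernel_section_continuous.
have c3 : (K y x : R[i]^o) @[x --> y] --> (K y y : R[i]^o).
  have /= := @continuous_comp _ _ _ (fun x => (y, x)) (fun z => K z.1 z.2 : R[i]^o) y.
  by apply; [apply: cvg_pair => //; exact: cvg_cst|exact: cK].
have c4 : (K y y : R[i]^o) @[x --> y] --> (K y y : R[i]^o) by exact: cvg_cst.
have E : (K y y : R[i]^o) - K y y - K y y + K y y = 0.
  by rewrite subrr sub0r addNr.
have := cvgD (cvgB (cvgB c1 c2) c3) c4.
rewrite E => H.
have F : (fun x => kernel_dist K x y : R[i]^o) =
    (fun x => (K x x : R[i]^o) - K x y - K y x + K y y) by apply/funext.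
by rewrite F; exact: H.
Qed.

Lemma rkhs_continuous K : kernel_continuous K -> psd K -> rkhs K `<=` @ccontinuous R X.
Proof.
move=> cK pK F /(rkhsP F pK)[c c0 dF].
apply: (@dist_continuous _ (kernel_dist K) c) => //; last exact: kernel_dist_cvg0.
by move=> x y; exact: dominated_dist.
Qed.

End Rkhs.

(** * Integration against complex measures *)

Section BoundedIntegral.
Context d (T : measurableType d) (R : realType).
Implicit Types (f g : T -> R) (A S : set T).

(** Measurability is global, boundedness is asked only on a carrier of the measure: a section of a
    continuous kernel may be unbounded on the whole space. *)
Definition bounded_on S f :=
  measurable_fun setT f /\ exists M : R, forall x, S x -> `|f x| <= M.

Lemma bounded_onD S f g : bounded_on S f -> bounded_on S g ->
  bounded_on S (fun x => f x + g x).
Proof.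
move=> [mf [M HM]] [mg [N HN]]; split; first exact: measurable_funD.
by exists (M + N) => x Sx; apply: le_trans (ler_normD _ _) _; rewrite lerD ?HM ?HN.
Qed.

Lemma bounded_onM S f g : bounded_on S f -> bounded_on S g ->
  bounded_on S (fun x => f x * g x).
Proof.
move=> [mf [M HM]] [mg [N HN]]; split; first exact: measurable_funM.
by exists (M * N) => x Sx; rewrite normrM ler_pM ?HM ?HN.
Qed.

Lemma bounded_on_cst S (r : R) : bounded_on S (fun=> r).
Proof. by split; [exact: measurable_cst|exists `|r|]. Qed.

Lemma bounded_onN S f : bounded_on S f -> bounded_on S (fun x => - f x).
Proof.
move=> /(bounded_onM (bounded_on_cst S (-1))); congr bounded_on.
by apply/funext => x; rewrite mulN1r.
Qed.

Lemma bounded_onB S f g : bounded_on S f -> bounded_on S g ->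
  bounded_on S (fun x => f x - g x).
Proof. by move=> bf /bounded_onN; exact: bounded_onD. Qed.

Lemma bounded_on_indic S A : measurable A -> bounded_on S \1_A.
Proof.
move=> mA; split; first exact: measurable_indic.
by exists 1 => x _; rewrite indicE ger0_norm // lern1 leq_b1.
Qed.

Section Measure.
Variables (m : {finite_measure set T -> \bar R}) (S : set T).
Hypotheses (mS : measurable S) (S0 : m (~` S) = 0%E).

Lemma bounded_on_integrable f : bounded_on S f -> m.-integrable setT (EFin \o f).
Proof.
move=> [mf [M HM]]; have mf' : measurable_fun setT (EFin \o f) by exact/measurable_EFinP.
apply/(negligible_integrable (measurableC mS) measurableT mf' S0).
rewrite setTD setCK; apply: (le_integrable mS _ _ (finite_measure_integrable_cst m M mS)).
  exact: measurable_funTS.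
by move=> x Sx; rewrite /= lee_fin (le_trans (HM x Sx)) // ler_norm.
Qed.

(** Nothing bounds [f] outside the null set's complement [S], so the integrals are first restricted
    to [S]. The indicator lets one bound serve both for the whole space and for sets of small
    measure. *)
Lemma Rintegral_indic_bound f A (M : R) : measurable_fun setT f -> measurable A -> 0 <= M ->
  (forall x, S x -> `|f x| <= M * \1_A x) ->
  `|\int[m]_x f x| <= M * fine (m A).
Proof.
move=> mf mA M0 HM.
have bf : bounded_on S f.
  split=> //; exists M => x Sx; apply: le_trans (HM x Sx) _.
  by rewrite indicE ler_piMr // lern1 leq_b1.
have bn : bounded_on S (fun x => `|f x|).
  split; first exact: measurableT_comp.
  by have [_ [N HN]] := bf; exists N => x Sx; rewrite normr_id HN.
have b1 : bounded_on S (fun x => M * \1_A x).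
  by apply: bounded_onM; [exact: bounded_on_cst|exact: bounded_on_indic].
apply: le_trans (le_normr_Rintegral measurableT (bounded_on_integrable bf)) _.
rewrite /Rintegral (negligible_integral (measurableC mS) measurableT (bounded_on_integrable bn) S0).
rewrite setTD setCK.
have -> : M * fine (m A) = \int[m]_x (M * \1_A x).
  rewrite RintegralZl //; last exact/bounded_on_integrable/bounded_on_indic.
  by rewrite /Rintegral integral_indic // setIT.
rewrite /Rintegral (negligible_integral (measurableC mS) measurableT (bounded_on_integrable b1) S0).
rewrite setTD setCK; apply: (@le_Rintegral _ _ _ m S) => //.
- by apply: integrableS (bounded_on_integrable bn).
- by apply: integrableS (bounded_on_integrable b1).
Qed.

End Measure.

(* Layer-cake discretisation of [f] with step [e]. *)
Lemma uniform_simple_approx S f (e : R) : bounded_on S f -> 0 < e ->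
  exists n (a : nat -> R) (A : nat -> set T), (forall k, measurable (A k)) /\
  forall x, S x -> `|f x - \sum_(k < n) a k * \1_(A k) x| <= e.
Proof.
move=> [mf [M HM]] e0.
(* [lev y n] is the largest multiple of [e] below [y], capped at [n * e]; the second claim of
   [levP], the value at the cap, drives the induction for the first. *)
pose lev (y : R) n := \sum_(k < n) e * (k.+1%:R * e <= y)%R%:R.
have levP y n : 0 <= y ->
    (y < n.+1%:R * e -> `|y - lev y n| <= e) /\ (n%:R * e <= y -> lev y n = n%:R * e).
  move=> y0; elim: n => [|n [IH1 IH2]].
    rewrite /lev big_ord0 mul0r mul1r subr0; split=> // ye.
    by rewrite ger0_norm // ltW.
  rewrite /lev big_ord_recr /= -/(lev y n).
  have IH3 : n.+1%:R * e <= y -> lev y n + e * (n.+1%:R * e <= y)%R%:R = n.+1%:R * e.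
    move=> ny; rewrite ny mulr1 IH2 ?(le_trans _ ny) ?ler_pM2r ?ler_nat //.
    by rewrite [in RHS]mulrSr mulrDl mul1r.
  split=> // yn; have [ny|ny] := leP (n.+1%:R * e) y; last first.
    by rewrite mulr0 addr0; exact: IH1.
  have := IH3 ny; rewrite ny => ->; rewrite ger0_norm ?subr_ge0 //.
  by rewrite lerBlDl ltW // (lt_le_trans yn) // [in X in X <= _]mulrSr mulrDl mul1r.
(* On [S] the function [f + M] lies between 0 and [2 * M], which is less than [(n + 1) * e]. Index 0
   carries the constant [- M], the later indices carry the levels of [f + M]. *)
pose n := Num.truncn (2 * M / e).
pose A k := if k is k'.+1 then [set x | k%:R * e - M <= f x] else setT.
pose a k : R := if k is k'.+1 then e else - M.
exists n.+1, a, A; split=> [[|k]|x Sx]; rewrite ?/A //.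
  have -> : [set x | k.+1%:R * e - M <= f x] = f @^-1` `[k.+1%:R * e - M, +oo[%classic.
    by apply/seteqP; split=> x /=; rewrite in_itv /= andbT.
  by rewrite -[X in measurable X]setTI; exact: mf.
have := HM x Sx; rewrite ler_norml => /andP[f1 f2].
have y0 : 0 <= f x + M by rewrite -lerBlDr sub0r.
have [H _] := levP (f x + M) n y0.
rewrite big_ord_recl /= indicT mulr1.
suff -> : f x - (- M + \sum_(i < n) e * \1_[set x0 | (lift ord0 i)%:R * e - M <= f x0] x)
    = f x + M - lev (f x + M) n.
  apply: H; rewrite -ltr_pdivrMr //; apply: le_lt_trans (truncnS_gt _).
  by rewrite ler_pM2r ?invr_gt0 // mulr2n mulrDl mul1r lerD2r.
rewrite opprD opprK addrA; congr (_ - _); apply: eq_bigr => k _; congr (_ * _).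
rewrite indicE; congr (_ %:R); congr nat_of_bool.
by rewrite -lerBlDr; apply/idP/idP; rewrite inE.
Qed.

End BoundedIntegral.

Section ChargeIntegral.
Context d (T : measurableType d) (R : realType).
Implicit Types (nu : {charge set T -> \bar R}) (A S : set T) (f g : T -> R).

(** The same Jordan parts as [charge_pos] and [charge_neg], now typed as finite measures so that
    bounded functions are integrable. *)
Definition charge_posf nu : {finite_measure set T -> \bar R} :=
  jordan_pos (svalP (hahn_sig nu)).

Definition charge_negf nu : {finite_measure set T -> \bar R} :=
  jordan_neg (svalP (hahn_sig nu)).

Definition charge_var nu A : R := fine (charge_posf nu A) + fine (charge_negf nu A).

Definition charge_carried nu S :=
  measurable S /\ forall A, measurable A -> A `<=` ~` S -> nu A = 0%E.

Lemma charge_posfE nu A : measurable A ->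
  charge_posf nu A = nu (A `&` (sval (hahn_sig nu)).1).
Proof.
move=> mA; change (jordan_pos (svalP (hahn_sig nu)) A = nu (A `&` (sval (hahn_sig nu)).1)).
by rewrite jordan_posE cjordan_posE /crestr0 mem_set.
Qed.

Lemma charge_negfE nu A : measurable A ->
  charge_negf nu A = (- nu (A `&` (sval (hahn_sig nu)).2))%E.
Proof.
move=> mA; change (jordan_neg (svalP (hahn_sig nu)) A = - nu (A `&` (sval (hahn_sig nu)).2))%E.
by rewrite jordan_negE cjordan_negE /crestr0 mem_set.
Qed.

Lemma measurable_hahn nu :
  measurable (sval (hahn_sig nu)).1 /\ measurable (sval (hahn_sig nu)).2.
Proof. by have [[mP _] [mN _] _ _] := svalP (hahn_sig nu). Qed.

Lemma charge_carried_pos nu S : charge_carried nu S -> charge_posf nu (~` S) = 0%E.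
Proof.
move=> [mS H]; rewrite charge_posfE; last exact: measurableC.
apply: H; last exact: subIsetl.
by apply: measurableI; [exact: measurableC|case: (measurable_hahn nu)].
Qed.

Lemma charge_carried_neg nu S : charge_carried nu S -> charge_negf nu (~` S) = 0%E.
Proof.
move=> [mS H]; rewrite charge_negfE; last exact: measurableC.
rewrite H ?oppe0 //.
by apply: measurableI; [exact: measurableC|case: (measurable_hahn nu)].
Qed.

Lemma fine_charge nu A : measurable A ->
  fine (nu A) = fine (charge_posf nu A) - fine (charge_negf nu A).
Proof.
move=> mA; have fp := fin_num_measure (charge_posf nu) A mA.
have fn := fin_num_measure (charge_negf nu) A mA.
rewrite (jordan_decomp (svalP (hahn_sig nu)) mA) /cadd /= cscaleN1 /=.
by rewrite -fineB.
Qed.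

Lemma charge_var_ge0 nu A : 0 <= charge_var nu A.
Proof. by rewrite addr_ge0 ?fine_ge0. Qed.

Lemma charge_var_abs nu A : measurable A -> `|fine (nu A)| <= charge_var nu A.
Proof.
move=> mA; rewrite fine_charge //; apply: le_trans (ler_normB _ _) _.
by rewrite !ger0_norm ?fine_ge0.
Qed.

Section Carried.
Variables (nu : {charge set T -> \bar R}) (S : set T).
Hypothesis nuS : charge_carried nu S.

Let mS : measurable S := nuS.1.
Let pS := charge_carried_pos nuS.
Let nS := charge_carried_neg nuS.

Lemma charge_integralD f g : bounded_on S f -> bounded_on S g ->
  charge_integral nu setT (fun x => f x + g x) =
  charge_integral nu setT f + charge_integral nu setT g.
Proof.
move=> bf bg; rewrite /charge_integral.
rewrite (RintegralD (mu := charge_posf nu)) //; try exact: bounded_on_integrable pS _ _.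
rewrite (RintegralD (mu := charge_negf nu)) //; try exact: bounded_on_integrable nS _ _.
by rewrite opprD addrACA.
Qed.

Lemma charge_integralZ (r : R) f : bounded_on S f ->
  charge_integral nu setT (fun x => r * f x) = r * charge_integral nu setT f.
Proof.
move=> bf; rewrite /charge_integral.
rewrite (RintegralZl (mu := charge_posf nu)) //; last exact: bounded_on_integrable pS _ _.
rewrite (RintegralZl (mu := charge_negf nu)) //; last exact: bounded_on_integrable nS _ _.
by rewrite mulrBr.
Qed.

Lemma charge_integral_bound f A (M : R) : measurable_fun setT f -> measurable A ->
  0 <= M -> (forall x, S x -> `|f x| <= M * \1_A x) ->
  `|charge_integral nu setT f| <= M * charge_var nu A.
Proof.
move=> mf mA M0 H; apply: le_trans (ler_normB _ _) _; rewrite /charge_var mulrDr.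
apply: lerD; first exact: (Rintegral_indic_bound mS pS).
exact: (Rintegral_indic_bound mS nS).
Qed.

End Carried.

Lemma charge_integral_indic nu A : measurable A ->
  charge_integral nu setT \1_A = fine (nu A).
Proof.
move=> mA; rewrite fine_charge // /charge_integral /Rintegral.
by rewrite !integral_indic // setIT.
Qed.

Lemma charge_integral0 nu : charge_integral nu setT (fun=> 0) = 0.
Proof. by have := charge_integral_indic nu measurable0; rewrite indic0 charge0. Qed.

Lemma charge_integral_mkcond nu A f :
  charge_integral nu A f = charge_integral nu setT (f \_ A).
Proof. by rewrite /charge_integral !(Rintegral_mkcond _ A). Qed.

(** Such a functional vanishes on simple functions, and these approximate [f] uniformly on [S].
    Identities between integrals are obtained below by applying this to the difference of the two
    sides. *)
Lemma functional_eq0 (L : (T -> R) -> R[i]) S (B : R) : measurable S ->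
  (forall f g, bounded_on S f -> bounded_on S g ->
    L (fun x => f x + g x) = L f + L g) ->
  (forall (r : R) f, bounded_on S f -> L (fun x => r * f x) = r%:C%C * L f) ->
  (forall f (M : R), measurable_fun setT f -> 0 <= M ->
    (forall x, S x -> `|f x| <= M) -> `|L f| <= (B * M)%:C%C) ->
  (forall A, measurable A -> L \1_A = 0) ->
  forall f, bounded_on S f -> L f = 0.
Proof.
move=> mS LD LZ LB L0 f bf.
have simp n (a : nat -> R) (A : nat -> set T) : (forall k, measurable (A k)) ->
    bounded_on S (fun x => \sum_(k < n) a k * \1_(A k) x) /\
    L (fun x => \sum_(k < n) a k * \1_(A k) x) = 0.
  move=> mA; elim: n => [|n [IH1 IH2]].
    have E0 : (fun x : T => \sum_(k < 0) a k * \1_(A k) x) = (fun x => 0 * \1_setT x).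
      by apply/funext => x; rewrite big_ord0 mul0r.
    rewrite E0; split; last by rewrite LZ ?L0 ?mulr0 //; exact: bounded_on_indic.
    by apply: bounded_onM; [exact: bounded_on_cst|exact: bounded_on_indic].
  have b1 : bounded_on S (fun x => a n * \1_(A n) x).
    by apply: bounded_onM; [exact: bounded_on_cst|exact: bounded_on_indic].
  under [X in bounded_on S X]eq_fun do rewrite big_ord_recr.
  under [X in L X]eq_fun do rewrite big_ord_recr.
  split; first exact: bounded_onD.
  by rewrite LD // IH2 LZ ?L0 ?mulr0 ?addr0 //; exact: bounded_on_indic.
apply/eqP; rewrite -normr_le0; apply/ler_addgt0Pr => _ /gt0_real_complex[e e0 ->].
have B0 : 0 <= B.
  have Hz x : S x -> `|cst 0 x : R| <= 1 by rewrite /= normr0 ler01.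
  have := LB (cst 0) 1 (measurable_cst _) ler01 Hz; rewrite mulr1 -ler0c.
  exact: le_trans.
have B1 : 0 < B + 1 by rewrite ltr_wpDl.
have [n [a [A [mA H]]]] := uniform_simple_approx bf (ltac:(by rewrite divr_gt0) : 0 < e / (B + 1)).
have [bs Ls] := simp n a A mA.
have bd := bounded_onB bf bs.
have -> : L f = L (fun x => f x - \sum_(k < n) a k * \1_(A k) x).
  rewrite -[RHS]addr0 -Ls -LD //; congr L.
  by apply/funext => x; rewrite subrK.
rewrite add0r; apply: le_trans (LB _ (e / (B + 1)) bd.1 _ _) _ => //.
  by rewrite ltW // divr_gt0.
by rewrite lecR mulrCA ger_pMr // ler_pdivrMr // mul1r lerDl.
Qed.

End ChargeIntegral.

Section ComplexIntegral.
Variables (R : realType) (X : ptopologicalType).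
Implicit Types (lam : complex_measure R X) (A S : set (borel X)) (f g : X -> R[i]).
Local Open Scope complex_scope.

Definition cbounded_on S f :=
  bounded_on S (@complex.Re R \o f : borel X -> R) /\
  bounded_on S (@complex.Im R \o f : borel X -> R).

Lemma cbounded_onD S f g : cbounded_on S f -> cbounded_on S g -> cbounded_on S (fun x => f x + g x).
Proof.
move=> [f1 f2] [g1 g2]; split.
  have := bounded_onD f1 g1; congr bounded_on.
  by apply/funext => x /=; rewrite ReD.
have := bounded_onD f2 g2; congr bounded_on.
by apply/funext => x /=; rewrite ImD.
Qed.

Lemma cbounded_onM S f g : cbounded_on S f -> cbounded_on S g -> cbounded_on S (fun x => f x * g x).
Proof.
move=> [f1 f2] [g1 g2]; split.
  have := bounded_onB (bounded_onM f1 g1) (bounded_onM f2 g2); congr bounded_on.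
  by apply/funext => x /=; rewrite ReM.
have := bounded_onD (bounded_onM f1 g2) (bounded_onM f2 g1); congr bounded_on.
by apply/funext => x /=; rewrite ImM.
Qed.

Lemma cbounded_on_cst S (a : R[i]) : cbounded_on S (fun=> a).
Proof. by split; exact: bounded_on_cst. Qed.

Lemma cbounded_onB S f g : cbounded_on S f -> cbounded_on S g -> cbounded_on S (fun x => f x - g x).
Proof.
move=> gf gg; have := cbounded_onD gf (cbounded_onM (cbounded_on_cst S (-1)) gg); congr cbounded_on.
by apply/funext => x; rewrite mulN1r.
Qed.

Lemma cbounded_on_real S (f : borel X -> R) : bounded_on S f -> cbounded_on S (fun x => (f x)%:C).
Proof. by move=> bf; split=> //; exact: bounded_on_cst. Qed.

Lemma cbounded_on_indic S A : measurable A -> cbounded_on S (fun x => (\1_A x)%:C).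
Proof. by move=> mA; apply: cbounded_on_real; exact: bounded_on_indic. Qed.

Lemma cbounded_on_conj S f : cbounded_on S f -> cbounded_on S (fun x => (f x)^*%R).
Proof.
move=> [f1 f2]; split.
  by move: f1; congr bounded_on; apply/funext => x /=; rewrite Re_conjC.
have := bounded_onN f2; congr bounded_on.
by apply/funext => x /=; rewrite Im_conjC.
Qed.

Lemma cbounded_on_norm_le S f : cbounded_on S f ->
  exists2 M : R, 0 <= M & forall x, S x -> `|f x| <= M%:C.
Proof.
move=> [[_ [M HM]] [_ [N HN]]]; exists (`|M| + `|N|) => [|x Sx].
  by rewrite addr_ge0.
apply: le_trans (normc_le_ReIm _) _; rewrite lecR lerD //.
  exact: le_trans (HM x Sx) (ler_norm _).
exact: le_trans (HN x Sx) (ler_norm _).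
Qed.

Lemma continuous_measurable_borel (f : X -> R) : continuous f ->
  measurable_fun setT (f : borel X -> R).
Proof.
move=> /continuousP cf; apply: (measurability _ (RGenOpens.measurableE R)).
move=> _ [_ [a [b ->] <-]]; rewrite setTI.
by apply: sub_gen_smallest; apply: cf; exact: interval_open.
Qed.

Lemma continuous_Re f : ccontinuous f -> continuous (@complex.Re R \o f).
Proof.
move=> cf x; apply/cvgrPdist_lt => e e0.
have e0' : 0 < e%:C :> R[i] by rewrite ltcR.
have := cf x => /cvgrPdist_lt/(_ _ e0'); apply: filterS => y.
by move=> /(le_lt_trans (normc_ge_Re _)); rewrite ltcR ReB.
Qed.

Lemma continuous_Im f : ccontinuous f -> continuous (@complex.Im R \o f).
Proof.
move=> cf x; apply/cvgrPdist_lt => e e0.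
have e0' : 0 < e%:C :> R[i] by rewrite ltcR.
have := cf x => /cvgrPdist_lt/(_ _ e0'); apply: filterS => y.
by move=> /(le_lt_trans (normc_ge_Im _)); rewrite ltcR ImB.
Qed.

Lemma continuous_cbounded_on S f (M : R) : ccontinuous f ->
  (forall x, S x -> `|f x| <= M%:C) -> cbounded_on S f.
Proof.
move=> cf HM; split; split.
- by apply: continuous_measurable_borel; exact: continuous_Re.
- exists M => x Sx; rewrite -lecR; apply: le_trans (normc_ge_Re (f x)) _; exact: HM.
- by apply: continuous_measurable_borel; exact: continuous_Im.
- exists M => x Sx; rewrite -lecR; apply: le_trans (normc_ge_Im (f x)) _; exact: HM.
Qed.

Definition carried lam S :=
  measurable S /\ forall A, measurable A -> A `<=` ~` S -> cm_val lam A = 0.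

(** On Borel sets this is the total variation up to a factor of at most 2, but it is a sum of
    measures and hence additive by construction. *)
Definition cm_var lam A : R := charge_var (cm_re lam) A + charge_var (cm_im lam) A.

Lemma cm_val0 lam : cm_val lam set0 = 0.
Proof. by rewrite /cm_val !charge0. Qed.

Lemma carriedT lam : carried lam setT.
Proof.
split=> // A mA; rewrite setCT => A0.
by rewrite (_ : A = set0) ?cm_val0 //; apply/seteqP; split.
Qed.

Lemma carried_re lam S : carried lam S -> charge_carried (cm_re lam) S.
Proof.
move=> [mS H]; split=> // A mA /(H A mA)[re0 _].
by rewrite -(fineK (fin_num_measure _ _ mA)) re0.
Qed.

Lemma carried_im lam S : carried lam S -> charge_carried (cm_im lam) S.
Proof.
move=> [mS H]; split=> // A mA /(H A mA)[_ im0].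
by rewrite -(fineK (fin_num_measure _ _ mA)) im0.
Qed.

Lemma cm_var_ge0 lam A : 0 <= cm_var lam A.
Proof. by rewrite addr_ge0 ?charge_var_ge0. Qed.

Lemma cm_val_var lam A : measurable A -> `|cm_val lam A| <= (cm_var lam A)%:C.
Proof.
move=> mA; apply: le_trans (normc_le_ReIm _) _.
by rewrite lecR lerD //; exact: charge_var_abs.
Qed.

Lemma cm_int_mkcond lam A f :
  cm_integral lam A f = cm_integral lam setT (fun x => (\1_A x)%:C * f x).
Proof.
rewrite /cm_integral 4!(charge_integral_mkcond _ A).
have Er : (fun x => complex.Re (f x)) \_ A = (fun x => complex.Re ((\1_A x)%:C * f x)).
  apply/funext => x; rewrite patchE indicE ReM /= mul0r subr0.
  by case: ifP; rewrite ?mul1r ?mul0r.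
have Ei : (fun x => complex.Im (f x)) \_ A = (fun x => complex.Im ((\1_A x)%:C * f x)).
  apply/funext => x; rewrite patchE indicE ImM /= mul0r addr0.
  by case: ifP; rewrite ?mul1r ?mul0r.
by rewrite Er Ei.
Qed.

Lemma cm_int_indic lam A : measurable A ->
  cm_integral lam setT (fun x => (\1_A x)%:C) = cm_val lam A.
Proof.
move=> mA; rewrite /cm_integral /=.
rewrite !charge_integral_indic //.
by rewrite !charge_integral0 subr0 add0r.
Qed.

Section Carried.
Variables (lam : complex_measure R X) (S : set (borel X)).
Hypothesis lamS : carried lam S.

Lemma cm_intD f g : cbounded_on S f -> cbounded_on S g ->
  cm_integral lam setT (fun x => f x + g x) =
  cm_integral lam setT f + cm_integral lam setT g.
Proof.
move=> [f1 f2] [g1 g2]; have cr := carried_re lamS; have ci := carried_im lamS.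
apply: complex_eqP; rewrite ?ReD ?ImD /=.
  rewrite (_ : (fun x => complex.Re (f x + g x)) =
    (fun x => (@complex.Re R \o f) x + (@complex.Re R \o g) x)); last first.
    by apply/funext => x /=; rewrite ReD.
  rewrite (_ : (fun x => complex.Im (f x + g x)) =
    (fun x => (@complex.Im R \o f) x + (@complex.Im R \o g) x)); last first.
    by apply/funext => x /=; rewrite ImD.
  by rewrite (charge_integralD cr) // (charge_integralD ci) // opprD addrACA.
rewrite (_ : (fun x => complex.Re (f x + g x)) =
  (fun x => (@complex.Re R \o f) x + (@complex.Re R \o g) x)); last first.
  by apply/funext => x /=; rewrite ReD.
rewrite (_ : (fun x => complex.Im (f x + g x)) =
  (fun x => (@complex.Im R \o f) x + (@complex.Im R \o g) x)); last first.
  by apply/funext => x /=; rewrite ImD.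
by rewrite (charge_integralD cr) // (charge_integralD ci) // addrACA.
Qed.

Lemma cm_intZ (a : R[i]) f : cbounded_on S f ->
  cm_integral lam setT (fun x => a * f x) = a * cm_integral lam setT f.
Proof.
move=> [f1 f2]; have cr := carried_re lamS; have ci := carried_im lamS.
have Er : (fun x => complex.Re (a * f x)) =
  (fun x => complex.Re a * (@complex.Re R \o f) x + - complex.Im a * (@complex.Im R \o f) x).
  by apply/funext => x /=; rewrite ReM mulNr.
have Ei : (fun x => complex.Im (a * f x)) =
  (fun x => complex.Re a * (@complex.Im R \o f) x + complex.Im a * (@complex.Re R \o f) x).
  by apply/funext => x /=; rewrite ImM.
have bZ (r : R) (h : borel X -> R) : bounded_on S h -> bounded_on S (fun x => r * h x).
  by apply: bounded_onM; exact: bounded_on_cst.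
have b1 := bZ (complex.Re a) _ f1; have b2 := bZ (- complex.Im a) _ f2.
have b3 := bZ (complex.Re a) _ f2; have b4 := bZ (complex.Im a) _ f1.
apply: complex_eqP; rewrite ?ReM ?ImM /= Er Ei
  ?(charge_integralD cr b1 b2) ?(charge_integralD ci b3 b4)
  ?(charge_integralD cr b3 b4) ?(charge_integralD ci b1 b2)
  !(charge_integralZ cr) // !(charge_integralZ ci) //; rewrite /comp; ring.
Qed.

(** The factor 2 arises from bounding the real and the imaginary part of the integral separately.
    With [M = 0] the lemma says that values off the carrier do not matter. *)
Lemma cm_int_bound f A (M : R) : cbounded_on S f -> measurable A -> 0 <= M ->
  (forall x, S x -> `|f x| <= (M * \1_A x)%:C) ->
  `|cm_integral lam setT f| <= (2 * M * cm_var lam A)%:C.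
Proof.
move=> [[f1 _] [f2 _]] mA M0 H; have cr := carried_re lamS; have ci := carried_im lamS.
have Hr x : S x -> `|complex.Re (f x)| <= M * \1_A x.
  by move=> Sx; rewrite -lecR (le_trans (normc_ge_Re _)) ?H.
have Hi x : S x -> `|complex.Im (f x)| <= M * \1_A x.
  by move=> Sx; rewrite -lecR (le_trans (normc_ge_Im _)) ?H.
apply: le_trans (normc_le_ReIm _) _; rewrite lecR /=.
have -> : 2 * M * cm_var lam A = M * cm_var lam A + M * cm_var lam A by ring.
rewrite lerD //.
  apply: le_trans (ler_normB _ _) _; rewrite /cm_var mulrDr lerD //.
    exact: (charge_integral_bound cr).
  exact: (charge_integral_bound ci).
apply: le_trans (ler_normD _ _) _; rewrite /cm_var mulrDr lerD //.
  exact: (charge_integral_bound cr).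
exact: (charge_integral_bound ci).
Qed.

End Carried.

Lemma complex_functional_eq0 (L : (X -> R[i]) -> R[i]) S (B : R) : measurable S -> 0 <= B ->
  (forall f g, cbounded_on S f -> cbounded_on S g -> L (fun x => f x + g x) = L f + L g) ->
  (forall a f, cbounded_on S f -> L (fun x => a * f x) = a * L f) ->
  (forall f (M : R), cbounded_on S f -> 0 <= M ->
    (forall x, S x -> `|f x| <= M%:C) -> `|L f| <= (B * M)%:C) ->
  (forall A, measurable A -> L (fun x => (\1_A x)%:C) = 0) ->
  forall f, cbounded_on S f -> L f = 0.
Proof.
move=> mS B0 LD LZ LB L0.
have Lr (f : borel X -> R) : bounded_on S f -> L (fun x => (f x)%:C) = 0.
  move=> bf.
  have H := @functional_eq0 _ (borel X) R (fun h => L (fun x => (h x)%:C)) S B mS.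
  have {}H := fun a b c d => H a b c d f bf.
  apply: H => [h k bh bk|r h bh|h M mh M0 H|A mA]; last exact: L0.
  - rewrite -LD; try exact: cbounded_on_real.
    by congr L; apply/funext => x; rewrite rmorphD.
  - rewrite -LZ; last exact: cbounded_on_real.
    by congr L; apply/funext => x; rewrite rmorphM.
  - apply: LB => //.
      by apply: cbounded_on_real; split=> //; exists M.
    by move=> x Sx; rewrite normc_real lecR H.
move=> f [f1 f2].
have -> : f = (fun x => (complex.Re (f x))%:C + 'i * (complex.Im (f x))%:C).
  by apply/funext => x; exact: complexE.
rewrite LD; last 2 first.
- exact: cbounded_on_real.
- by apply: cbounded_onM; [exact: cbounded_on_cst|exact: cbounded_on_real].
by rewrite LZ ?(Lr (@complex.Re R \o f)) ?(Lr (@complex.Im R \o f)) ?mulr0 ?addr0 //; exact: cbounded_on_real.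
Qed.

End ComplexIntegral.

(** * Vanishing double integrals *)

Section DoubleIntegral.
Variables (R : realType) (X : ptopologicalType).
Implicit Types (lam : complex_measure R X) (A S : set (borel X)) (f g : X -> R[i]).
Let C : numClosedFieldType := R[i].
Local Open Scope complex_scope.

Lemma charge_carried_copp (nu : {charge set (borel X) -> \bar R}) S :
  charge_carried nu S -> charge_carried (copp nu) S.
Proof.
move=> [mS H]; split=> // A mA AS; change (- nu A = 0)%E.
by rewrite H ?oppe0.
Qed.

(** The integral uses a chosen Hahn decomposition, and the choice for [copp nu] need not be the one
    for [nu] with its sets exchanged. The two sides are therefore compared on indicators. *)
Lemma charge_integral_copp (nu : {charge set (borel X) -> \bar R}) S (f : borel X -> R) :
  charge_carried nu S -> bounded_on S f ->
  charge_integral (copp nu) setT f = - charge_integral nu setT f.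
Proof.
move=> nuS bf; have cS := charge_carried_copp nuS; apply/eqP; rewrite -addr_eq0.
apply/eqP/complexI; rewrite rmorph0.
have H := @functional_eq0 _ (borel X) R (fun h : borel X -> R =>
  (charge_integral (copp nu) setT h + charge_integral nu setT h)%:C) S
  (charge_var (copp nu) setT + charge_var nu setT) nuS.1.
have {}H := fun a b c d => H a b c d f bf.
apply: H => [h k bh bk|r h bh|h M mh M0 H|A mA].
- rewrite (charge_integralD nuS) // (charge_integralD cS) // -rmorphD; congr _%:C.
  by rewrite addrACA.
- by rewrite (charge_integralZ nuS) // (charge_integralZ cS) // -mulrDr rmorphM.
- have H1 x : S x -> `|h x| <= M * \1_setT x by rewrite indicT mulr1; exact: H.
  rewrite normc_real lecR.
  apply: le_trans (ler_normD _ _) _; rewrite mulrC mulrDr lerD //.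
    exact: (charge_integral_bound cS).
  exact: (charge_integral_bound nuS).
- rewrite !charge_integral_indic //.
  have E : fine (- nu A)%E + fine (nu A) = 0 by rewrite fineN addNr.
  exact: (congr1 (real_complex R) E).
Qed.

Lemma cm_int_conj lam S f : carried lam S -> cbounded_on S f ->
  cm_integral (cm_conj lam) setT f = ((cm_integral lam setT (fun x => (f x)^*%R))^*)%R.
Proof.
move=> lamS [f1 f2]; have ci := carried_im lamS; have cr := carried_re lamS.
have Er : (fun x => complex.Re (f x)^*%R) = (@complex.Re R \o f).
  by apply/funext => x; rewrite Re_conjC.
have Ei : (fun x => complex.Im (f x)^*%R) = (fun x => -1 * (@complex.Im R \o f) x).
  by apply/funext => x; rewrite Im_conjC mulN1r.
apply: complex_eqP; rewrite ?Re_conjC ?Im_conjC /= Er Ei.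
  rewrite (charge_integral_copp ci f2) (charge_integralZ ci _ f2) mulN1r //.
rewrite (charge_integral_copp ci f1) (charge_integralZ cr _ f2) /comp; ring.
Qed.

Lemma cm_int0 lam A : cm_integral lam A (fun=> 0) = 0.
Proof.
rewrite cm_int_mkcond.
have -> : (fun x => (\1_A x)%:C * 0) = (fun x : X => 0 : R[i]).
  by apply/funext => x; rewrite mulr0.
by rewrite /cm_integral /= !charge_integral0 subrr addr0.
Qed.

Section Kernel.
Variables (K : X -> X -> R[i]).
Hypotheses (cK : kernel_continuous K) (pK : psd K).
Variables (lam : complex_measure R X) (S : set (borel X)) (k : R).
Hypotheses (lamS : carried lam S) (k0 : 0 <= k).
Hypothesis KS : forall x, S x -> K x x <= k%:C.

Local Notation hil := (@hilb C X K).
Local Notation hp := (@hip C X K).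

Lemma dominated_norm_le F (n : R) : 0 <= n -> dominated (C := C) K F (n ^+ 2)%:C ->
  forall x, S x -> `|F x| <= (n * Num.sqrt k)%:C.
Proof.
move=> n0 dF x Sx.
have p0 : 0 <= (n * Num.sqrt k)%:C :> R[i] by rewrite ler0c mulr_ge0 ?sqrtr_ge0.
rewrite -(@ler_pXn2r _ 2) ?nnegrE //.
apply: le_trans (dominated_le x pK dF) _.
have -> : (n * Num.sqrt k)%:C ^+ 2 = (n ^+ 2)%:C * k%:C.
  by rewrite -rmorphXn exprMn sqr_sqrtr // -rmorphM.
by rewrite ler_wpM2l ?KS // ler0c exprn_ge0.
Qed.

Lemma hilb_norm F : hil F -> exists2 n : R, 0 <= n & ipnorm hp F = n%:C.
Proof.
move=> HF; have := ipnorm_ge0 (hilb_sip (C := C) (@complex_complete R) pK) HF.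
by case: (ipnorm hp F) => a b; rewrite lecE /= => /andP[/eqP -> a0]; exists a.
Qed.

Lemma hilb_norm_dominated F (n : R) : hil F -> ipnorm hp F = n%:C ->
  dominated (C := C) K F (n ^+ 2)%:C.
Proof.
move=> HF E; have := rkhs_dominated (hilb_is_rkhs pK) HF.
by rewrite -[hip K F F]sqrtCK -/(ipnorm _ _) E rmorphXn.
Qed.

Lemma hilb_cbounded_on F : hil F -> cbounded_on S F.
Proof.
move=> HF; have [n n0 E] := hilb_norm HF.
have dF := hilb_norm_dominated HF E.
apply: (continuous_cbounded_on (M := n * Num.sqrt k)); last exact: dominated_norm_le.
apply: (rkhs_continuous cK pK); apply/(rkhsP F pK).
by exists (n ^+ 2)%:C => //; rewrite ler0c exprn_ge0.
Qed.

Lemma integral_on_eq0 A : measurable A -> double_integral K lam A = 0 ->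
  forall F, rkhs K F -> cm_integral lam A F = 0.
Proof.
move=> mA.
have S0 := hilb_sip (C := C) (@complex_complete R) pK.
have rK := hilb_is_rkhs pK.
pose Phi F := cm_integral lam A F.
have PhiE F : Phi F = cm_integral lam setT (fun x => (\1_A x)%:C * F x).
  exact: cm_int_mkcond.
have gA F : hil F -> cbounded_on S (fun x => (\1_A x)%:C * F x).
  by move=> HF; apply: cbounded_onM; [exact: cbounded_on_indic|exact: hilb_cbounded_on].
pose B := 2 * Num.sqrt k * cm_var lam setT.
have B0 : 0 <= B by rewrite !mulr_ge0 ?sqrtr_ge0 ?cm_var_ge0.
have PhiB F : hil F -> `|Phi F| <= B%:C * ipnorm hp F.
  move=> HF; have [n n0 E] := hilb_norm HF.
  have dF := hilb_norm_dominated HF E.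
  rewrite PhiE E -rmorphM /=.
  have -> : B * n = 2 * (n * Num.sqrt k) * cm_var lam setT by rewrite /B; ring.
  apply: (cm_int_bound lamS (gA F HF)) => // [|x Sx].
    by rewrite mulr_ge0 ?sqrtr_ge0.
  rewrite indicT mulr1 normrM; apply: le_trans (dominated_norm_le n0 dF Sx).
  by rewrite ler_piMl // indicE normc_real lecR ger0_norm ?lern1 ?leq_b1.
have PhiD a F G : hil F -> hil G -> Phi (fun x => a * F x + G x) = a * Phi F + Phi G.
  move=> HF HG; rewrite !PhiE -(cm_intZ lamS _ (gA F HF)) -(cm_intD lamS _ (gA G HG)).
    by congr cm_integral; apply/funext => x; ring.
  by apply: cbounded_onM (gA F HF); exact: cbounded_on_cst.
have PhiC s : Phi (comb K s) = \sum_(u <- s) u.1 * Phi (K^~ u.2).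
  elim: s => [|u s IH].
    rewrite big_nil -[RHS](cm_int0 lam A); congr cm_integral.
    by apply/funext => x; rewrite /comb big_nil.
  rewrite big_cons -IH -PhiD.
  - by congr Phi; apply/funext => x; rewrite /comb big_cons.
  - exact: rkhs_section rK _.
  - by have [] := rkhs_comb rK s.
pose g y := ((Phi (K^~ y))^*)%R.
have pg s : pairing g s = ((Phi (comb K s))^*)%R.
  by rewrite PhiC rmorph_sum; apply: eq_bigr => u _; rewrite rmorphM.
(* The bound of [Phi] on finite combinations is exactly domination of [g]; [dominated_hilb] thus
   takes the place of the Riesz theorem. *)
have dg : dominated (C := C) K g (B ^+ 2)%:C.
  apply/dominatedP => s; rewrite pg norm_conjC -(rkhs_comb_norm rK).
  have [Hs _] := rkhs_comb rK s.
  rewrite -[hip K _ _]sqrtCK rmorphXn -exprMn.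
  apply: lerXn2r; rewrite ?nnegrE; [exact: normr_ge0| |exact: PhiB].
  by rewrite mulr_ge0 ?ler0c //; exact: (ipnorm_ge0 S0).
have Hg : hil g by apply: dominated_hilb dg; rewrite ?ler0c ?exprn_ge0.
(* Both sides agree on finite combinations and are bounded in the norm, so density carries the
   identity to all of the space. *)
have Phig F : hil F -> Phi F = hp F g.
  move=> HF; apply/eqP; rewrite -subr_eq0 -normr_le0; apply/ler_addgt0Pr => e e0.
  have ng := ipnorm_ge0 S0 Hg.
  have M0 : 0 <= (B%:C : C) + ipnorm hp g by rewrite addr_ge0 // ler0c.
  have M1 : 0 < (B%:C : C) + ipnorm hp g + 1 by rewrite ltr_wpDl.
  have [|s Hs] := hilb_dense (C := C) (@complex_complete R) pK HF
     (_ : 0 < e / ((B%:C : C) + ipnorm hp g + 1)); first by rewrite divr_gt0.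
  have [Hc Ec] := rkhs_comb rK s.
  have HD := sipB S0 HF Hc.
  have E1 : hp (F \- comb K s) g = hp F g - hp (comb K s) g := sipBl S0 HF Hc Hg.
  have E2 : hp (comb K s) g = Phi (comb K s).
    by rewrite (sip_conj S0 Hg Hc) (Ec _ Hg) pg conjCK.
  have E3 : Phi (F \- comb K s) = Phi F - Phi (comb K s).
    have := PhiD (-1) _ _ Hc HF; rewrite mulN1r addrC => <-; congr Phi.
    by apply/funext => x; rewrite mulN1r addrC.
  have -> : Phi F - hp F g = Phi (F \- comb K s) - hp (F \- comb K s) g.
    by rewrite E1 E2 E3; ring.
  rewrite add0r; apply: le_trans (ler_normB _ _) _.
  apply: (@le_trans _ _ (((B%:C : C) + ipnorm hp g) * ipnorm hp (F \- comb K s))).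
    rewrite mulrDl lerD ?PhiB // mulrC.
    exact: ip_le_norm S0 _ _ HD Hg.
  apply: (@le_trans _ _ (((B%:C : C) + ipnorm hp g) * (e / ((B%:C : C) + ipnorm hp g + 1)))).
    by rewrite ler_wpM2l // ltW.
  by rewrite mulrCA ger_pMr // ler_pdivrMr // mul1r lerDl.
(* The inner integral at [y] is the conjugate of [g y]; integrating it against [cm_conj lam] yields
   the conjugate of [Phi g]. *)
have -> : double_integral K lam A = ((hp g g)^*)%R.
  rewrite /double_integral cm_int_mkcond (cm_int_conj lamS); last first.
    apply: cbounded_onM; first exact: cbounded_on_indic.
    have := cbounded_on_conj (hilb_cbounded_on Hg); congr cbounded_on.
    by apply/funext => y; rewrite /g conjCK.
  rewrite -Phig // PhiE; congr (_^*)%R; congr cm_integral.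
  apply/funext => x; rewrite rmorphM /=; congr (_ * _).
  by rewrite conj_Creal //; apply/complex_realP; exists (\1_A x).
move=> /eqP; rewrite conjC_eq0 => /eqP g0 F /(rkhsP F pK)[c c0 dF].
have HF := dominated_hilb pK c0 dF.
have G0 : g = (fun=> 0) := hilb_definite (C := C) (@complex_complete R) pK Hg g0.
have E1 : hp F (fun=> 0) = (hp (fun=> 0) F)^*%R := sip_conj S0 (sip_zero S0) HF.
have E2 : hp (fun=> 0) F = 0 := sip0l S0 HF.
by have := Phig F HF; rewrite G0 E1 E2 rmorph0.
Qed.

End Kernel.

Lemma double_integral_sections0 (K : X -> X -> R[i]) lam A :
  (forall y, cm_integral lam A (fun x => K x y) = 0) -> double_integral K lam A = 0.
Proof.
move=> H; rewrite /double_integral -[RHS](cm_int0 (cm_conj lam) A); congr cm_integral.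
by apply/funext => y.
Qed.

End DoubleIntegral.

(** * Null forms of a product kernel, and the finitely supported case *)

Section NullForms.
Variables (R : realType) (X : ptopologicalType) (p q : X -> X -> R[i]).
Hypotheses (cp : kernel_continuous p) (pp : psd p).
Hypotheses (cq : kernel_continuous q) (pq : psd q).
Implicit Types (lam : complex_measure R X) (A S : set (borel X)) (F G : X -> R[i]).
Let C : numClosedFieldType := R[i].
Local Open Scope complex_scope.

Lemma kernel_mul_continuous : kernel_continuous (kernel_mul p q).
Proof. by move=> z; apply: (@cvgM R[i]); [exact: cp|exact: cq]. Qed.

Lemma kernel_mul_psd : psd (kernel_mul p q).
Proof. exact: psdM. Qed.

Lemma rkhs_mul F G : rkhs p F -> rkhs q G -> rkhs (kernel_mul p q) (fun x => F x * G x).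
Proof.
move=> /(rkhsP F pp)[c c0 dF] /(rkhsP G pq)[d d0 dG]; apply/(rkhsP _ kernel_mul_psd).
by exists (c * d); [rewrite mulr_ge0|exact: dominatedM].
Qed.

Lemma rkhs_kernel_section K y : psd K -> rkhs K (fun x : X => K x y : R[i]).
Proof.
by move=> pK; apply/(rkhsP _ pK); exists (K y y); [exact: psd_diag|exact: dominated_section].
Qed.

Lemma rkhs_cbounded_on K F S (k : R) : kernel_continuous K -> psd K -> 0 <= k ->
  (forall x, S x -> K x x <= k%:C) -> rkhs K F -> cbounded_on S F.
Proof.
move=> cK pK k0 KS /(rkhsP F pK)[c c0 dF].
exact: (hilb_cbounded_on cK pK k0 KS (dominated_hilb pK c0 dF)).
Qed.

Section Carried.
Variables (lam : complex_measure R X) (S : set (borel X)) (k : R).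
Hypotheses (lamS : carried lam S) (k0 : 0 <= k).
Hypotheses (pS : forall x, S x -> p x x <= k%:C) (qS : forall x, S x -> q x x <= k%:C).

(** For fixed [G] the integral is a functional of [F]; the hypothesis says that it vanishes on
    indicators, so [complex_functional_eq0] applies. *)
Lemma integral_mul_eq0 F G : cbounded_on S F -> cbounded_on S G ->
  (forall A, measurable A -> cm_integral lam A G = 0) ->
  cm_integral lam setT (fun x => F x * G x) = 0.
Proof.
move=> gF gG G0; have [M M0 HM] := cbounded_on_norm_le gG.
have H := @complex_functional_eq0 R X (fun F => cm_integral lam setT (fun x => F x * G x)) S
  (2 * M * cm_var lam setT) lamS.1.
have {}H := fun a b c d e => H a b c d e F gF.
apply: H => [|f g gf gg|a f gf|f N gf N0 Hf|A mA].
- by rewrite !mulr_ge0 // cm_var_ge0.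
- rewrite -(cm_intD lamS); try exact: cbounded_onM.
  by congr cm_integral; apply/funext => x; rewrite mulrDl.
- rewrite -(cm_intZ lamS); last exact: cbounded_onM.
  by congr cm_integral; apply/funext => x; rewrite mulrA.
- have -> : 2 * M * cm_var lam setT * N = 2 * (N * M) * cm_var lam setT by ring.
  apply: (cm_int_bound lamS) => //; first exact: cbounded_onM.
    exact: mulr_ge0.
  by move=> x Sx; rewrite indicT mulr1 normrM rmorphM ler_pM ?Hf ?HM.
- by rewrite -cm_int_mkcond G0.
Qed.

(** The hypothesis [step] isolates the only use of strictness of [p]; it is provided by [spd_step],
    [universal_step] and [ispd_step]. *)
Lemma null_form_equiv_at :
  (forall z, (forall F, rkhs p F -> cm_integral lam setT (fun x => F x * q x z) = 0) ->
    forall A, measurable A -> cm_integral lam A (fun x => q x z) = 0) ->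
  double_integral (kernel_mul p q) lam setT = 0 <->
  (forall A, measurable A -> forall z, cm_integral lam A (fun x => q x z) = 0).
Proof.
move=> step; split=> [D0 A mA z|H].
  apply: step mA => F rF.
  have kk : 0 <= k * k by rewrite mulr_ge0.
  apply: (integral_on_eq0 kernel_mul_continuous kernel_mul_psd lamS kk) => // [x Sx|].
    by rewrite rmorphM ler_pM ?psd_diag ?pS ?qS.
  exact: rkhs_mul rF (rkhs_kernel_section z pq).
apply: double_integral_sections0 => y.
apply: (integral_mul_eq0 _ _ (fun A mA => H A mA y)).
  exact: (rkhs_cbounded_on cp pp k0 pS (rkhs_kernel_section y pp)).
exact: (rkhs_cbounded_on cq pq k0 qS (rkhs_kernel_section y pq)).
Qed.

Lemma sections_eq0P A : measurable A ->
  double_integral q lam A = 0 <-> forall z, cm_integral lam A (fun x => q x z) = 0.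
Proof.
move=> mA; split=> [D0 z|]; last exact: double_integral_sections0.
exact: (integral_on_eq0 cq pq lamS k0 qS mA D0 (rkhs_kernel_section z pq)).
Qed.

End Carried.

Lemma compact_diag_bound K (D : set X) : kernel_continuous K -> psd K -> compact D ->
  exists2 k : R, 0 <= k & forall x, D x -> K x x <= k%:C.
Proof.
move=> cK pK cD.
have cRe : continuous (fun x => complex.Re (K x x)).
  apply: continuous_Re => x.
  have /= := @continuous_comp _ _ _ (fun x => (x, x)) (fun z => K z.1 z.2 : R[i]^o) x.
  by apply; [apply: cvg_pair => //|exact: cK].
have cI : compact ((fun x => complex.Re (K x x)) @` D).
  by apply: continuous_compact => //; exact: continuous_subspaceT.
have [M [_ HM]] := compact_bounded cI.
exists (`|M| + 1) => [|x Dx]; first by rewrite addr_ge0.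
have : complex.Re (K x x) <= `|M| + 1.
  apply: le_trans (ler_norm _) _; apply: (HM (`|M| + 1)); last by exists x.
  by rewrite (le_lt_trans (ler_norm M)) // ltrDl.
by have := psd_diag x pK; case: (K x x) => a b; rewrite !lecE /= => /andP[/eqP -> _] ->; rewrite eqxx.
Qed.

Hypothesis hX : hausdorff_space X.

Lemma measurable_borel_compact (D : set X) : compact D -> measurable (D : set (borel X)).
Proof.
move=> cD; rewrite -[D]setCK; apply: measurableC; apply: sub_gen_smallest.
by apply: closed_openC; exact: compact_closed.
Qed.

Lemma measurable_borel_set1 (x : X) : measurable ([set x] : set (borel X)).
Proof. by apply: measurable_borel_compact; exact: compact_set1. Qed.

Section FiniteSupport.
Variables (lam : complex_measure R X) (s : seq X).
Hypotheses (us : uniq s) (lamS : carried lam [set` s]).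

(** On the carrier [f] coincides with a finite sum of multiples of indicators of points, and
    [cm_int_bound] with [M = 0] discards the difference elsewhere. *)
Lemma cm_int_finite f : cbounded_on [set` s] f ->
  cm_integral lam setT f = \sum_(x <- s) cm_val lam [set x] * f x.
Proof.
move=> gf.
have E0 : cm_integral lam setT f =
    cm_integral lam setT (fun y => \sum_(x <- s) f x * (\1_[set x] y)%:C).
  have gs : forall t : seq X, cbounded_on [set` s] (fun y => \sum_(x <- t) f x * (\1_[set x] y)%:C).
    elim=> [|x t IH]; first by under [X in cbounded_on _ X]eq_fun do rewrite big_nil; exact: cbounded_on_cst.
    under [X in cbounded_on _ X]eq_fun do rewrite big_cons; apply: cbounded_onD => //; apply: cbounded_onM; first exact: cbounded_on_cst.
    by apply: cbounded_on_indic; exact: measurable_borel_set1.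
  apply/eqP; rewrite -subr_eq0 -mulN1r -(cm_intZ lamS) // -(cm_intD lamS) //; last first.
    by apply: cbounded_onM => //; exact: cbounded_on_cst.
  rewrite -normr_le0.
  apply: le_trans (cm_int_bound lamS (A := setT) (M := 0) _ _ _ _) _ => //.
  - by apply: cbounded_onD => //; apply: cbounded_onM => //; exact: cbounded_on_cst.
  - move=> y sy; rewrite mul0r normr_le0 (bigD1_seq y) //= indicE mem_set // mulr1.
    rewrite big1 ?addr0 ?mulN1r ?subrr // => x xy.
    rewrite indicE memNset ?mulr0 //= => E; by rewrite E eqxx in xy.
  - by rewrite mulr0 mul0r.
rewrite E0 {E0}.
have gs : forall t : seq X, cbounded_on [set` s] (fun y => \sum_(x <- t) f x * (\1_[set x] y)%:C) /\
   cm_integral lam setT (fun y => \sum_(x <- t) f x * (\1_[set x] y)%:C)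
   = \sum_(x <- t) cm_val lam [set x] * f x.
  elim=> [|x t [IH1 IH2]].
    under [X in cbounded_on _ X]eq_fun do rewrite big_nil; split; first exact: cbounded_on_cst.
    by under [X in cm_integral _ _ X]eq_fun do rewrite big_nil; rewrite big_nil cm_int0.
  have g1 : cbounded_on [set` s] (fun y : X => (\1_[set x] y)%:C : R[i]).
    have mx := measurable_borel_set1 x; exact: (@cbounded_on_indic R X [set` s] [set x] mx).
  have g2 : cbounded_on [set` s] (fun y => f x * (\1_[set x] y)%:C).
    by apply: cbounded_onM => //; exact: cbounded_on_cst.
  under [X in cbounded_on _ X]eq_fun do rewrite big_cons; split; first exact: cbounded_onD.
  under [X in cm_integral _ _ X]eq_fun do rewrite big_cons.
  rewrite (cm_intD lamS) // (cm_intZ lamS) // cm_int_indic; last exact: measurable_borel_set1.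
  by rewrite IH2 big_cons mulrC.
by have [_ ->] := gs s.
Qed.

End FiniteSupport.

(** Put b(x) = lam({x}) q(x, z) for the points [x] of [s]. Testing the hypothesis on the sections of
    [p] makes every column sum of b(x) p(x, y) vanish, hence the form of [p] at [b] as well, and
    strictness gives [b = 0]. *)
Lemma spd_step lam (s : seq X) (z : X) : spd p -> uniq s -> carried lam [set` s] ->
  (forall F, rkhs p F -> cm_integral lam setT (fun x => F x * q x z) = 0) ->
  forall A, measurable A -> cm_integral lam A (fun x => q x z) = 0.
Proof.
move=> [_ sp] us lamS H A mA.
have cs : compact [set` s] by apply: finite_compact; exact: finite_seq.
have [k k0 pS] := compact_diag_bound cp pp cs.
have [l l0 qS] := compact_diag_bound cq pq cs.
have gp y := rkhs_cbounded_on cp pp k0 pS (rkhs_kernel_section y pp).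
have gq := rkhs_cbounded_on cq pq l0 qS (rkhs_kernel_section z pq).
pose b (i : 'I_(size s)) := cm_val lam [set nth point s i] * q (nth point s i) z.
have b0 i : b i = 0.
  apply: (sp _ _ (fun i : 'I_(size s) => nth point s i)).
    by move=> u v /eqP; rewrite nth_uniq // => /eqP/val_inj.
  rewrite /kernel_sum exchange_big big1 // => j _ /=.
  have := H _ (rkhs_kernel_section (nth point s j) pp).
  rewrite (cm_int_finite us lamS); last exact: cbounded_onM.
  rewrite (big_nth point) big_mkord => E.
  rewrite -[RHS](mulr0 (b j)^*%R) -[in RHS]E mulr_sumr; apply: eq_bigr => u _.
  by rewrite /b; ring.
rewrite cm_int_mkcond (cm_int_finite us lamS); last first.
  by apply: cbounded_onM => //; exact: cbounded_on_indic.
rewrite (big_nth point) big_mkord big1 // => i _.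
by rewrite mulrCA -/(b i) b0 mulr0.
Qed.

End NullForms.

(** * Regularity of Radon measures *)

Section Variation.
Variables (R : realType) (X : ptopologicalType).
Implicit Types (lam : complex_measure R X) (A C D E U S : set (borel X)).
Local Open Scope complex_scope.

Definition cm_abs lam A : R := complex.Re `|cm_val lam A|.

Lemma cm_absE lam A : `|cm_val lam A| = (cm_abs lam A)%:C.
Proof. by rewrite /cm_abs RRe_real // normr_real. Qed.

Lemma cm_abs_ge0 lam A : 0 <= cm_abs lam A.
Proof. by rewrite -ler0c -cm_absE. Qed.

Lemma cm_abs0 lam : cm_abs lam set0 = 0.
Proof. by rewrite /cm_abs cm_val0 normr0. Qed.

Lemma cm_valU lam A D : measurable A -> measurable D -> A `&` D = set0 ->
  cm_val lam (A `|` D) = cm_val lam A + cm_val lam D.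
Proof.
move=> mA mD AD; rewrite /cm_val !chargeU // !fineD ?fin_num_measure //.
Qed.

Definition variation_measure lam : {measure set (borel X) -> \bar R} :=
  measure_add (measure_add (charge_posf (cm_re lam)) (charge_negf (cm_re lam)))
    (measure_add (charge_posf (cm_im lam)) (charge_negf (cm_im lam))).

Lemma variation_measureE lam A : measurable A -> variation_measure lam A = (cm_var lam A)%:E.
Proof.
move=> mA; rewrite /variation_measure /cm_var /charge_var !EFinD !fineK ?fin_num_measure //.
by apply: etrans (measure_addE _ _ _) _; congr (_ + _)%E; exact: measure_addE.
Qed.

Lemma le_cm_var lam A D : measurable A -> measurable D -> A `<=` D ->
  cm_var lam A <= cm_var lam D.
Proof.
move=> mA mD AD; have : (variation_measure lam A <= variation_measure lam D)%E by rewrite le_measure ?inE.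
by rewrite !variation_measureE.
Qed.

Lemma cm_varU lam A D : measurable A -> measurable D ->
  cm_var lam (A `|` D) <= cm_var lam A + cm_var lam D.
Proof.
move=> mA mD; have mU := measurableU _ _ mA mD.
have : (variation_measure lam (A `|` D) <= variation_measure lam A + variation_measure lam D)%E by exact: measureU2.
by rewrite !variation_measureE.
Qed.

Definition partition_of E (F : (set (borel X))^nat) :=
  [/\ forall n, measurable (F n), trivIset setT F & \bigcup_n F n = E].

Local Notation V := cm_variation.

Lemma le_variation lam E F : partition_of E F ->
  (\sum_(0 <= n <oo) (cm_abs lam (F n))%:E <= V lam E)%E.
Proof. by move=> pF; apply: ereal_sup_ubound; exists F. Qed.

Lemma variation_le lam E x :
  (forall F, partition_of E F -> (\sum_(0 <= n <oo) (cm_abs lam (F n))%:E <= x)%E) ->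
  (V lam E <= x)%E.
Proof. by move=> H; apply: ge_ereal_sup => _ [F pF <-]; exact: H. Qed.

Lemma variation_le_measure lam (m : {measure set (borel X) -> \bar R}) (M : R) E :
  measurable E -> (forall A, measurable A -> ((cm_abs lam A)%:E <= M%:E * m A)%E) ->
  (V lam E <= M%:E * m E)%E.
Proof.
move=> mE H; apply: variation_le => F [mF tF FE].
have -> : (M%:E * m E = \sum_(0 <= n <oo) M%:E * m (F n))%E.
  rewrite nneseriesZl //; congr (_ * _)%E; rewrite -FE measure_bigcup //.
  by apply: eq_eseriesl => n; rewrite in_setT.
by apply: lee_nneseries => n // _; rewrite ?lee_fin ?cm_abs_ge0 // H.
Qed.

Lemma variation_le_var lam E : measurable E -> (V lam E <= (cm_var lam E)%:E)%E.
Proof.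
move=> mE; rewrite -variation_measureE // -[X in (_ <= X)%E]mul1e.
apply: variation_le_measure => // A mA; rewrite mul1e variation_measureE // lee_fin -lecR -cm_absE.
exact: cm_val_var.
Qed.

(* Prepend [D1], [D2] and the rest of [E `\` C] to a partition of [C]. *)
Lemma variation_split lam E C D1 D2 : measurable E -> measurable C ->
  measurable D1 -> measurable D2 -> C `<=` E -> D1 `<=` E `\` C -> D2 `<=` E `\` C ->
  D1 `&` D2 = set0 ->
  ((cm_abs lam D1 + cm_abs lam D2)%:E + V lam C <= V lam E)%E.
Proof.
move=> mE mC m1 m2 CE s1 s2 d12.
rewrite addeC -leeBrDr //; apply: variation_le => F [mF tF FC]; rewrite leeBrDr //.
pose G n := if n is n'.+1 then if n' is n''.+1 then if n'' is k.+1 then F k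
  else E `\` C `\` D1 `\` D2 else D2 else D1.
have FiC k : F k `<=` C by rewrite -FC; exact: bigcup_sup.
have pG : partition_of E G.
  split=> [[|[|[|k]]] /=| |] //.
  - by do !apply: measurableD.
  - apply/trivIsetP => i j _ _; wlog ij : i j / (i < j)%N.
      move=> H; rewrite neq_ltn => /orP[ij|ij]; first by rewrite H ?ltn_eqF.
      by rewrite setIC H ?ltn_eqF.
    move=> _; case: i ij => [|[|[|i]]]; case: j => [|[|[|j]]] //= ij.
    + by apply/seteqP; split=> // x [] x1 [] [].
    + by apply/seteqP; split=> // x [] /s1[_ nC] /FiC.
    + by apply/seteqP; split=> // x [] x2 [] _.
    + by apply/seteqP; split=> // x [] /s2[_ nC] /FiC.
    + by apply/seteqP; split=> // x [] [] [] [] _ nC _ _ /FiC.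
    + by move/trivIsetP : tF => /(_ i j); apply => //; rewrite ltn_eqF.
  - apply/seteqP; split=> [x [[|[|[|k]]] _ /=]|x Ex].
    + by case/s1.
    + by case/s2.
    + by case=> [] [] [].
    + by move/FiC/CE.
    have [x1|n1] := pselect (D1 x); first by exists 0%N.
    have [x2|n2] := pselect (D2 x); first by exists 1%N.
    have [xC|nC] := pselect (C x); last by exists 2%N.
    by move: xC; rewrite -FC => -[k _ Fk]; exists k.+3.
apply: le_trans (le_variation lam pG).
have G0 k : (0 <= (cm_abs lam (G k))%:E)%E by rewrite lee_fin cm_abs_ge0.
rewrite (@nneseries_split R (fun k => (cm_abs lam (G k))%:E) 0%N 3%N); last first.
  by move=> k _; exact: G0.
rewrite add0n -(nneseries_addn 3) //.
under [X in (_ <= _ + X)%E]eq_eseriesr do rewrite addn3.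
rewrite !big_nat_recr //= big_nil add0e addeC.
rewrite EFinD leeD2r //=.
by rewrite leeDl // lee_fin cm_abs_ge0.
Qed.

Lemma variation_ge0 lam E : measurable E -> (0 <= V lam E)%E.
Proof.
move=> mE; have p0 : partition_of E (fun n => if n is 0%N then E else set0).
  split=> [[|n] //| |].
    apply/trivIsetP => -[|i] [|j] //= _ _ _; rewrite ?setI0 ?set0I //.
  apply/seteqP; split=> [x [[|n] _ //]|x Ex]; by exists 0%N.
apply: le_trans (le_variation lam p0).
by apply: nneseries_ge0 => n _ _; rewrite lee_fin cm_abs_ge0.
Qed.

Lemma variation_fin lam E : measurable E -> V lam E \is a fin_num.
Proof.
move=> mE; rewrite ge0_fin_numE ?variation_ge0 //.
exact: le_lt_trans (variation_le_var lam mE) (ltry _).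
Qed.

Lemma le_variation_sub lam E C : measurable E -> measurable C -> C `<=` E ->
  (V lam C <= V lam E)%E.
Proof.
move=> mE mC CE.
have := variation_split lam mE mC measurable0 measurable0 CE (sub0set _) (sub0set _) (setI0 _).
by rewrite !cm_abs0 addr0 add0e.
Qed.

Lemma cm_abs_le_variation lam E A : measurable E -> measurable A -> A `<=` E ->
  ((cm_abs lam A)%:E <= V lam E)%E.
Proof.
move=> mE mA AE.
have := variation_split lam mE measurable0 mA measurable0 (sub0set _).
rewrite setD0 setI0 => /(_ AE (sub0set _) erefl); rewrite cm_abs0 addr0.
by apply: le_trans; rewrite leeDl // variation_ge0.
Qed.

Lemma charge_var_split (nu : {charge set (borel X) -> \bar R}) D : measurable D ->
  exists D1 D2, [/\ measurable D1 /\ measurable D2, D1 `<=` D, D2 `<=` D, D1 `&` D2 = set0 &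
    charge_var nu D <= `|fine (nu D1)| + `|fine (nu D2)|].
Proof.
move=> mD; have [mP mN] := measurable_hahn nu.
have [_ _ _ PN] := svalP (hahn_sig nu).
exists (D `&` (sval (hahn_sig nu)).1), (D `&` (sval (hahn_sig nu)).2).
split; try exact: subIsetl; first by split; exact: measurableI.
  by rewrite setIACA PN setI0.
rewrite /charge_var charge_posfE // charge_negfE // fineN lerD ?ler_norm //.
by rewrite -normrN ler_norm.
Qed.

(** Prepended to partitions of [C], the two Hahn pieces of the difference set for the real part show
    that its variation there is at most the gap between the suprema. The imaginary part obeys the
    same bound, whence the factor 2. In this way the suprema and infima in [radon] control an honest
    measure. *)
Lemma var_le_variation lam E C : measurable E -> measurable C -> C `<=` E ->
  cm_var lam (E `\` C) <= 2 * (fine (V lam E) - fine (V lam C)).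
Proof.
move=> mE mC CE; have mD := measurableD mE mC.
have key (D1 D2 : set (borel X)) : measurable D1 -> measurable D2 -> D1 `<=` E `\` C -> D2 `<=` E `\` C ->
    D1 `&` D2 = set0 -> cm_abs lam D1 + cm_abs lam D2 <= fine (V lam E) - fine (V lam C).
  move=> m1 m2 s1 s2 d12; rewrite lerBrDr -lee_fin EFinD.
  rewrite !fineK ?variation_fin //; exact: variation_split.
have -> x : 2 * x = x + x :> R by rewrite mulr2n mulrDl mul1r.
have rele A : `|fine (cm_re lam A)| <= cm_abs lam A.
  by rewrite -lecR -cm_absE; exact: (normc_ge_Re (cm_val lam A)).
have imle A : `|fine (cm_im lam A)| <= cm_abs lam A.
  by rewrite -lecR -cm_absE; exact: (normc_ge_Im (cm_val lam A)).
rewrite /cm_var lerD //.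
  have [D1 [D2 [[m1 m2] s1 s2 d12 H]]] := charge_var_split (cm_re lam) mD.
  by apply: le_trans H _; apply: le_trans (key D1 D2 _ _ _ _ _) => //; rewrite lerD.
have [D1 [D2 [[m1 m2] s1 s2 d12 H]]] := charge_var_split (cm_im lam) mD.
by apply: le_trans H _; apply: le_trans (key D1 D2 _ _ _ _ _) => //; rewrite lerD.
Qed.

Hypothesis hX : hausdorff_space X.

Lemma measurable_borel_open (U : set X) : open U -> measurable (U : set (borel X)).
Proof. by move=> oU; apply: sub_gen_smallest. Qed.

Lemma radon_regular lam E (e : R) : radon lam -> measurable E -> 0 < e ->
  exists C U : set X, [/\ compact C, C `<=` E, open U, E `<=` U & cm_var lam (U `\` C) < e].
Proof.
move=> rl mE e0; have [inE outE] := rl E mE.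
(* There are two gaps, between [C] and [E] and between [E] and [U], and [var_le_variation] doubles
   each; the total stays below [e / 2]. *)
have e4 : 0 < e / 8 by rewrite divr_gt0.
have fE := variation_fin lam mE.
have [|_ [C [cC CE] <-] HC] := @ub_ereal_sup_adherent R
  [set V lam C | C in [set C : set X | compact C /\ C `<=` E]] (e / 8) e4.
  by rewrite -inE.
have [|_ [U [oU EU] <-] HU] := @lb_ereal_inf_adherent R
  [set V lam U | U in [set U : set X | open U /\ E `<=` U]] (e / 8) e4.
  by rewrite -outE.
exists C, U; split=> //.
have mC : measurable (C : set (borel X)) by exact: measurable_borel_compact.
have mU : measurable (U : set (borel X)) by exact: measurable_borel_open.
move: HC HU; rewrite -inE -outE -(fineK fE) -(fineK (variation_fin lam mC)) -(fineK (variation_fin lam mU)).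
rewrite -EFinB -EFinD !lte_fin => HC HU.
have l1 := var_le_variation lam mE mC CE; have l2 := var_le_variation lam mU mE EU.
have sub : U `\` C `<=` (U `\` E) `|` (E `\` C).
  move=> x [Ux nC]; have [Ex|nE] := pselect (E x); first by right.
  by left.
have mUE := measurableD mU mE; have mEC := measurableD mE mC.
have mUC := measurableD mU mC.
have l3 := le_cm_var lam mUC (measurableU _ _ mUE mEC) sub.
have l4 := cm_varU lam mUE mEC.
lra.
Qed.

(** Cutting a partition of [A] along a subset [D] bounds the variation of [A] by that of [D] plus
    [M] times the measure of the rest, so the regularity of [m] passes to the variation of [lam]. It
    serves for densities and for point masses. *)
Lemma radon_dominated lam (m : {measure set (borel X) -> \bar R}) (M : R) : 0 <= M ->
  (forall A, measurable A -> ((cm_abs lam A)%:E <= M%:E * m A)%E) ->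
  (forall E (e : R), measurable E -> 0 < e ->
    exists C U : set X, [/\ compact C, C `<=` E, open U, E `<=` U & (m (U `\` C) <= e%:E)%E]) ->
  radon lam.
Proof.
move=> M0 dom reg E mE; have fE := variation_fin lam mE.
have sub A D : measurable A -> measurable D -> D `<=` A ->
    (V lam A <= V lam D + M%:E * m (A `\` D))%E.
  move=> mA mD DA; apply: variation_le => F [mF tF FA].
  have mFD n : measurable (F n `&` D) by exact: measurableI.
  have mFnD n : measurable (F n `\` D) by exact: measurableD.
  apply: (@le_trans _ _ (\sum_(0 <= n <oo) ((cm_abs lam (F n `&` D))%:E + M%:E * m (F n `\` D)))%E).
    apply: lee_nneseries => n; first by rewrite lee_fin cm_abs_ge0.
    move=> _; apply: (@le_trans _ _ ((cm_abs lam (F n `&` D))%:E + (cm_abs lam (F n `\` D))%:E)%E).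
      rewrite -EFinD lee_fin -lecR rmorphD /= -!cm_absE.
      rewrite -[in X in X <= _](setUIDK (F n) D) cm_valU ?ler_normD //.
      by rewrite setDE setICA -setIA setICr !setI0.
    by rewrite leeD2l // dom.
  rewrite nneseriesD; [|by move=> n _ _; rewrite lee_fin cm_abs_ge0|by move=> n _ _; rewrite mule_ge0].
  apply: leeD.
    apply: le_variation; split=> //.
      exact: trivIset_setIr.
    by rewrite -setI_bigcupl FA setIidr.
  rewrite nneseriesZl; last by move=> n _.
  have -> : (m (A `\` D) = \sum_(0 <= n <oo) m (F n `\` D))%E; last by [].
  have <- : \bigcup_n (F n `\` D) = A `\` D.
    by rewrite -FA; apply/seteqP; split=> [x [n _ [Fx nD]]|x [[n _ Fx] nD]]; [split=> //; exists n|exists n].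
  rewrite measure_bigcup //; first by apply: eq_eseriesl => n; rewrite in_setT.
  apply/trivIsetP => i j _ _ ij; move/trivIsetP : tF => /(_ i j Logic.I Logic.I ij) FF.
  by apply/seteqP; split=> // x [[Fi _] [Fj _]]; rewrite -FF.
have key (e : R) : 0 < e -> exists C U : set X, [/\ compact C /\ C `<=` E, open U, E `<=` U,
    (V lam E <= V lam C + e%:E)%E & (V lam U <= V lam E + e%:E)%E].
  move=> e0; have M1 : 0 < M + 1 by rewrite ltr_wpDl.
  have [C [U [cC CE oU EU HUC]]] := reg E (e / (M + 1)) mE (ltac:(by rewrite divr_gt0)).
  have mC : measurable (C : set (borel X)) by exact: measurable_borel_compact.
  have mU : measurable (U : set (borel X)) by exact: measurable_borel_open.
  have small A : measurable A -> A `<=` U `\` C -> (M%:E * m A <= e%:E)%E.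
    move=> mA AUC; apply: (@le_trans _ _ (M%:E * (e / (M + 1))%:E)%E).
      rewrite lee_wpmul2l ?lee_fin // (le_trans _ HUC) // le_measure ?inE //.
      exact: measurableD.
    by rewrite -EFinM lee_fin mulrCA ger_pMr // ler_pdivrMr // mul1r lerDl.
  exists C, U; split=> //.
    apply: le_trans (sub E C mE mC CE) _; rewrite leeD2l // small //; first exact: measurableD.
    by move=> x [/EU].
  apply: le_trans (sub U E mU mE EU) _; rewrite leeD2l // small //; first exact: measurableD.
  by move=> x [Ux nE]; split=> // /CE.
split; apply/eqP; rewrite eq_le; apply/andP; split.
- apply/lee_addgt0Pr => e e0; have [C [U [[cC CE] oU EU H1 H2]]] := key e e0.
  by apply: le_trans H1 _; rewrite leeD2r //; apply: ereal_sup_ubound; exists C.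
- apply: ge_ereal_sup => _ [C [cC CE] <-]; apply: le_variation_sub => //.
  exact: measurable_borel_compact.
- apply: le_ereal_inf_tmp => _ [U [oU EU] <-]; apply: le_variation_sub => //.
  exact: measurable_borel_open.
- apply/lee_addgt0Pr => e e0; have [C [U [[cC CE] oU EU H1 H2]]] := key e e0.
  by apply: le_trans H2; apply: ereal_inf_lbound; exists U.
Qed.

Definition cm_null lam (U : set (borel X)) :=
  forall A, measurable A -> A `<=` U -> cm_val lam A = 0.

Lemma cm_null_var lam U : measurable U -> cm_null lam U -> cm_var lam U = 0.
Proof.
move=> mU nU.
have [D1 [D2 [[m1 m2] s1 s2 _ H1]]] := charge_var_split (cm_re lam) mU.
have [D3 [D4 [[m3 m4] s3 s4 _ H2]]] := charge_var_split (cm_im lam) mU.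
have [E1 _] := nU D1 m1 s1; have [E2 _] := nU D2 m2 s2.
have [_ E3] := nU D3 m3 s3; have [_ E4] := nU D4 m4 s4.
apply/eqP; rewrite eq_le cm_var_ge0 andbT /cm_var.
by rewrite E1 E2 E3 E4 normr0 addr0 in H1 H2; rewrite -[leRHS]addr0 lerD.
Qed.

(** Regularity stands in for a countability assumption on [X]: up to small variation [E] is compact,
    and finitely many of the null open sets cover a compact set. *)
Lemma locally_null lam E : radon lam -> measurable E ->
  (forall x, E x -> exists U : set X, [/\ open U, U x & cm_null lam U]) ->
  cm_var lam E = 0.
Proof.
move=> rl mE H; apply/eqP; rewrite eq_le cm_var_ge0 andbT.
apply/ler_addgt0Pr => e e0; rewrite add0r.
have [C [U [cC CE oU EU HUC]]] := radon_regular rl mE e0.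
have mC : measurable (C : set (borel X)) by exact: measurable_borel_compact.
have mU : measurable (U : set (borel X)) by exact: measurable_borel_open.
suff C0 : cm_var lam C = 0.
  have mEC := measurableD mE mC.
  apply: (@le_trans _ _ (cm_var lam (C `|` (E `\` C)))).
    by apply: le_cm_var => //; [exact: measurableU|rewrite setDUK].
  apply: le_trans (cm_varU lam mC mEC) _; rewrite C0 add0r ltW //.
  apply: le_lt_trans HUC; apply: le_cm_var => //; first exact: measurableD.
  by move=> x [/EU].
have cC' : cover_compact C by rewrite -compact_cover.
pose W (x : X) := if pselect (E x) is left Ex then sval (cid (H x Ex)) else set0.
have WP x : E x -> [/\ open (W x), W x x & cm_null lam (W x)].
  by rewrite /W => Ex; case: pselect => // Ex'; case: cid.
have [D sD CD] : finite_subset_cover C W C.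
  apply: cC' => [x /CE/WP[] //|x Cx].
  by exists x => //; have [] := WP x (CE _ Cx).
apply/eqP; rewrite eq_le cm_var_ge0 andbT.
have sum0 (r : seq X) : (forall x, x \in r -> C x) ->
    measurable ((\big[setU/set0]_(x <- r) W x) : set (borel X)) /\
    cm_var lam (\big[setU/set0]_(x <- r) W x) <= 0.
  elim: r => [_|x r IH Hr]; rewrite ?big_nil ?big_cons.
    split=> //; rewrite cm_null_var // => A mA A0.
    by rewrite (_ : A = set0) ?cm_val0 //; apply/seteqP; split.
  have [|mr r0] := IH; first by move=> y yr; apply: Hr; rewrite inE yr orbT.
  have [oW _ nW] := WP x (CE _ (Hr x (mem_head _ _))).
  have mW := measurable_borel_open oW; split; first exact: measurableU.
  by apply: le_trans (cm_varU lam mW mr) _; rewrite (cm_null_var mW nW) add0r.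
have [x xD|mD D0] := sum0 (finmap.enum_fset D); first by have := sD x xD; rewrite inE.
apply: le_trans D0; apply: le_cm_var => //.
by move=> x /CD [y yD Wy]; rewrite -bigcup_seq; exists y.
Qed.

Lemma cm_var0_val lam E A : measurable E -> measurable A -> A `<=` E ->
  cm_var lam E = 0 -> cm_val lam A = 0.
Proof.
move=> mE mA AE E0; apply/eqP; rewrite -normr_le0.
apply: le_trans (cm_val_var lam mA) _; rewrite -[X in _ <= X]/(0%:C) lecR -E0.
exact: le_cm_var.
Qed.

(** A point off the support has an open neighbourhood of variation 0, and [locally_null] combines
    these. For a measure without regularity the complement of the support can carry mass. *)
Lemma carried_support lam : radon lam -> measurable (cm_support lam : set (borel X)) ->
  carried lam (cm_support lam).
Proof.
move=> rl mS; split=> // A mA AS; apply: (cm_var0_val (E := ~` cm_support lam)) => //.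
  exact: measurableC.
apply: locally_null => //; first exact: measurableC.
move=> x /existsNP[U] /not_implyP[oU] /not_implyP[Ux] /negP; rewrite -leNgt => V0.
exists U; split=> // B mB BU; apply/eqP; rewrite -normr_le0 cm_absE -[X in _ <= X]/(0%:C) lecR.
rewrite -lee_fin; apply: le_trans V0; apply: cm_abs_le_variation => //.
exact: measurable_borel_open.
Qed.

End Variation.

(** * The universal and integrally strictly positive definite cases *)

Section UniversalStep.
Variables (R : realType) (X : ptopologicalType) (p : X -> X -> R[i]).
Implicit Types (lam : complex_measure R X) (A S : set (borel X)) (F G h : X -> R[i]).
Local Open Scope complex_scope.
Hypothesis hX : hausdorff_space X.
Hypotheses (cp : kernel_continuous p) (pp : psd p) (up : universal p).

Lemma clip_lipschitz (a b : R) : `|Num.min 1 a - Num.min 1 b| <= `|a - b|.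
Proof.
have h1 := ler_norm (a - b); have h2 := ler_norm (- (a - b)); rewrite normrN in h2.
by rewrite ler_norml /Num.min; case: ifP; case: ifP; move=> /= H1 H2; apply/andP; split; lra.
Qed.

(* [h] truncates an element of the Hilbert space of [p] close to [\1_D1], which
   is continuous on [D1 `|` D2]. *)
Lemma separating_function (D1 D2 : set X) (e : R) : compact D1 -> compact D2 ->
  D1 `&` D2 = set0 -> 0 < e -> exists h : X -> R,
  [/\ ccontinuous (fun x => (h x)%:C), forall x, 0 <= h x <= 1,
      forall x, D1 x -> 1 - e <= h x & forall x, D2 x -> h x <= e].
Proof.
move=> c1 c2 d12 e0; have cl1 := compact_closed hX c1; have cl2 := compact_closed hX c2.
have [_ rc dens] := up.
have cf : ccontinuous_on (D1 `|` D2) (fun x => (\1_D1 x)%:C : R[i]).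
  apply: withinU_continuous => //.
    apply: (@subspace_eq_continuous _ D1 _ (fun=> 1 : R[i]^o)) => [x xD|].
      by rewrite /from_subspace /= indicE xD.
    by move=> x; exact: cst_continuous.
  apply: (@subspace_eq_continuous _ D2 _ (fun=> 0 : R[i]^o)) => [x xD|].
    rewrite /from_subspace /= indicE memNset // => x1; suff : set0 x by [].
    by rewrite -d12; split=> //; exact: set_mem.
  by move=> x; exact: cst_continuous.
have [F rF HF] := dens _ (compactU c1 c2) _ cf e e0.
have cF := rc _ rF.
(* Off the two compact sets nothing is known of the size of [F]; clipping its modulus at 1 confines
   the values everywhere and keeps continuity. *)
exists (fun x => Num.min 1 (Normc.normc (F x))); split.
- move=> x; apply/cvgrPdist_lt => d d0; have := cF x => /cvgrPdist_lt/(_ _ d0).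
  apply: filterS => y; apply: le_lt_trans.
  rewrite -rmorphB normc_real; apply: (@le_trans _ _ (`| `|F x| - `|F y| |)).
    rewrite -[`|F x|]/((Normc.normc (F x))%:C) -[`|F y|]/((Normc.normc (F y))%:C).
    by rewrite -rmorphB normc_real lecR clip_lipschitz.
  exact: ler_dist_dist.
- move=> x; rewrite le_min ge_min lexx ler01 /= andbT.
  by rewrite -ler0c; exact: (normr_ge0 (F x)).
- move=> x x1; have := HF x (or_introl x1); rewrite indicE mem_set // => lt1.
  rewrite le_min gerBl (ltW e0) /= -lecR.
  have : (1 : R[i]) <= `|F x| + e%:C.
    apply: (@le_trans _ _ (`|F x| + `|1 - F x|)).
      rewrite -{1}(normr1 R[i]) -[X in `|X|](subrKC (F x)) ler_normD //.
    by rewrite lerD2l distrC ltW.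
  by rewrite -lerBlDr rmorphB rmorph1.
- move=> x x2; have := HF x (or_intror x2); rewrite indicE memNset; last first.
    by move=> x1; suff : set0 x by []; rewrite -d12.
  rewrite subr0 => lt1; rewrite ge_min -[X in _ || X]lecR.
  by apply/orP; right; exact: ltW.
Qed.

(* [\1_A] is approximated in variation by continuous functions, and these
   uniformly on [S] by elements of the Hilbert space of [p]. *)
Lemma universal_step lam (S : set X) (G : X -> R[i]) : radon lam -> compact S ->
  carried lam S -> cbounded_on S G ->
  (forall F, rkhs p F -> cm_integral lam setT (fun x => F x * G x) = 0) ->
  forall A, measurable A -> cm_integral lam A G = 0.
Proof.
move=> rl cS lamS gG H A mA; have [_ rc dens] := up.
have mS := lamS.1.
have [k k0 pS] := compact_diag_bound cp pp cS.
have [M M0 HM] := cbounded_on_norm_le gG.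
have v0 := cm_var_ge0 lam setT.
have small f (e : R) : 0 <= e -> cbounded_on S f -> (forall x, S x -> `|f x| <= e%:C) ->
    `|cm_integral lam setT (fun x => f x * G x)| <= (2 * (e * M) * cm_var lam setT)%:C.
  move=> e0 gf Hf; apply: (cm_int_bound lamS) => //; first exact: cbounded_onM.
    exact: mulr_ge0.
  by move=> x Sx; rewrite indicT mulr1 normrM rmorphM ler_pM ?Hf ?HM.
have B1 : 0 < 2 * M * cm_var lam setT + 1 by rewrite ltr_wpDl // !mulr_ge0.
have cont0 f : ccontinuous f -> cbounded_on S f -> cm_integral lam setT (fun x => f x * G x) = 0.
  move=> cf gf; apply/eqP; rewrite -normr_le0; apply/ler_addgt0Pr => _ /gt0_real_complex[e e0 ->].
  have d0 : 0 < e / (2 * M * cm_var lam setT + 1) by rewrite divr_gt0.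
  have [|F rF HF] := dens S cS f _ _ d0; first exact: continuous_subspaceT.
  have gF := rkhs_cbounded_on cp pp k0 pS rF.
  have -> : cm_integral lam setT (fun x => f x * G x) =
      cm_integral lam setT (fun x => (f x - F x) * G x).
    have -> : (fun x => (f x - F x) * G x) = (fun x => f x * G x + -1 * (F x * G x)).
      by apply/funext => x; ring.
    rewrite (cm_intD lamS) ?(cm_intZ lamS) ?(H F rF) ?mulr0 ?addr0 //; try exact: cbounded_onM.
    by apply: cbounded_onM; [exact: cbounded_on_cst|exact: cbounded_onM].
  apply: le_trans (small _ _ (ltW d0) _ _) _.
  - exact: cbounded_onB.
  - by move=> x Sx; rewrite distrC ltW // HF.
  rewrite add0r lecR.
  have -> : 2 * (e / (2 * M * cm_var lam setT + 1) * M) * cm_var lam setT =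
    e * ((2 * M * cm_var lam setT) / (2 * M * cm_var lam setT + 1)) by ring.
  by rewrite ger_pMr // ler_pdivrMr // mul1r lerDl.
have mAS : measurable (A `&` S : set (borel X)) by exact: measurableI.
rewrite cm_int_mkcond; apply/eqP; rewrite -normr_le0.
apply/ler_addgt0Pr => _ /gt0_real_complex[e e0 ->]; rewrite add0r.
(* The error [\1_A - h] contributes at most [2 * d * M] times the variation of [lam] outside the
   difference of [U] and [C], and at most [2 * M * d] on it; the final 1 keeps the denominator
   positive. *)
pose d := e / (2 * M * cm_var lam setT + 2 * M + 1).
have B2 : 0 < 2 * M * cm_var lam setT + 2 * M + 1 by rewrite ltr_wpDl // addr_ge0 ?mulr_ge0.
have d0 : 0 < d by rewrite divr_gt0.
have [C [U [cC CA oU AU HUC]]] := radon_regular hX rl mAS d0.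
have mC : measurable (C : set (borel X)) by exact: measurable_borel_compact.
have mU : measurable (U : set (borel X)) by exact: measurable_borel_open.
have cD : compact (S `\` U).
  apply: (@subclosed_compact _ _ S) => //.
  by rewrite setDE; apply: closedI; [exact: compact_closed|exact: open_closedC].
have CD : C `&` (S `\` U) = set0.
  by apply/seteqP; split=> // x [/CA/AU Ux [_ nU]].
have [h [ch h01 hC hD]] := separating_function cC cD CD d0.
have gh : cbounded_on S (fun x => (h x)%:C).
  apply: (continuous_cbounded_on (M := 1)) => // x Sx.
  by have /andP[h0 h1] := h01 x; rewrite normc_real lecR ger0_norm.
have I0 := cont0 _ ch gh.
pose u x : R := \1_A x - h x.
have gA : cbounded_on S (fun x => (\1_A x)%:C : R[i]) by exact: cbounded_on_indic.
have gu : cbounded_on S (fun x => (u x)%:C).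
  have := cbounded_onB gA gh; congr cbounded_on; apply/funext => x; by rewrite /u rmorphB.
have mUC := measurableD mU mC.
have gUC : cbounded_on S (fun x => (\1_(U `\` C) x)%:C : R[i]) by exact: cbounded_on_indic.
have -> : cm_integral lam setT (fun x => (\1_A x)%:C * G x) =
   cm_integral lam setT (fun x => (u x)%:C * G x).
  have -> : (fun x => (u x)%:C * G x) = (fun x => (\1_A x)%:C * G x + -1 * ((h x)%:C * G x)).
    by apply/funext => x; rewrite /u rmorphB; ring.
  rewrite (cm_intD lamS) ?(cm_intZ lamS) ?I0 ?mulr0 ?addr0 //; try exact: cbounded_onM.
  by apply: cbounded_onM; [exact: cbounded_on_cst|exact: cbounded_onM].
(* [w] is the error [u] cut off on the difference of [U] and [C]. Any other point of [S] lies in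
   [C], where [h] is near 1, or outside [U], where [h] is near 0 and [\1_A] vanishes. *)
pose w x : R := u x * (1 - \1_(U `\` C) x).
have wE x : (w x)%:C = (u x)%:C * (1 - (\1_(U `\` C) x)%:C).
  by rewrite /w rmorphM; congr (_ * _); rewrite rmorphB.
have gw : cbounded_on S (fun x => (w x)%:C).
  have := cbounded_onM gu (cbounded_onB (cbounded_on_cst S 1) gUC); congr cbounded_on.
  by apply/funext => x; rewrite wE.
have g3 : cbounded_on S (fun x => (\1_(U `\` C) x)%:C * ((u x)%:C * G x)).
  by apply: cbounded_onM => //; exact: cbounded_onM.
have -> : cm_integral lam setT (fun x => (u x)%:C * G x) =
   cm_integral lam setT (fun x => (w x)%:C * G x) +
   cm_integral lam setT (fun x => (\1_(U `\` C) x)%:C * ((u x)%:C * G x)).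
  rewrite -(cm_intD lamS) //; last exact: cbounded_onM.
  by congr cm_integral; apply/funext => x; rewrite wE; ring.
have u1 x : `|u x| <= 1.
  have /andP[h0 h1] := h01 x; rewrite ler_norml /u indicE.
  by case: (x \in A) => /=; apply/andP; split; lra.
have w1 x : S x -> `|w x| <= d.
  move=> Sx; rewrite /w indicE; have /andP[h0 h1] := h01 x.
  have [UC|nUC] := boolP (x \in U `\` C); first by rewrite subrr mulr0 normr0 ltW.
  rewrite subr0 mulr1 /u indicE; have [Cx|nC] := pselect (C x).
    have Ax : A x := (CA x Cx).1; rewrite mem_set //=.
    by have h2 := hC x Cx; rewrite ger0_norm; lra.
  have nU : ~ U x by move=> Ux; move/negP: nUC; apply; rewrite inE.
  rewrite memNset /=; last by move=> Ax; apply: nU; apply: AU.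
  by rewrite sub0r normrN ger0_norm // hD.
apply: le_trans (ler_normD _ _) _.
have l1 : `|cm_integral lam setT (fun x => (w x)%:C * G x)| <= (2 * (d * M) * cm_var lam setT)%:C.
  by apply: small => //; [exact: ltW|move=> x Sx; rewrite normc_real lecR w1].
have l2 : `|cm_integral lam setT (fun x => (\1_(U `\` C) x)%:C * ((u x)%:C * G x))|
     <= (2 * M * cm_var lam (U `\` C))%:C.
  apply: (cm_int_bound lamS) => // x Sx; rewrite !normrM !normc_real rmorphM mulrC.
  have gx := HM x Sx.
  have ux0 : (0 : R[i]) <= `|u x|%:C by rewrite ler0c.
  have ux1 : `|u x|%:C <= (1 : R[i]) by rewrite -[X in _ <= X]/(1%:C) lecR.
  apply: ler_pM.
  - by apply: mulr_ge0 => //; exact: normr_ge0.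
  - by rewrite ler0c.
  - by apply: le_trans gx; rewrite ler_piMl //; exact: normr_ge0.
  - by rewrite lecR ger0_norm // indicE; case: (_ \in _).
apply: le_trans (lerD l1 l2) _; rewrite -rmorphD lecR.
apply: (@le_trans _ _ (2 * (d * M) * cm_var lam setT + 2 * M * d)).
  by rewrite lerD2l ler_wpM2l ?mulr_ge0 // ltW.
have -> : 2 * (d * M) * cm_var lam setT + 2 * M * d =
  e * ((2 * M * cm_var lam setT + 2 * M) / (2 * M * cm_var lam setT + 2 * M + 1)).
  by rewrite /d; ring.
by rewrite ger_pMr // ler_pdivrMr // mul1r lerDl.
Qed.

End UniversalStep.

(** * Measures with a bounded density, and the integrally strict case *)

Section Density.
Variables (R : realType) (X : ptopologicalType).
Implicit Types (lam : complex_measure R X) (A S : set (borel X)) (F G : X -> R[i]).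
Local Open Scope complex_scope.

Lemma charge_density (nu : {charge set (borel X) -> \bar R}) S (f : borel X -> R) :
  charge_carried nu S -> bounded_on S f ->
  exists mu : {charge set (borel X) -> \bar R},
    forall A, measurable A -> mu A = (charge_integral nu A f)%:E.
Proof.
move=> nuS bf; have mS := nuS.1.
have ip := bounded_on_integrable mS (charge_carried_pos nuS) bf.
have iq := bounded_on_integrable mS (charge_carried_neg nuS) bf.
exists (cadd (induced_charge ip) (copp (induced_charge iq))) => A mA.
have jp : (charge_posf nu).-integrable A (EFin \o f) by apply: integrableS ip.
have jq : (charge_negf nu).-integrable A (EFin \o f) by apply: integrableS iq.
rewrite /charge_integral EFinB.
have E1 : (\int[charge_pos nu]_(x in A) f x)%:E = (\int[charge_posf nu]_(x in A) (f x)%:E)%E.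
  exact: fineK (integrable_fin_num mA jp).
have E2 : (\int[charge_neg nu]_(x in A) f x)%:E = (\int[charge_negf nu]_(x in A) (f x)%:E)%E.
  exact: fineK (integrable_fin_num mA jq).
by rewrite E1 E2.
Qed.

Lemma complex_density lam S G : carried lam S -> cbounded_on S G ->
  exists mu : complex_measure R X,
    forall A, measurable A -> cm_val mu A = cm_integral lam A G.
Proof.
move=> lamS [g1 g2]; have cr := carried_re lamS; have ci := carried_im lamS.
have [m1 H1] := charge_density cr g1; have [m2 H2] := charge_density cr g2.
have [m3 H3] := charge_density ci g1; have [m4 H4] := charge_density ci g2.
exists (ComplexMeasure (cadd m1 (copp m4)) (cadd m2 m3)) => A mA.
rewrite /cm_val /cm_integral /=; congr (_ +i* _).
  have -> : fine (cadd m1 (copp m4) A) = fine (m1 A + - m4 A)%E by [].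
  by rewrite H1 // H4.
have -> : fine (cadd m2 m3 A) = fine (m2 A + m3 A)%E by [].
by rewrite H2 // H3.
Qed.

(** For indicators [F] the identity is the hypothesis on [mu]; [complex_functional_eq0], applied to
    the difference of the two sides, extends it. *)
Lemma density_integral lam mu S F G : carried lam S -> cbounded_on S F -> cbounded_on S G ->
  (forall A, measurable A -> cm_val mu A = cm_integral lam A G) ->
  cm_integral mu setT F = cm_integral lam setT (fun x => F x * G x).
Proof.
move=> lamS gF gG E; have [M M0 HM] := cbounded_on_norm_le gG; have mS := lamS.1.
have muS : carried mu S.
  split=> // A mA AS; rewrite E // cm_int_mkcond.
  apply/eqP; rewrite -normr_le0.
  apply: le_trans (cm_int_bound lamS (A := setT) (M := 0) _ _ _ _) _ => //.
  - by apply: cbounded_onM => //; exact: cbounded_on_indic.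
  - move=> x Sx; rewrite mul0r indicE memNset ?mul0r ?normr0 //.
    by move=> /AS; apply.
  - by rewrite mulr0 mul0r.
apply/eqP; rewrite -subr_eq0; apply/eqP.
have H := @complex_functional_eq0 R X (fun F => cm_integral mu setT F -
    cm_integral lam setT (fun x => F x * G x)) S
  (2 * cm_var mu setT + 2 * M * cm_var lam setT) mS.
have {}H := fun a b c d e => H a b c d e F gF.
apply: H => [|f g gf gg|a f gf|f N gf N0 Hf|A mA].
- by rewrite addr_ge0 // !mulr_ge0 // cm_var_ge0.
- rewrite (cm_intD muS) //.
  have -> : (fun x => (f x + g x) * G x) = (fun x => f x * G x + g x * G x).
    by apply/funext => x; rewrite mulrDl.
  by rewrite (cm_intD lamS); [ring|exact: cbounded_onM|exact: cbounded_onM].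
- rewrite (cm_intZ muS) //.
  have -> : (fun x => a * f x * G x) = (fun x => a * (f x * G x)).
    by apply/funext => x; rewrite mulrA.
  by rewrite (cm_intZ lamS); [ring|exact: cbounded_onM].
- apply: le_trans (ler_normB _ _) _; rewrite mulrDl rmorphD lerD //.
    have -> : 2 * cm_var mu setT * N = 2 * N * cm_var mu setT by ring.
    by apply: (cm_int_bound muS) => // x Sx; rewrite indicT mulr1 Hf.
  have -> : 2 * M * cm_var lam setT * N = 2 * (N * M) * cm_var lam setT by ring.
  apply: (cm_int_bound lamS) => //; [exact: cbounded_onM|exact: mulr_ge0|].
  by move=> x Sx; rewrite indicT mulr1 normrM rmorphM ler_pM ?Hf ?HM.
- by rewrite cm_int_indic // E // -cm_int_mkcond subrr.
Qed.

Hypothesis hX : hausdorff_space X.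

Lemma density_radon lam mu G : radon lam -> cbounded_on setT G ->
  (forall A, measurable A -> cm_val mu A = cm_integral lam A G) -> radon mu.
Proof.
move=> rl gG E; have [M M0 HM] := cbounded_on_norm_le gG.
have lamT := carriedT lam.
apply: (radon_dominated hX (m := variation_measure lam) (M := 2 * M)) => [|A mA|D e mD e0].
- exact: mulr_ge0.
- rewrite variation_measureE // -EFinM lee_fin -lecR -cm_absE E // cm_int_mkcond.
  apply: (cm_int_bound lamT) => //.
    by apply: cbounded_onM => //; exact: cbounded_on_indic.
  move=> x _; rewrite normrM mulrC rmorphM ler_pM ?HM //.
  by rewrite normc_real lecR ger0_norm // indicE; case: (_ \in _).
- have [C [U [cC CD oU DU HUC]]] := radon_regular hX rl mD e0.
  exists C, U; split=> //.
  have mC : measurable (C : set (borel X)) by exact: measurable_borel_compact.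
  have mU : measurable (U : set (borel X)) by exact: measurable_borel_open.
  by rewrite variation_measureE ?lee_fin ?ltW //; exact: measurableD.
Qed.

(** The measure [mu] with density [G] with respect to [lam] is Radon. Tested on the sections of [p],
    the hypothesis makes every inner integral of [p] against [mu] vanish, so integral strictness
    forces [mu = 0]. *)
Lemma ispd_step (p : X -> X -> R[i]) lam G : kernel_continuous p -> psd p -> ispd p ->
  radon lam -> cbounded_on setT G ->
  (forall F, rkhs p F -> cm_integral lam setT (fun x => F x * G x) = 0) ->
  forall A, measurable A -> cm_integral lam A G = 0.
Proof.
move=> cp pp [[M HM] _ _ ip] rl gG H A mA.
have lamT := carriedT lam.
have [mu E] := complex_density lamT gG.
rewrite -E //; apply: ip mA; first exact: density_radon rl gG E.
apply: double_integral_sections0 => y.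
have gp : cbounded_on setT (fun x => p x y).
  apply: (continuous_cbounded_on (M := M)); first exact: kernel_section_continuous.
  by move=> x _; exact: HM.
by rewrite (density_integral lamT gp gG E) H //; exact: rkhs_kernel_section.
Qed.

End Density.

(** * Strict positivity of products *)

Section ContinuousOperations.
Variables (R : realType) (Y : topologicalType).
Implicit Types f g : Y -> R[i].

Lemma ccontinuousM f g :
  ccontinuous f -> ccontinuous g -> ccontinuous (fun x => f x * g x).
Proof. by move=> cf cg x; apply: (@cvgM R[i]); [exact: cf|exact: cg]. Qed.

Lemma ccontinuousD f g :
  ccontinuous f -> ccontinuous g -> ccontinuous (fun x => f x + g x).
Proof. by move=> cf cg x; exact: (cvgD (cf x) (cg x)). Qed.

End ContinuousOperations.

Section StrictKernels.
Variables (R : realType) (X : ptopologicalType).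
Implicit Types (K p q : X -> X -> R[i]) (F G : X -> R[i]).
Let C : numClosedFieldType := R[i].
Local Open Scope complex_scope.
Hypothesis hX : hausdorff_space X.

Lemma psd_diag_gt0 K x : psd K -> K x x <> 0 -> 0 < K x x.
Proof. by move=> pK /eqP n0; rewrite lt0r n0 psd_diag. Qed.

Lemma psd_diag0 K x y : psd K -> K x x = 0 -> K y x = 0.
Proof.
move=> pK K0; have := dominated_le y pK (dominated_section x pK).
by rewrite K0 mul0r -normrX normr_le0 expf_eq0 /= => /eqP.
Qed.

Lemma spd_diag K x : spd K -> K x x <> 0.
Proof.
move=> [_ sK] K0.
have inj : injective (fun _ : 'I_1 => x) by move=> i j _; rewrite (ord1 i) (ord1 j).
have S0 : kernel_sum K (fun _ : 'I_1 => 1) (fun=> x) = 0.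
  by rewrite /kernel_sum !big_ord1 rmorph1 !mul1r K0.
by have /eqP := sK 1%N _ _ inj S0 ord0; rewrite oner_eq0.
Qed.

(** If [K x x = 0], all members of the Hilbert space vanish at [x] and cannot approximate the
    constant 1 on the compact set [{x}]. *)
Lemma universal_diag K x : psd K -> universal K -> K x x <> 0.
Proof.
move=> pK [_ _ dens] K0.
have c1 : ccontinuous_on [set x] (fun=> 1 : R[i]).
  by apply: continuous_subspaceT => y; exact: cst_continuous.
have [F rF HF] := dens _ (@compact_set1 _ x) _ c1 1 ltr01.
have [c c0 dF] := (rkhsP F pK).1 rF.
have := dominated_le x pK dF; rewrite K0 mulr0 -normrX normr_le0 expf_eq0 /= => /eqP Fx.
by have := HF x erefl; rewrite Fx sub0r normrN normr1 ltxx.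
Qed.

(** If [K x x = 0], the section at [x] vanishes identically, so the unit mass at [x] is a nonzero
    Radon measure with vanishing double integral. *)
Lemma ispd_diag K x : kernel_continuous K -> psd K -> ispd K -> K x x <> 0.
Proof.
move=> cK pK [_ _ _ iK] K0.
pose lam : complex_measure R X :=
  ComplexMeasure (charge_of_finite_measure (dirac (x : borel X))) czero.
have valE (A : set (borel X)) : cm_val lam A = (\1_A x)%:C by [].
have mx := measurable_borel_set1 hX x.
have lamx : carried lam [set` [:: x]].
  have E : [set` [:: x]] = [set x] by apply/seteqP; split=> y /=; rewrite inE => /eqP.
  rewrite E; split=> // A mA Ax; rewrite valE indicE memNset //.
  by move=> /Ax; apply.
have rl : radon lam.
  apply: (radon_dominated hX (m := dirac (x : borel X)) (M := 1)) => // [A mA|E e mE e0].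
    rewrite mul1e /cm_abs valE normc_real /= lee_fin ger0_norm //.
  (* If [x] is in [E], the pair [{x}] and [X] differs by a set without mass. Otherwise the pair is
     the empty set and the complement of [{x}], open because [X] is Hausdorff. *)
  have [Ex|nE] := pselect (E x).
    exists [set x], setT; split=> //; [exact: compact_set1|by move=> y ->|exact: openT|].
    change ((\1_(setT `\` [set x]) x)%:E <= e%:E)%E.
    by rewrite indicE memNset ?lee_fin ?ltW // => -[_]; apply.
  exists set0, (~` [set x]); split=> //; first exact: compact0.
  - apply: closed_openC; apply: compact_closed => //; exact: compact_set1.
  - by move=> y Ey yx; apply: nE; rewrite -yx.
  - change ((\1_(~` [set x] `\` set0) x)%:E <= e%:E)%E.
    by rewrite indicE memNset ?lee_fin ?ltW // => -[nx _]; exact: nx.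
have D0 : double_integral K lam setT = 0.
  apply: double_integral_sections0 => y.
  rewrite (cm_int_finite hX (s := [:: x])) //.
    rewrite big_seq1 (psd_conj y x pK) psd_diag0 // conjC0 mulr0 //.
  apply: (continuous_cbounded_on (M := Normc.normc (K x y))); first exact: kernel_section_continuous.
  by move=> z /=; rewrite inE => /eqP ->.
have := iK lam rl D0 [set x] mx; rewrite valE indicE mem_set // => /eqP.
by rewrite -[_%:C]/(1 : R[i]) oner_eq0.
Qed.

Section Products.
Variables (p q : X -> X -> R[i]).
Hypotheses (cp : kernel_continuous p) (pp : psd p).
Hypotheses (cq : kernel_continuous q) (pq : psd q).
Let ppq : psd (kernel_mul p q) := kernel_mul_psd pp pq.
Let cpq : kernel_continuous (kernel_mul p q) := kernel_mul_continuous cp cq.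

Lemma kernel_mul_diag x : kernel_mul p q x x <> 0 -> 0 < q x x.
Proof.
move=> n0; apply: psd_diag_gt0 => // q0; apply: n0.
by rewrite /kernel_mul q0 mulr0.
Qed.

(** Products of a section of [p] and a section of [q] are dominated by the product kernel, so a
    combination with zero form annihilates them. For fixed [k] the coefficients
    [c i * q (x i) (x k)] therefore make the form of [p] vanish, and the one with [i = k] is a
    nonzero multiple of [c k]. *)
Lemma spd_mul : spd p -> (forall x, 0 < q x x) -> spd (kernel_mul p q).
Proof.
move=> [_ sp] q0; split=> [|n c x xi S0 k]; first exact: psd_positive_definite.
pose s := fam (fun i => (c i)^*%R) x.
have b0 i : c i * q (x i) (x k) = 0.
  apply: (sp n (fun i => c i * q (x i) (x k)) x xi) => {i}.
  rewrite /kernel_sum exchange_big big1 // => j _ /=.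
  have df := dominatedM pp pq (psd_diag (x j) pp) (psd_diag (x k) pq)
     (dominated_section (x j) pp) (dominated_section (x k) pq).
  have := (dominatedP _ _ _).1 df s.
  have -> : form (fun x y => p x y * q x y) s s = 0 by rewrite -kernel_sum_form.
  rewrite mulr0 -normrX normr_le0 expf_eq0 /= => /eqP.
  rewrite /pairing big_map => E.
  rewrite -[RHS](mulr0 (c j * q (x j) (x k))^*%R) -[in RHS]E mulr_sumr.
  by apply: eq_bigr => i _ /=; rewrite conjCK; ring.
have /eqP := b0 k; rewrite mulf_eq0 => /orP[/eqP //|/eqP qk].
by have := q0 (x k); rewrite qk ltxx.
Qed.

Lemma rkhs_sum K (r : seq X) (F : X -> X -> R[i]) : psd K ->
  (forall y, y \in r -> rkhs K (F y)) -> rkhs K (fun x => \sum_(y <- r) F y x).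
Proof.
move=> pK; have S0 := hilb_sip (C := C) (@complex_complete R) pK.
have toH G : rkhs K G -> @hilb C X K G.
  by move=> /(rkhsP G pK)[c c0 dG]; exact: dominated_hilb dG.
have ofH G : @hilb C X K G -> rkhs K G.
  move=> HG; exists (@hilb C X K), (@hip C X K); split; first exact: hilb_is_rkhs.
  exact: HG.
elim: r => [|y r IH] HF.
  by apply: ofH; have := sip_zero S0; congr hilb; apply/funext => x; rewrite big_nil.
have H1 := toH _ (HF y (mem_head _ _)).
have H2 : @hilb C X K (fun x => \sum_(z <- r) F z x).
  by apply: toH; apply: IH => z zr; apply: HF; rewrite inE zr orbT.
apply: ofH; have := sip_lin S0 1 H1 H2; congr hilb.
by apply/funext => x; rewrite big_cons mul1r.
Qed.

(** Since [q y y > 0], finitely many sections of [q] with base points in [D] have no common zero on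
    [D]. Weighting [f] by their conjugates over the sum [hh] of their squared moduli writes [f] on
    [D] as a sum of products [g y x * q x y]; approximating each [g y] in [H_p] gives members of the
    space of the product kernel. The functions [g y] are continuous on [D] only, as [hh] may vanish
    elsewhere. *)
Lemma universal_mul : universal p -> (forall x, 0 < q x x) -> universal (kernel_mul p q).
Proof.
move=> [_ _ dens] q0; split; first exact: psd_positive_definite.
  exact: rkhs_continuous.
move=> D cD f cf e e0.
have cqy y : ccontinuous (q^~ y) by exact: kernel_section_continuous.
pose W y := [set x | q x y != 0].
have oW y : open (W y).
  rewrite openE => x Wx; have n0 : 0 < `|q x y| by rewrite normr_gt0.
  have := cqy y x => /cvgrPdist_lt/(_ _ n0); apply: filterS => z.
  rewrite /W /= => lt1; apply/eqP => qz; by rewrite qz subr0 ltxx in lt1.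
have cD' : cover_compact D by rewrite -compact_cover.
have [E sE DE] : finite_subset_cover D W D.
  apply: cD' => [y _|y Dy]; first exact: oW.
  by exists y => //; rewrite /W /= gt_eqF.
pose r := finmap.enum_fset E.
pose hh x : R[i] := \sum_(y <- r) `|q x y| ^+ 2.
have hh0 x : D x -> hh x != 0.
  move=> /DE[y yE Wy]; rewrite gt_eqF // /hh (big_rem y) //=.
  apply: ltr_wpDr; first by apply: sumr_ge0 => z _; rewrite exprn_ge0.
  by rewrite exprn_gt0 // normr_gt0.
pose g y x : R[i] := f x * (q x y)^*%R / hh x.
have cconj y : ccontinuous (fun x => (q x y)^*%R).
  move=> x; apply/cvgrPdist_lt => d d0; have := cqy y x => /cvgrPdist_lt/(_ _ d0).
  by apply: filterS => z; rewrite -rmorphB norm_conjC.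
have chh : ccontinuous hh.
  rewrite /hh; elim: (r) => [|y t IH].
    have -> : (fun x => \sum_(y <- [::]) `|q x y| ^+ 2) = (fun=> 0 : R[i]).
      by apply/funext => x; rewrite big_nil.
    by move=> x; exact: cst_continuous.
  have -> : (fun x => \sum_(z <- y :: t) `|q x z| ^+ 2) =
      (fun x => (q x y * (q x y)^*%R + \sum_(z <- t) `|q x z| ^+ 2)).
    by apply/funext => x; rewrite big_cons normCK.
  by apply: ccontinuousD IH; apply: ccontinuousM; [exact: cqy|exact: cconj].
have cg y : ccontinuous_on D (g y).
  rewrite /ccontinuous_on continuous_subspace_in => x xD.
  have Dx : D x := set_mem xD.
  apply: (@cvgM R[i]); last first.
    apply: (@cvgV R[i]); first exact: hh0.
    exact: (@continuous_subspaceT _ _ D _ chh).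
  apply: (@cvgM R[i]); first exact: cf.
  exact: (@continuous_subspaceT _ _ D _ (cconj y)).
have [k k0 qk] := compact_diag_bound cq pq cD.
(* Cauchy-Schwarz bounds the square of |q(x, y)| by q(y, y) q(x, x), and [k] bounds the second
   factor on [D]. *)
have /choice[Qb HQ] y : exists b : R, 0 <= b /\ forall x, D x -> `|q x y| <= b%:C.
  have /gt0_real_complex[b b0 Eb] := q0 y.
  exists (Num.sqrt (b * k)); split=> [|x Dx]; first exact: sqrtr_ge0.
  have := dominated_le x pq (dominated_section y pq); rewrite Eb => H.
  have s0 : (0 : R[i]) <= (Num.sqrt (b * k))%:C by rewrite ler0c sqrtr_ge0.
  rewrite -(@ler_pXn2r _ 2) ?nnegrE //; apply: le_trans H _.
  have -> : (Num.sqrt (b * k))%:C ^+ 2 = b%:C * k%:C.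
    by rewrite -rmorphXn sqr_sqrtr -?rmorphM // mulr_ge0 // ltW.
  by rewrite ler_wpM2l ?qk // ler0c ltW.
pose B := \sum_(y <- r) Qb y.
have B0 : 0 <= B by apply: sumr_ge0 => y _; case: (HQ y).
have B1 : 0 < B + 1 by rewrite ltr_wpDl.
have d0 : 0 < e / (B + 1) by rewrite divr_gt0.
have /choice[F HF] y : exists F, rkhs p F /\ forall x, D x -> `|F x - g y x| < (e / (B + 1))%:C.
  by have [F rF HF] := dens D cD (g y) (cg y) _ d0; exists F.
exists (fun x => \sum_(y <- r) F y x * q x y).
  apply: (rkhs_sum (F := fun y x => F y x * q x y)) => // y _.
  apply: (rkhs_mul pp pq); first by case: (HF y).
  exact: rkhs_kernel_section.
move=> x Dx.
have Ef : f x = \sum_(y <- r) g y x * q x y.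
  transitivity (\sum_(y <- r) (f x / hh x) * `|q x y| ^+ 2).
    by rewrite -mulr_sumr -/(hh x) divfK // hh0.
  by apply: eq_bigr => y _; rewrite normCK /g; ring.
have -> : \sum_(y <- r) F y x * q x y - f x = \sum_(y <- r) (F y x - g y x) * q x y.
  by rewrite Ef -sumrB; apply: eq_bigr => y _; rewrite mulrBl.
apply: (@le_lt_trans _ _ (e / (B + 1) * B)%:C); last first.
  by rewrite ltcR -mulrA gtr_pMr // mulrC ltr_pdivrMr // mul1r ltrDl.
apply: le_trans (ler_norm_sum _ _ _) _.
rewrite rmorphM rmorph_sum mulr_sumr; apply: ler_sum => y _.
rewrite normrM; have [_ Hy] := HQ y; have [_ HFy] := HF y.
apply: ler_pM; [exact: normr_ge0|exact: normr_ge0| |exact: Hy].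
exact/ltW/HFy.
Qed.

(* Near [x], [t = 1 - q(., x) / q(x, x)] is at most [1/2] in norm, while the
   hypothesis gives [lam A = int_A t^n dlam] for all [n]. *)
Lemma null_sections_cm_is_zero (lam : complex_measure R X) : radon lam -> (forall x, 0 < q x x) ->
  kernel_bounded q ->
  (forall A, measurable A -> forall z, cm_integral lam A (fun x => q x z) = 0) ->
  cm_is_zero lam.
Proof.
move=> rl q0 [M HM] H.
have lamT := carriedT lam.
suff V0 : cm_var lam setT = 0 by move=> A mA; exact: (cm_var0_val (E := setT)).
apply: (locally_null hX) => // x _.
have cqx : ccontinuous (q^~ x) by exact: kernel_section_continuous.
have c0 := q0 x; set c := q x x in c0.
have c20 : 0 < c / 2 by rewrite divr_gt0.
have cn0 : c != 0 by rewrite gt_eqF.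
exists [set y | `|c - q y x| < c / 2]; split.
- rewrite openE => y /= Uy; have d0 : 0 < c / 2 - `|c - q y x| by rewrite subr_gt0.
  have := cqx y => /cvgrPdist_lt/(_ _ d0); apply: filterS => z; rewrite ltrBrDl.
  apply: le_lt_trans; have -> : c - q z x = (c - q y x) + (q y x - q z x) by ring.
  exact: ler_normD.
- by rewrite /= subrr normr0.
move=> A mA AU.
pose t y := 1 + - c^-1 * q y x.
have gq : cbounded_on setT (q^~ x) by apply: (continuous_cbounded_on (M := M)) => // y _; exact: HM.
have gt : cbounded_on setT t by apply: cbounded_onD; [exact: cbounded_on_cst|apply: cbounded_onM => //; exact: cbounded_on_cst].
have gA : cbounded_on setT (fun y => (\1_A y)%:C : R[i]) by exact: cbounded_on_indic.
have gn n : cbounded_on setT (fun y => (\1_A y)%:C * t y ^+ n).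
  elim: n => [|n IH]; first by apply: cbounded_onM => //; exact: cbounded_on_cst.
  have := cbounded_onM IH gt; congr cbounded_on; apply/funext => y.
  by rewrite exprSr mulrA.
have In n : cm_integral lam setT (fun y => (\1_A y)%:C * t y ^+ n) = cm_val lam A.
  elim: n => [|n IH].
    rewrite -(cm_int_indic lam mA); congr cm_integral.
    by apply/funext => y; rewrite expr0 mulr1.
  rewrite -IH.
  (* One more factor [t] changes the integrand by a bounded function times the section of [q] at
     [x], and such products integrate to 0. *)
  have -> : (fun y => (\1_A y)%:C * t y ^+ n.+1) =
      (fun y => (\1_A y)%:C * t y ^+ n + - c^-1 * ((\1_A y)%:C * t y ^+ n * q y x)).
    by apply/funext => y; rewrite exprS {1}/t; ring.
  have gnq := cbounded_onM (gn n) gq.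
  rewrite (cm_intD lamT) //; last by apply: cbounded_onM => //; exact: cbounded_on_cst.
  rewrite (cm_intZ lamT) // (integral_mul_eq0 lamT (gn n) gq) ?mulr0 ?addr0 //.
  by move=> B mB; exact: H.
have tU y : A y -> `|t y| <= 2^-1.
  move=> /AU /= Uy; have -> : t y = (c - q y x) / c by rewrite /t; field.
  rewrite normrM normfV (ger0_norm (ltW c0)) ler_pdivrMr // mulrC ltW //.
have bound n : `|cm_val lam A| <= (2 * (2^-1) ^+ n * cm_var lam A)%:C.
  rewrite -(In n); apply: (cm_int_bound lamT) => // y _.
  rewrite normrM normc_real !indicE; have [Ay|nA] := boolP (y \in A) => /=.
    rewrite normr1 mul1r mulr1 rmorphXn normrX; apply: lerXn2r; rewrite ?nnegrE ?normr_ge0 //.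
      by rewrite ler0c.
    apply: le_trans (tU y (set_mem Ay)) _.
    by rewrite fmorphV rmorph_nat.
  by rewrite normr0 mul0r mulr0.
apply/eqP; rewrite -normr_le0; apply/ler_addgt0Pr => _ /gt0_real_complex[e e0 ->].
have v1 : 0 < 2 * cm_var lam A + 1 by rewrite ltr_wpDl // mulr_ge0 // cm_var_ge0.
have d0 : (0 : R[i]) < (e / (2 * cm_var lam A + 1))%:C by rewrite ltcR divr_gt0.
have [N /(_ N (leqnn N))] := complex_harmonic d0.
have -> : N.+1%:R^-1 = (N.+1%:R^-1)%:C :> R[i] by rewrite fmorphV rmorph_nat.
rewrite ltcR => HN; apply: le_trans (bound N) _; rewrite add0r lecR.
have pw : (2^-1 : R) ^+ N <= N.+1%:R^-1.
  by rewrite exprVn lef_pV2 ?posrE ?exprn_gt0 // -natrX ler_nat ltn_expl.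
apply: (@le_trans _ _ (e / (2 * cm_var lam A + 1) * (2 * cm_var lam A))).
  rewrite mulrAC mulrC ler_wpM2r ?mulr_ge0 ?cm_var_ge0 //.
  exact: le_trans pw (ltW HN).
by rewrite mulrAC -mulrA ger_pMr // ler_pdivrMr // mul1r lerDl.
Qed.

End Products.
End StrictKernels.

(** * Assembly of the three cases *)

Lemma null_form_equiv_step (R : realType) (X : ptopologicalType)
    (p q : X -> X -> R[i]) (lam : complex_measure R X) (S : set (borel X)) (k l : R) :
  kernel_continuous p -> psd p -> kernel_continuous q -> psd q -> carried lam S ->
  0 <= k -> (forall x, S x -> p x x <= k%:C%C) ->
  0 <= l -> (forall x, S x -> q x x <= l%:C%C) ->
  (forall z, (forall F, rkhs p F -> cm_integral lam setT (fun x => F x * q x z) = 0) ->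
    forall A, measurable A -> cm_integral lam A (fun x => q x z) = 0) ->
  (double_integral (kernel_mul p q) lam setT = 0 <->
   forall A, measurable A -> double_integral q lam A = 0).
Proof.
move=> cp pp cq pq lamS k0 pS l0 qS step.
(* [null_form_equiv_at] takes one common bound for both diagonals. *)
have kl0 : 0 <= k + l by rewrite addr_ge0.
have pS' x : S x -> p x x <= (k + l)%:C%C.
  by move=> /pS /le_trans; apply; rewrite lecR lerDl.
have qS' x : S x -> q x x <= (k + l)%:C%C.
  by move=> /qS /le_trans; apply; rewrite lecR lerDr.
apply: (iff_trans (null_form_equiv_at cp pp cq pq lamS kl0 pS' qS' step)).
by split=> H A mA; [apply/(sections_eq0P cq pq lamS kl0 qS' mA)|
  apply/(sections_eq0P cq pq lamS kl0 qS' mA)]; exact: H.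
Qed.

Lemma finite_discrete_carried (R : realType) (X : ptopologicalType)
    (lam : complex_measure R X) : hausdorff_space X -> finite_discrete lam ->
  exists2 s : seq X, uniq s & carried lam [set` s].
Proof.
move=> hX [n [c [x E]]]; exists (undup (codom x)); first exact: undup_uniq.
split=> [|A mA As].
  apply: measurable_borel_compact => //; apply: finite_compact; exact: finite_seq.
rewrite E // big1 // => i _; rewrite indicE memNset ?mulr0 //.
by move=> /As; apply; rewrite /= mem_undup codom_f.
Qed.

Theorem lemma7p5 (R : realType) (X : ptopologicalType) (p q : X -> X -> R[i]) :
  hausdorff_space X ->
  kernel_continuous p -> positive_definite p ->
  kernel_continuous q -> positive_definite q ->
  [/\ spd p ->
        null_form_equiv (@finite_discrete R X) p q /\
        (spd (kernel_mul p q) <-> forall x, 0 < q x x),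
      universal p ->
        null_form_equiv (@radon_compact R X) p q /\
        (universal (kernel_mul p q) <-> forall x, 0 < q x x) &
      ispd p -> kernel_bounded q ->
        null_form_equiv (@radon R X) p q /\
        (ispd (kernel_mul p q) <-> forall x, 0 < q x x)].
Proof.
move=> hX cp /positive_definite_psd pp cq /positive_definite_psd pq.
have ppq := kernel_mul_psd pp pq; have cpq := kernel_mul_continuous cp cq.
have diag := kernel_mul_diag (p := p) pq.
split.
- move=> sp; split=> [lam Nlam|].
    have [s us lamS] := finite_discrete_carried hX Nlam.
    have cs : compact [set` s] by apply: finite_compact; exact: finite_seq.
    have [k k0 pS] := compact_diag_bound cp pp cs.
    have [l l0 qS] := compact_diag_bound cq pq cs.
    apply: (null_form_equiv_step cp pp cq pq lamS k0 pS l0 qS) => z.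
    exact: (spd_step cp pp cq pq hX sp us lamS).
  split=> [spq x|]; last exact: spd_mul.
  by apply: diag; exact: spd_diag spq.
- move=> up; split=> [lam [rl cS]|].
    have lamS := carried_support hX rl (measurable_borel_compact hX cS).
    have [k k0 pS] := compact_diag_bound cp pp cS.
    have [l l0 qS] := compact_diag_bound cq pq cS.
    apply: (null_form_equiv_step cp pp cq pq lamS k0 pS l0 qS) => z.
    apply: (universal_step hX cp pp up rl cS lamS).
    exact: (rkhs_cbounded_on cq pq l0 qS (rkhs_kernel_section z pq)).
  split=> [upq x|]; last exact: universal_mul.
  by apply: diag; exact: universal_diag upq.
move=> ip bq; have [[M HM] _ _ _] := ip; have [N HN] := bq.
have nonneg (K : X -> X -> R[i]) (L : R) : (forall x y, `|K x y| <= L%:C%C) ->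
    0 <= L /\ forall x, K x x <= `|K x x| -> K x x <= L%:C%C.
  move=> HL; split=> [|x H]; last exact: le_trans H (HL x x).
  by rewrite -ler0c (le_trans (normr_ge0 (K point point))).
have [M0 pM] := nonneg p M HM; have [N0 qN] := nonneg q N HN.
have gq z : cbounded_on setT (fun x => q x z).
  apply: (continuous_cbounded_on (M := N)); first exact: kernel_section_continuous.
  by move=> x _; exact: HN.
have pS x : setT x -> p x x <= M%:C%C by move=> _; apply: pM; rewrite ger0_norm ?psd_diag.
have qS x : setT x -> q x x <= N%:C%C by move=> _; apply: qN; rewrite ger0_norm ?psd_diag.
have step (lam : complex_measure R X) (rl : radon lam) z :
    (forall F, rkhs p F -> cm_integral lam setT (fun x => F x * q x z) = 0) ->
    forall A, measurable A -> cm_integral lam A (fun x => q x z) = 0.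
  by apply: (ispd_step hX cp pp ip rl).
split=> [lam rl|].
  exact: (null_form_equiv_step cp pp cq pq (carriedT lam) M0 pS N0 qS (step lam rl)).
split=> [ipq x|q0].
  by apply: diag; exact: ispd_diag ipq.
split.
- exists (M * N) => x y; rewrite normrM rmorphM ler_pM //.
- exact: psd_positive_definite.
- exact: rkhs_continuous.
(* Vanishing of the form of the product kernel gives q(., z) lam = 0 for all [z]; positivity of the
   diagonal of [q] then leaves only the zero measure. *)
move=> lam rl D0; apply: (null_sections_cm_is_zero hX cq rl q0 bq).
have MN0 : 0 <= M + N by rewrite addr_ge0.
apply: (null_form_equiv_at cp pp cq pq (carriedT lam) MN0 _ _ (step lam rl)).1 => // x Tx.
  by apply: le_trans (pS x Tx) _; rewrite lecR lerDl.
by apply: le_trans (qS x Tx) _; rewrite lecR lerDr.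
Qed.
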